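(* Let $L\ge 2$, $1\le N\le L-1$, and fix initial and final states $S_{\rm in},S_{\rm fin}$. For $\tau>0$ and $\varepsilon>0$ let $M=M(\varepsilon)$ be integers with $\varepsilon M\to\tau$ as $\varepsilon\to0$, and consider the random $\varepsilon$-weighted evolution of height $M$ from $S_{\rm in}$ to $S_{\rm fin}$, with rescaled time (level $j\in\{0,\dots,M\}$ corresponds to time $\varepsilon j-\frac{\tau}{2}$). Let first $\varepsilon\to 0$, obtaining a random process on the time interval $[-\frac{\tau}{2},\frac{\tau}{2}]$, and then let $\tau\to\infty$. Then these processes converge (in law on every bounded time window $[a,b]$, jointly for the stone configuration and for the places and times of the jumps) to the limit process on $\mathbb{R}$ given by coupling (independently) the maximal entropy measure of the two-sided topological Markov chain, which gives the successive states, with a Poisson process on $\mathbb{R}$ of constant intensity, which gives the moments of the jumps. The intensity of the Poisson process equals $e^h$, where $h=\log\frac{\sin(\pi N/L)}{\sin(\pi/L)}$ is the entropy of the Markov chain. Explicitly, the limit process is $(\eta_t)_{t\in\mathbb{R}}$ with $\eta_t=X_i$ for $t\in[s_i,s_{i+1})$, where $(X_i)_{i\in\mathbb{Z}}$ is distributed according to the maximal entropy measure, and $\dots<s_{-1}<s_0\le 0<s_1<s_2<\dots$ are the points of a Poisson process of intensity $e^h$ on $\mathbb{R}$ independent of $(X_i)$.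
   Context: **Topological Markov chain.** States are $N$-element subsets $S\subset\mathbb{Z}/L\mathbb{Z}$ (holes on a circle of length $L$ occupied by stones). A transition $S\to S'$ is allowed iff $S'=(S\setminus\{k\})\cup\{k+1\}$ for some $k\in S$ with $k+1\notin S$. The two-sided topological Markov chain is the shift on bi-infinite sequences $(X_i)_{i\in\mathbb{Z}}$ of states with all transitions $X_i\to X_{i+1}$ allowed. Its maximal entropy measure is the (unique) shift-invariant probability measure of maximal entropy (Parry measure). **$\varepsilon$-weighted evolution of height $M$.** A configuration is an evolution $S_{\rm in}=S_0,S_1,\dots,S_M=S_{\rm fin}$ in which at each of the $M$ steps every stone either stays in its hole or moves (''jumps'') to the next hole in the positive direction, the resulting positions being pairwise distinct. So at one step there may be no jumps or several simultaneous jumps, and a stone may move into a hole that is being vacated at the same step. (These are the dimer covers of a hexagonal-type graph on a cylinder: white vertices $(k,j)$ are joined to black vertices $(k,j)$, $(k,j+1)$, $(k+1,j+1)$, the corresponding edges encoding ''no stone at $(k,j)$'', ''stone stays'' and ''stone jumps''.) The weight of a configuration is $\varepsilon^{\#\text{jumps}}$, and the configuration is chosen with probability proportional to its weight. The place of a jump is the hole $k$ which the stone leaves, and its time is the time of its level. *)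

(* Defs.v *)
From HB Require Import structures.
From mathcomp Require Import all_boot all_order all_algebra.
From mathcomp Require Import all_classical all_reals all_analysis.

Set Implicit Arguments.
Unset Strict Implicit.
Unset Printing Implicit Defensive.

Import Order.TTheory GRing.Theory Num.Theory.
Import numFieldNormedType.Exports.

Local Open Scope classical_set_scope.
Local Open Scope ring_scope.

HB.instance Definition _ (T : finType) := isPointed.Build {set T} finset.set0.
HB.instance Definition _ (T : finType) :=
  @isMeasurable.Build default_measure_display {set T}
    discrete_measurable discrete_measurable0
    discrete_measurableC discrete_measurableU.

Definition coord_cylinders d (T : measurableType d) : set (set (int -> T)) :=
  [set C | exists i (B : set T), measurable B /\ C = [set x | B (x i)]].

Arguments coord_cylinders {d} T.

Definition Zseq d (T : measurableType d) :=
  g_sigma_algebraType (coord_cylinders T).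
Arguments Zseq {d} T.

(* The holes are 'I_L and ordS is the cyclic successor. The ambient alphabet is
   {set 'I_L}; states are the sets of cardinality N. *)

Definition jump_at L (k : 'I_L) (S S' : {set 'I_L}) : bool :=
  [&& k \in S, ordS k \notin S & S' == ordS k |: (S :\ k)].

Definition step L (S S' : {set 'I_L}) : bool := [exists k, jump_at k S S'].

Definition chain L N : set (int -> {set 'I_L}) :=
  [set X : int -> {set 'I_L} |
     (forall i, #|X i| = N) /\ (forall i, step (X i) (X (i + 1)))].

Definition shift (T : Type) (X : int -> T) : int -> T := fun i => X (i + 1).

Section entropy.
Context {R : realType} {L : nat}.
Implicit Types mu : probability (Zseq {set 'I_L}) R.

Definition word_prob mu n (w : {ffun 'I_n -> {set 'I_L}}) : R :=
  fine (mu [set X : int -> {set 'I_L} | forall i : 'I_n, X (Posz i) = w i]).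

Definition block_entropy mu n : R :=
  - \sum_(w : {ffun 'I_n -> {set 'I_L}}) word_prob mu w * ln (word_prob mu w).

(* The entropy of the shift with respect to mu: the partition according to the
   coordinate 0 is generating. *)
Definition entropy mu : R := limn (fun n => block_entropy mu n / n%:R).

Definition invariant_on_chain N mu : Prop :=
  mu (chain N) = 1%E /\
  forall A : set (Zseq {set 'I_L}), measurable A ->
    mu [set X | A (shift X)] = mu A.

Definition max_entropy_measure N mu : Prop :=
  invariant_on_chain N mu /\
  forall nu : probability (Zseq {set 'I_L}) R,
    invariant_on_chain N nu -> entropy nu <= entropy mu.

End entropy.

Definition chain_words L N n : {set {ffun 'I_n -> {set 'I_L}}} :=
  [set w : {ffun 'I_n -> {set 'I_L}} |
     `[< exists2 X, chain N X & forall i : 'I_n, X (Posz i) = w i >]]%SET.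

Definition topological_entropy (R : realType) L N : R :=
  limn (fun n => ln #|chain_words L N n|%:R / n%:R).

(* Law of the increasing enumeration s of the points, normalised by
   s 0 <= 0 < s 1: counts in disjoint intervals are independent and Poisson
   distributed. *)
Definition poisson_process (R : realType) (lam : R)
    (P : probability (Zseq (measurableTypeR R)) R) : Prop :=
  P [set s : int -> R | [/\ forall i, s i < s (i + 1), s 0 <= 0 < s 1 &
       forall r : R, exists i j, s i < r < s j]] = 1%E /\
  forall (n : nat) (a b : 'I_n -> R) (c : 'I_n -> nat),
    (forall l, a l < b l) ->
    trivIset setT (fun l => `]a l, b l]%classic) ->
    P [set s : int -> R | forall l, ([set i | (a l < s i <= b l)%R] #= `I_(c l))%card] =
      (\prod_(l < n) poisson_pmf (lam * (b l - a l)) (c l))%:E.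

(* An element of [events] is a jump time, the set of holes left at that time and
   the state reached. *)
Record trajectory (R : realType) (L : nat) := Trajectory {
  start : {set 'I_L} ;
  events : seq (R * ({set 'I_L} * {set 'I_L})) }.

Section trajectory_space.
Context {R : realType} {L : nat}.

HB.instance Definition _ := gen_eqMixin (trajectory R L).
HB.instance Definition _ := gen_choiceMixin (trajectory R L).
HB.instance Definition _ :=
  isPointed.Build (trajectory R L) (Trajectory finset.set0 [::]).

(* The topology: trajectories are close when they have the same initial state
   and the same successive marks, at close times. That is, the disjoint union
   of the spaces R^n over all initial states and lists of n marks. *)
Definition trajectory_at (S : {set 'I_L})
    (m : seq ({set 'I_L} * {set 'I_L})) (t : 'rV[R]_(size m)) :
    trajectory R L :=
  Trajectory S [seq (t ord0 i, tnth (in_tuple m) i) | i <- enum 'I_(size m)].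

Definition trajectory_open : set_system (trajectory R L) :=
  [set U | forall S m, open (@trajectory_at S m @^-1` U)].

Lemma trajectory_openT : trajectory_open setT.
Proof. by move=> S m; rewrite preimage_setT; exact: openT. Qed.

Lemma trajectory_openI : setI_closed trajectory_open.
Proof. by move=> A B oA oB S m; rewrite preimage_setI; exact: openI. Qed.

Lemma trajectory_open_bigU (I : Type) (f : I -> set (trajectory R L)) :
  (forall i, trajectory_open (f i)) -> trajectory_open (\bigcup_i f i).
Proof.
by move=> fo S m; rewrite preimage_bigcup; apply: bigcup_open => i _; exact: fo.
Qed.

HB.instance Definition _ := isOpenTopological.Build (trajectory R L)
  trajectory_openT trajectory_openI trajectory_open_bigU.

(* The part of a trajectory in [a, b]; its initial state is the one in force
   when the window opens, before any jump taking place at time a. *)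
Definition window (a b : R) (w : trajectory R L) : trajectory R L :=
  Trajectory (last (start w) [seq e.2.2 | e <- events w & e.1 < a])
             [seq e <- events w | a <= e.1 <= b].

End trajectory_space.

Definition borel_trajectory (R : realType) (L : nat) :=
  g_sigma_algebraType (@open (trajectory R L)).

(* Convergence in law, laws being given by the expectations E i f of the test
   functions f. *)
Definition cvg_in_law (R : realType) (L : nat) (I : Type) (F : set_system I)
    (E : I -> (trajectory R L -> R) -> R) (E0 : (trajectory R L -> R) -> R) :
    Prop :=
  forall f : trajectory R L -> R, continuous f ->
    (exists C : R, forall w, `|f w| <= C) ->
    E i f @[i --> F] --> E0 f.

Section evolutions.
Context {L M : nat}.

(* The states at the levels 0, ..., M and, for each of the M steps, the set of
   holes left by the jumping stones. *)
Definition configuration : finType :=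
  ({ffun 'I_M.+1 -> {set 'I_L}} * {ffun 'I_M -> {set 'I_L}})%type.

Implicit Types (c : configuration) (j : 'I_M).

Definition state_before c j : {set 'I_L} := c.1 (widen_ord (leqnSn M) j).
Definition state_after c j : {set 'I_L} := c.1 (lift ord0 j).
Definition jumps c j : {set 'I_L} := c.2 j.

Definition move (J : {set 'I_L}) (k : 'I_L) : 'I_L :=
  if k \in J then ordS k else k.

Definition evolution (Sin Sfin : {set 'I_L}) c : bool :=
  [&& c.1 ord0 == Sin, c.1 ord_max == Sfin &
   [forall j, [&& jumps c j \subset state_before c j,
      dinjectiveb (move (jumps c j)) (mem (state_before c j)) &
      state_after c j == move (jumps c j) @: state_before c j]]].

Definition weight {R : realType} (eps : R) c : R :=
  eps ^+ (\sum_(j < M) #|jumps c j|).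

Definition evolution_mean {R : realType} (eps : R) (Sin Sfin : {set 'I_L})
    (F : configuration -> R) : R :=
  (\sum_(c | evolution Sin Sfin c) weight eps c * F c) /
  (\sum_(c | evolution Sin Sfin c) weight eps c).

(* The jumps from level j to level j + 1 leave the holes of level j, hence take
   place at time eps * j - tau / 2, up to which the state is that of level j. *)
Definition evolution_trajectory {R : realType} (tau eps : R) c :
    trajectory R L :=
  Trajectory (c.1 ord0)
    [seq (eps * (j : nat)%:R - tau / 2, (jumps c j, state_after c j))
       | j <- enum 'I_M & jumps c j != finset.set0].

End evolutions.
Arguments configuration : clear implicits.

Section limit_process.
Context {R : realType} {L : nat}.
Implicit Types (X : int -> {set 'I_L}) (s : int -> R).

Definition clock s (t : R) : int :=
  xget 0 [set i : int | s i <= t < s (i + 1)].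

Definition eta X s (t : R) : {set 'I_L} := X (clock s t).

(* The restriction of eta to [a, b], a jump at the time a itself being
   neglected (it almost surely does not occur); the jumps in ]a, b] occur at the times s i with
   clock s a < i <= clock s b, from the state X (i - 1) to X i. *)
Definition limit_window (a b : R) X s : trajectory R L :=
  Trajectory (eta X s a)
    [seq let i := clock s a + 1 + Posz n in
         (s i, ([set k | jump_at k (X (i - 1)) (X i)]%SET, X i))
       | n <- iota 0 `|clock s b - clock s a|%N].

End limit_process.

(* Main.v *)
(* On N-element states, psi S = prod_(i < j in S) |sin (pi (i - j) / L)|, the
   modulus of a Vandermonde determinant, is a positive eigenvector of the
   transition matrix A and of its transpose, with eigenvalue
   lam = sin (pi N / L) / sin (pi / L).  The Parry measure gives the word
   S_0 ... S_n the mass psi S_0 psi S_n / (|psi|^2 lam^n); the entropy of any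
   other invariant measure is ln lam minus a nondecreasing limit of relative
   entropies to the Parry transitions, whence maximality and uniqueness.

   As eps -> 0, evolutions with simultaneous jumps become negligible, and the
   weighted sums over the others are Riemann sums converging to a sum over n of
   integrals over n ordered jump times marked by holes (dominated convergence).
   The kernel E^t = exp (t A) obtained from the constant functional is a
   positive semigroup, and a Doeblin minorization gives
   exp (- lam t) E^t(S, S') -> psi S psi S' / |psi|^2.  Cutting at the ends of
   [a, b] writes the bridge functional as
   sum_(U, V) E^(t1)(Sin, U) K(U, V) E^(t3)(V, Sfin), which therefore tends to
   exp (- lam (b - a)) sum_(U, V) psi U psi V K(U, V) / |psi|^2.  The coupled
   process gives the same value: on a fine grid of [a, b] the pattern of cells
   occupied by the Poisson points has probability
   exp (- lam (b - a)) (lam delta)^n, and lam^n cancels the denominator of the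
   mass of a word of n + 1 states. *)
From HB Require Import structures.
Require Import Defs.
From mathcomp Require Import all_boot all_order all_algebra.
From mathcomp Require Import all_classical all_reals all_analysis.
From mathcomp Require Import measurable_realfun complex.
From mathcomp Require Import ring lra zify.

Set Implicit Arguments.
Unset Strict Implicit.
Unset Printing Implicit Defensive.

Import Order.TTheory GRing.Theory Num.Theory.
Import numFieldNormedType.Exports.

Local Open Scope classical_set_scope.
Local Open Scope ring_scope.

(** * The Perron eigenvector *)

(** No iterated integral and no matrix exponential is manipulated. A continuous-time object is the
    limit [mlim] of sums [msum] over a grid of times, so that the semigroup law, the cutting of the
    window and the comparison with the Poisson clock are exact finite identities between such sums,
    which then pass to the limit. [msum_cvg] leaves the mesh, the length and the origin of the grid
    free, hence each identity may be proved on the grid that suits it. The convergence itself is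
    probabilistic: up to an explicit factor, the terms with n jumps are expectations under n
    independent uniform marked points rounded to cells, and the rounding converges pointwise. The
    obstacle there is that [window] is discontinuous at trajectories with a jump at an end of
    [a, b]; [cont_off] records these exceptional times, which the random points almost surely avoid.
    Jumps are marked by holes, so that marks range over a fixed finite type and the legality of a
    path becomes part of the functional ([bridge]). *)

Section free_fermions.

Lemma size_monicB (F : idomainType) (p q : {poly F}) n :
  p \is monic -> q \is monic -> size p = n.+1 -> size q = n.+1 -> (size (p - q)%R <= n)%N.
Proof.
move=> pm qm ps qs; apply/leq_sizeP => j nj; rewrite coefB.
have [->|jn] := eqVneq j n.
  move: pm qm; rewrite !monicE /lead_coef ps qs /= => /eqP -> /eqP ->.
  by rewrite subrr.
have nj' : (n.+1 <= j)%N by rewrite ltn_neqAle eq_sym jn.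
by rewrite !nth_default ?subrr // ?ps ?qs.
Qed.

Context {F : fieldType} {I : finType}.

(* Lagrange interpolation at 0 of the polynomial
   prod_i ('X - z i / q) - prod_i ('X - z i), of degree less than #|S|. *)
Lemma sum_prod_qshift (S : {set I}) (z : I -> F) (q : F) :
    {in S &, injective z} -> (forall i, i \in S -> z i != 0) -> q != 0 ->
  (1 - q) * (\sum_(k in S) \prod_(i in S :\ k) ((q * z k - z i) / (z k - z i))) =
  1 - q ^+ #|S|.
Proof.
move=> zI z0 q0.
pose P := \prod_(i in S) ('X - (z i / q)%:P) - \prod_(i in S) ('X - (z i)%:P).
pose l k := \prod_(i in S :\ k) ((z k - z i)^-1 *: ('X - (z i)%:P)).
pose T := P - \sum_(k in S) P.[z k] *: l k.
have zB i j : i \in S -> j \in S -> i != j -> z i - z j != 0.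
  by move=> iS jS; apply: contra; rewrite subr_eq0 => /eqP /zI ->.
have lE k j : k \in S -> j \in S -> (l k).[z j] = (j == k)%:R.
  move=> kS jS; rewrite /l horner_prod; case: eqVneq => [->|jk].
    rewrite big1 // => i /setD1P[ik iS]; rewrite !hornerE mulVf //.
    by apply: zB => //; rewrite eq_sym.
  rewrite (bigD1 j) /=; last by rewrite !inE jk jS.
  by rewrite !hornerE subrr mulr0 mul0r.
have sz (y : I -> F) (A : {set I}) : size (\prod_(i in A) ('X - (y i)%:P)) = #|A|.+1.
  by rewrite -big_enum /= size_prod_XsubC cardE.
have mon (y : I -> F) (A : {set I}) : \prod_(i in A) ('X - (y i)%:P) \is monic.
  by apply: monic_prod => i _; exact: monicXsubC.
have TE x : T.[x] = P.[x] - \sum_(k in S) P.[z k] * (l k).[x].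
  by rewrite /T hornerD hornerN horner_sum; under eq_bigr do rewrite hornerZ.
have T0 : T = 0.
  apply: (@roots_geq_poly_eq0 _ _ [seq z i | i <- enum S]).
  - apply/allP => x /mapP[j]; rewrite mem_enum => jS ->.
    rewrite /root TE (bigD1 j) //= lE // eqxx mulr1.
    rewrite big1 ?addr0 ?subrr // => k /andP[kS kj].
    by rewrite lE // eq_sym (negPf kj) mulr0.
  - by rewrite map_inj_in_uniq ?enum_uniq // => i j; rewrite !mem_enum; exact: zI.
  - rewrite size_map -cardE (leq_trans (size_polyD _ _)) // size_polyN geq_max.
    rewrite {1}/P size_monicB //=.
    apply: (leq_trans (size_sum _ _ _)); apply/bigmax_leqP => k kS.
    rewrite (leq_trans (size_scale_leq _ _)) // /l scaler_prod.
    by rewrite (leq_trans (size_scale_leq _ _)) // sz (cardsD1 k S) kS.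
have Z0 : \prod_(i in S) - z i != 0.
  by apply/prodf_neq0 => i iS; rewrite oppr_eq0 z0.
have P0 : P.[0] = \prod_(i in S) - z i * (q ^- #|S| - 1).
  rewrite /P hornerD hornerN !horner_prod.
  under eq_bigr do rewrite !hornerE -mulNr.
  under [X in _ - X]eq_bigr do rewrite !hornerE.
  by rewrite big_split /= prodr_const exprVn mulrBr mulr1.
have Pk k : k \in S -> P.[z k] = z k * (q - 1) * q ^- #|S| * \prod_(i in S :\ k) (q * z k - z i).
  move=> kS; rewrite /P hornerD hornerN !horner_prod.
  rewrite [X in _ - X](bigD1 k) //= !hornerE subrr mul0r subr0.
  rewrite (eq_bigr (fun i => q^-1 * (q * z k - z i))); last first.
    by move=> i _; rewrite !hornerE; field.
  rewrite big_split /= prodr_const exprVn (bigD1 k) //= [RHS]mulrAC [in LHS]mulrC.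
  congr (_ * _ * _); first by ring.
  by apply: eq_bigl => i; rewrite !inE andbC.
have := congr1 (horner^~ 0) T0; rewrite TE horner0 P0 => /eqP.
rewrite subr_eq0 => /eqP E.
have {}E : \prod_(i in S) - z i * (q ^- #|S| - 1) =
    \prod_(i in S) - z i * (q ^- #|S| * (1 - q) *
     \sum_(k in S) \prod_(i in S :\ k) ((q * z k - z i) / (z k - z i))).
  rewrite E !mulr_sumr; apply: eq_bigr => k kS.
  have -> : (l k).[0] = \prod_(i in S :\ k) ((z k - z i)^-1 * - z i).
    by rewrite /l horner_prod; apply: eq_bigr => i _; rewrite !hornerE.
  rewrite Pk //.
  rewrite [\prod_(i in S) _](bigD1 k) //= [\prod_(i in S | _) _](eq_bigl (mem (S :\ k))); last first.
    by move=> i; rewrite !inE andbC.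
  rewrite !big_split /=; ring.
move/(mulfI Z0): E => /(congr1 (fun x => x * q ^+ #|S|)).
rewrite mulrBl mulVf ?expf_neq0 // mul1r => ->.
by field; rewrite expf_neq0.
Qed.
End free_fermions.

Section trig.
Context {R : realType}.
Local Open Scope complex_scope.
Let e (t : R) : R[i] := cos t +i* sin t.

Let eD s t : e (s + t) = e s * e t.
Proof. by rewrite /e cosD sinD; simpc; congr Complex; ring. Qed.

Let e_neq0 t : e t != 0.
Proof.
apply/eqP => -[c0 s0]; have := cos2Dsin2 t; rewrite c0 s0 expr0n addr0 => /eqP.
by rewrite eq_sym oner_eq0.
Qed.

Let eB s t : e (2 * s) - e (2 * t) = e (s + t) * ((2 * sin (s - t))%:C * 'i).
Proof.
have -> : 2 * s = (s + t) + (s - t) by ring.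
have -> : 2 * t = (s + t) - (s - t) by ring.
rewrite [LHS](_ : _ = e (s + t) * (e (s - t) - e (- (s - t)))); last first.
  by rewrite mulrBr -!eD.
by congr (_ * _); rewrite /e cosN sinN; simpc; congr Complex; ring.
Qed.

(** This is [sum_prod_qshift] at the points exp (2 i t_k) of the unit circle, with q = exp (2 i a):
    each ratio of sines is the corresponding ratio of complex numbers up to the phase exp (i a), and
    every product has the same number #|S| - 1 of such phases. *)
Lemma sum_prod_sin (I : finType) (S : {set I}) (t : I -> R) (a : R) :
    {in S &, forall i j, i != j -> sin (t i - t j) != 0} -> sin a != 0 ->
  \sum_(k in S) \prod_(i in S :\ k) (sin (t k + a - t i) / sin (t k - t i)) =
  sin (#|S|%:R * a) / sin a.
Proof.
move=> tS a0.
pose z i := e (2 * t i); pose q := e (2 * a).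
have e2 s (n : nat) : e (s *+ n) = e s ^+ n.
  elim: n => [|n IHn]; last by rewrite mulrS eD IHn exprS.
  by rewrite mulr0n expr0 /e cos0 sin0.
have i0 : 'i != 0 :> R[i] by rewrite eq_complex /= oner_eq0 andbF.
have inj : {in S &, injective z}.
  move=> i j iS jS zij; apply/eqP; apply: contraT => ij.
  have := eB (t i) (t j); rewrite -/(z i) -/(z j) zij subrr => /esym/eqP.
  rewrite mulf_eq0 (negPf (e_neq0 _)) /= mulf_eq0 (negPf i0) orbF.
  rewrite eq_complex /= eqxx andbT mulf_eq0 pnatr_eq0 /= => s0.
  by rewrite (negPf (tS _ _ iS jS ij)) in s0.
have [->|[k0 k0S]] := set_0Vmem S.
  by rewrite big_set0 cards0 mul0r sin0 mul0r.
have qz k i : q * z k - z i = e a * (e (t k + t i) * ((2 * sin (t k + a - t i))%:C * 'i)).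
  rewrite -eD (_ : 2 * a + 2 * t k = 2 * (t k + a)); last by ring.
  by rewrite eB [RHS]mulrA -eD; congr (e _ * _); ring.
have ratio k i : k \in S -> i \in S :\ k ->
    (q * z k - z i) / (z k - z i) = e a * (sin (t k + a - t i) / sin (t k - t i))%:C.
  move=> kS /setD1P[ik iS]; rewrite qz eB.
  have s0 : (sin (t k - t i))%:C != 0.
    by rewrite eq_complex /= eqxx andbT tS // eq_sym.
  rewrite !rmorphM /= fmorphV.
  field.
  by apply/and3P; split=> //; exact: e_neq0.
have := @sum_prod_qshift _ _ S z q inj (fun i _ => e_neq0 _) (e_neq0 _).
rewrite (eq_bigr (fun k => e a ^+ #|S|.-1 *
   (\prod_(i in S :\ k) (sin (t k + a - t i) / sin (t k - t i)))%:C)); last first.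
  move=> k kS; rewrite (eq_bigr _ (fun i => ratio k i kS)) big_split /= prodr_const.
  by rewrite (cardsD1 k S) kS rmorph_prod.
rewrite -mulr_sumr -rmorph_sum /=.
set X := \sum_(k in S) _.
have e0 : e 0 = 1 by rewrite /e cos0 sin0.
have -> : 1 - q = e a * ((2 * sin (- a))%:C * 'i).
  by rewrite -e0 /q -{1}[0](mulr0 2) eB add0r sub0r.
have -> : 1 - q ^+ #|S| = e a ^+ #|S| * ((2 * sin (- (#|S|%:R * a)))%:C * 'i).
  rewrite /q -!e2 (_ : 2 * a *+ #|S| = 2 * (#|S|%:R * a)); last by rewrite -mulr_natl; ring.
  by rewrite -e0 -{1}[0](mulr0 2) eB add0r sub0r mulr_natl.
rewrite (_ : #|S| = #|S|.-1.+1); last by rewrite prednK // (cardsD1 k0) k0S.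
rewrite -pred_Sn => /eqP; rewrite [X in X == _](_ : _ =
  e a ^+ #|S|.-1.+1 * ((2 * sin (- a) * X)%:C * 'i)); last first.
  by rewrite exprS !rmorphM /=; ring.
rewrite -subr_eq0 -mulrBr mulf_eq0 expf_eq0 (negPf (e_neq0 _)) andbF /=.
rewrite -mulrBl mulf_eq0 (negPf i0) orbF -rmorphB /= eq_complex /= eqxx andbT.
rewrite !sinN subr_eq0 => /eqP E.
apply: (mulfI a0); rewrite mulrCA divff // mulr1; lra.
Qed.
End trig.

(** * The exclusion graph and its reflection *)

Definition hop L (S : {set 'I_L}) (k : 'I_L) : {set 'I_L} := ordS k |: (S :\ k).
Definition free L (S : {set 'I_L}) (k : 'I_L) : bool := (k \in S) && (ordS k \notin S).

Section exclusion_graph.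
Context {L : nat}.
Implicit Types (S : {set 'I_L}) (k : 'I_L).

Lemma jump_atE k S S' : jump_at k S S' = free S k && (S' == hop S k).
Proof. by rewrite /jump_at /free andbA. Qed.

Lemma card_hop S k : free S k -> #|hop S k| = #|S|.
Proof.
by case/andP=> kS Sk; rewrite /hop cardsU1 !inE (negPf Sk) andbF (cardsD1 k S) kS.
Qed.

Lemma hop_inj S k k' : free S k -> free S k' -> hop S k = hop S k' -> k = k'.
Proof.
move=> /andP[kS Sk] /andP[k'S Sk'] /setP/(_ k); rewrite !inE eqxx /= orbF.
rewrite kS andbT (_ : (k == ordS k) = false); last first.
  by apply/negbTE; apply: contra Sk => /eqP <-.
rewrite (_ : (k == ordS k') = false); last first.
  by apply/negbTE; apply: contra Sk' => /eqP <-.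
by rewrite /=; case: eqP.
Qed.

Lemma stepP S S' : reflect (exists2 k, free S k & S' = hop S k) (step S S').
Proof.
apply: (iffP existsP) => [[k]|[k kf ->]].
  by rewrite jump_atE => /andP[kf /eqP ->]; exists k.
by exists k; rewrite jump_atE kf eqxx.
Qed.

Lemma card_step S S' : step S S' -> #|S'| = #|S|.
Proof. by case/stepP => k kf ->; exact: card_hop. Qed.

(** By [hop_inj] distinct free stones lead to distinct states, so successors of S and free stones of
    S are in bijection. *)
Lemma sum_step (V : nmodType) S (f : {set 'I_L} -> V) :
  \sum_(S' | step S S') f S' = \sum_(k | free S k) f (hop S k).
Proof.
rewrite (partition_big_imset (hop S)) /= (eq_bigl (mem (hop S @: free S))); last first.
  move=> S'; rewrite inE; apply/stepP/imsetP => -[k kf ->]; exists k => //.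
apply: eq_bigr => S' /imsetP[k kf ->].
rewrite (eq_bigl (pred1 k)) ?big_pred1_eq // => k'.
apply/andP/eqP => [[k'f /eqP]|->]; last by [].
exact: hop_inj.
Qed.

(** The reflection k -> L - 1 - k of the circle reverses the direction of every jump, hence carries
    the graph to its transpose ([mirror_step]). It yields the left eigenvector from the right
    one. *)
Definition mirror S : {set 'I_L} := (@rev_ord L) @: S.

Lemma mirrorK : involutive mirror.
Proof.
move=> S; rewrite /mirror -imset_comp (eq_imset _ (g := id)) ?imset_id // => k /=.
by rewrite rev_ordK.
Qed.

Lemma in_mirror S k : (k \in mirror S) = (rev_ord k \in S).
Proof. by rewrite -{1}[k]rev_ordK mem_imset //; exact: rev_ord_inj. Qed.

Lemma card_mirror S : #|mirror S| = #|S|.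
Proof. by rewrite card_imset //; exact: rev_ord_inj. Qed.

Lemma ordS_rev_ord k : ordS (rev_ord (ordS k)) = rev_ord k.
Proof.
apply/val_inj => /=; have := ltn_ord k; case: (ltngtP k.+1 L) => // [kL|kL] _.
  by rewrite (modn_small kL) subnSK // modn_small //; lia.
rewrite kL modnn (_ : (L - 1).+1 = L); last by lia.
by rewrite modnn subnn.
Qed.

Lemma mirror_step S S' : step (mirror S') (mirror S) = step S S'.
Proof.
suff H S1 S2 : step S1 S2 -> step (mirror S2) (mirror S1).
  by apply/idP/idP => /H //; rewrite !mirrorK.
case/stepP => k /andP[kS Sk] ->; apply/stepP; exists (rev_ord (ordS k)).
  rewrite /free ordS_rev_ord !in_mirror !rev_ordK !inE !eqxx /= orbF.
  by apply: contra Sk => /eqP <-.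
apply/setP => i; rewrite /hop ordS_rev_ord !inE !in_mirror !inE.
rewrite -(inj_eq rev_ord_inj) rev_ordK -(inj_eq rev_ord_inj i) rev_ordK.
case: eqVneq => [->|ik] //=; rewrite ?kS //=.
by case: eqVneq => [->|//] /=; rewrite (negPf Sk).
Qed.

End exclusion_graph.

(** * The Vandermonde eigenvector and its eigenvalue *)

Definition lam (R : realType) (L N : nat) : R :=
  sin (pi * N%:R / L%:R) / sin (pi / L%:R).

Section ground_state.
Context {R : realType} {L : nat}.
Implicit Types (S : {set 'I_L}) (i j k : 'I_L).

Let ang (i : 'I_L) : R := pi * i%:R / L%:R.

Definition psi S : R := \prod_(i in S) \prod_(j in S | (i < j)%N) `|sin (ang i - ang j)|.

Let L_gt0 k : (0 : R) < L%:R.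
Proof. by rewrite ltr0n (leq_ltn_trans _ (ltn_ord k)). Qed.

Let angB k i : ang k - ang i = pi * (k%:R - i%:R) / L%:R.
Proof. by rewrite /ang; ring. Qed.

Let sin_ang_gt0 i j : (i < j)%N -> 0 < sin (ang j - ang i).
Proof.
move=> ij; apply: sin_gt0_pi; rewrite angB.
have L0 := L_gt0 i; have p0 := pi_gt0 R.
have ij' : (i%:R : R) < j%:R by rewrite ltr_nat.
have jL : (j%:R : R) < L%:R by rewrite ltr_nat.
have i0 : (0 : R) <= i%:R by [].
rewrite divr_gt0 ?mulr_gt0 ?subr_gt0 //= ltr_pdivrMr // ltr_pM2l //; lra.
Qed.

Let sin_ang_neq0 i j : i != j -> sin (ang i - ang j) != 0.
Proof.
rewrite -val_eqE /= neq_ltn => /orP[] ij; last by rewrite gt_eqF // sin_ang_gt0.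
by rewrite -opprB sinN oppr_eq0 gt_eqF // sin_ang_gt0.
Qed.

Lemma psi_gt0 S : 0 < psi S.
Proof.
apply: prodr_gt0 => i _; apply: prodr_gt0 => j /andP[_ ij].
by rewrite normr_gt0 sin_ang_neq0 // -val_eqE /= ltn_eqF.
Qed.

Let normsinC i j : `|sin (ang i - ang j)| = `|sin (ang j - ang i)|.
Proof. by rewrite -opprB sinN normrN. Qed.

Let psiU1 S k : k \notin S ->
  psi (k |: S) = psi S * \prod_(i in S) `|sin (ang k - ang i)|.
Proof.
move=> kS; rewrite /psi big_setU1 //= big_mkcondr big_setU1 //= ltnn mul1r.
under [X in _ * X = _]eq_bigr do rewrite big_mkcondr big_setU1 //=.
rewrite big_split /= mulrA -big_split /= [LHS]mulrC; congr (_ * _).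
  by apply: eq_bigr => i _; rewrite [RHS]big_mkcondr.
apply: eq_bigr => i iS; case: ltngtP => [||/val_inj ki]; rewrite ?mulr1 ?mul1r // 1?normsinC //.
by rewrite ki iS in kS.
Qed.

Let psi_mirror S : psi (mirror S) = psi S.
Proof.
rewrite /psi /mirror big_imset /=; last by move=> ? ? _ _; exact: rev_ord_inj.
rewrite (eq_bigr (fun i => \prod_(j in S | (j < i)%N) `|sin (ang i - ang j)|)); last first.
  move=> i iS; rewrite big_mkcondr big_imset /=; last by move=> ? ? _ _; exact: rev_ord_inj.
  rewrite -big_mkcondr; apply: eq_big => j.
    by case: (j \in S) => //=; have := ltn_ord j; have := ltn_ord i; lia.
  move=> _; rewrite normsinC !angB; congr (`|sin (pi * _ / _)|).
  by rewrite !natrB // -!natr1; ring.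
rewrite (exchange_big_dep (mem S)) /=; last by move=> i j _ /andP[].
apply: eq_bigr => j jS; apply: eq_big => i; first by rewrite jS.
by move=> _; rewrite normsinC.
Qed.

(** When [ordS] wraps from L - 1 to 0 the angle drops by pi instead of growing by pi / L, which only
    changes the sign of the sine. The absolute values in [psi] absorb this sign, whatever the parity
    of the number of stones. *)
Let sin_ordS k (x : R) : `|sin (ang (ordS k) - x)| = `|sin (ang k + pi / L%:R - x)|.
Proof.
have L0 : L%:R != 0 :> R by rewrite gt_eqF // L_gt0.
have -> : ang k + pi / L%:R = pi * k.+1%:R / L%:R by rewrite /ang -natr1; ring.
rewrite /ang /=; have := ltn_ord k; rewrite leq_eqVlt => /predU1P[kL|kL].
  rewrite {1}kL modnn mulr0 mul0r sub0r sinN normrN kL mulfK //.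
  by rewrite sinB sinpi cospi mul0r mulN1r sub0r opprK.
by rewrite modn_small.
Qed.

(** The indices being integers, k + 1 - i vanishes or has the sign of k - i, and all angles stay
    within [-pi, pi]. So the absolute values can be removed from the ratios before [sum_prod_sin] is
    applied. *)
Let ratio_ge0 k i : k != i -> 0 <= sin (ang k + pi / L%:R - ang i) / sin (ang k - ang i).
Proof.
have L0 := L_gt0 i; have p0 := pi_gt0 R.
have kL : (k%:R + 1 : R) <= L%:R by rewrite natr1 ler_nat.
have iL : (i%:R + 1 : R) <= L%:R by rewrite natr1 ler_nat.
have i0 : (0 : R) <= i%:R by []. have k0 : (0 : R) <= k%:R by [].
have E : ang k + pi / L%:R - ang i = pi * (k%:R + 1 - i%:R) / L%:R by rewrite /ang; ring.
have bnd (x : R) : 0 <= x <= L%:R -> 0 <= pi * x / L%:R <= pi.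
  case/andP=> x0 xL; rewrite divr_ge0 ?mulr_ge0 ?(ltW p0) ?(ltW L0) //=.
  by rewrite ler_pdivrMr // ler_pM2l.
rewrite -val_eqE /= neq_ltn => /orP[] ki.
  rewrite -(opprB _ (ang k)) -(opprB (ang i)) !sinN invrN mulrNN.
  apply: divr_ge0; last exact/ltW/sin_ang_gt0.
  have ki' : (k%:R + 1 : R) <= i%:R by rewrite natr1 ler_nat.
  apply: sin_ge0_pi; rewrite -opprB E -mulNr -mulrN.
  by apply: bnd; lra.
apply: divr_ge0; last exact/ltW/sin_ang_gt0.
have ki' : (i%:R + 1 : R) <= k%:R by rewrite natr1 ler_nat.
apply: sin_ge0_pi; rewrite E.
by apply: bnd; lra.
Qed.

Hypothesis L_gt1 : (1 < L)%N.

Let sin_piL : 0 < sin (pi / L%:R) :> R.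
Proof.
have p0 := pi_gt0 R; have L1 : (1 : R) < L%:R by rewrite ltr1n.
apply: sin_gt0_pi; rewrite divr_gt0 //=; last lra.
by rewrite ltr_pdivrMr; [nra|lra].
Qed.

Lemma lam_gt0 N : (0 < N < L)%N -> 0 < lam R L N.
Proof.
case/andP=> N0 NL; apply: divr_gt0 => //.
have p0 := pi_gt0 R; have L1 : (1 : R) < L%:R by rewrite ltr1n.
have N0' : (0 : R) < N%:R by rewrite ltr0n.
have NL' : (N%:R : R) < L%:R by rewrite ltr_nat.
apply: sin_gt0_pi; rewrite divr_gt0 ?mulr_gt0 //=; last lra.
by rewrite ltr_pdivrMr; [nra|lra].
Qed.

(** The sum over free stones may be extended to all stones: if the hole [ordS k] is occupied, it
    contributes the factor sin 0 to the product attached to k. The full sum is [sum_prod_sin] with a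
    = pi / L. *)
Lemma psi_right S : \sum_(S' | step S S') psi S' = lam R L #|S| * psi S.
Proof.
have E k : k \in S -> (if ordS k \notin S then psi (hop S k) else 0) = psi S *
    \prod_(i in S :\ k) (sin (ang k + pi / L%:R - ang i) / sin (ang k - ang i)).
  move=> kS.
  have -> : psi S = psi (S :\ k) * \prod_(i in S :\ k) `|sin (ang k - ang i)|.
    by rewrite -psiU1 ?finset.setD1K // !inE eqxx.
  rewrite -mulrA -big_split /= [in RHS](eq_bigr (fun i => `|sin (ang (ordS k) - ang i)|)).
    case: ifPn => [Sk|/negPn Sk].
      by rewrite /hop psiU1 // !inE (negPf Sk) andbF.
    rewrite (bigD1 (ordS k)) /=; first by rewrite subrr sin0 normr0 mul0r mulr0.
    rewrite !inE Sk andbT -val_eqE /=; have := ltn_ord k; rewrite leq_eqVlt => /predU1P[kL|kL].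
      by rewrite kL modnn; lia.
    by rewrite modn_small //; lia.
  move=> i; rewrite !inE => /andP[ik iS]; rewrite sin_ordS.
  rewrite -[X in `|sin (ang k - ang i)| * X]ger0_norm ?ratio_ge0 1?eq_sym //.
  by rewrite normrM normfV mulrC divfK // normr_eq0 sin_ang_neq0 // eq_sym.
rewrite sum_step big_mkcondr (eq_bigr _ E) -mulr_sumr mulrC; congr (_ * _).
rewrite sum_prod_sin //; last first.
- by rewrite gt_eqF.
- by move=> i j _ _; exact: sin_ang_neq0.
- by rewrite /lam (_ : pi * _ / _ = #|S|%:R * (pi / L%:R)) // mulrCA mulrA.
Qed.

Lemma psi_left S : \sum_(S' | step S' S) psi S' = lam R L #|S| * psi S.
Proof.
rewrite -psi_mirror -card_mirror -psi_right (reindex_inj (can_inj mirrorK)) /=.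
apply: eq_big => S'; first by rewrite -[S in LHS]mirrorK mirror_step.
by rewrite psi_mirror.
Qed.

End ground_state.

(** * Irreducibility of the exclusion graph *)

Section irreducibility.
Context {L : nat}.
Hypothesis L_gt1 : (1 < L)%N.
Implicit Types (S : {set 'I_L}).

Lemma card_connect S S' : connect (@step L) S S' -> #|S'| = #|S|.
Proof.
case/connectP => p; elim: p S => [S _ ->//|S1 p IHp S /= /andP[SS1 pp] E].
by rewrite (IHp _ pp E) (card_step SS1).
Qed.

Lemma card_ord_lt n : (n <= L)%N -> #|[set i : 'I_L | (i < n)%N]%SET| = n.
Proof. 
move=> nL; rewrite -sum1_card (eq_bigl (fun i : 'I_L => (i < n)%N)) => [|i]; last by rewrite inE.
by rewrite -(big_ord_widen _ (fun=> 1%N)) // sum_nat_const card_ord muln1.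
Qed.

(** Induction on the sum of the positions. If some stone has an empty hole just behind it, without
    wrapping around, then S is a successor of the state in which this stone stands one hole back;
    otherwise S is an initial segment. *)
Lemma connect_initial_segment S :
  connect (@step L) [set i : 'I_L | (i < #|S|)%N]%SET S.
Proof.
have [m] := ubnP (\sum_(i in S) i); elim: m S => // m IHm S.
have [/existsP[k /andP[kS /existsP[k' /andP[k'S /eqP kk']]]]|H] :=
  boolP [exists k, (k \notin S) && [exists k', (k' \in S) && (k' == k.+1 :> nat)]].
  have Sk : ordS k = k' by apply/val_inj; rewrite /= -kk' modn_small.
  have kk'N : k != k' by apply: contraNneq kS => ->.
  pose S0 := k |: (S :\ k').
  have sS0 : step S0 S.
    apply/stepP; exists k.
      by rewrite /free Sk !inE !eqxx /= orbF eq_sym.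
    apply/setP => i; rewrite /hop Sk !inE.
    by case: eqVneq => [->|_] //=; case: eqVneq => [->|] //=; rewrite (negPf kS).
  have cS0 : #|S0| = #|S| by rewrite (card_step sS0).
  rewrite (bigD1 k') //= => Hm.
  apply: (connect_trans _ (connect1 sS0)); rewrite -cS0; apply: IHm.
  rewrite big_setU1 /= ?inE ?(negPf kS) ?andbF //.
  have -> : (\sum_(i in S :\ k') i = \sum_(i in S | i != k') i)%N.
    by apply: eq_bigl => i; rewrite !inE andbC.
  by move: Hm; rewrite kk' addSn ltnS.
move=> _; suff -> : S = [set i : 'I_L | (i < #|S|)%N]%SET.
  by rewrite card_ord_lt ?connect0 // -[X in (_ <= X)%N]card_ord max_card.
have down (i j : 'I_L) : i \in S -> (j <= i)%N -> j \in S.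
  move=> iS; move E : (i - j)%N => d; elim: d j E => [|d IHd] j E ji.
    by rewrite (_ : j = i) //; apply/val_inj => /=; lia.
  apply: contraT => jS; case/existsP: H; exists j; rewrite jS /=.
  have j1 : (j.+1 < L)%N by rewrite (leq_ltn_trans _ (ltn_ord i)) //; lia.
  by apply/existsP; exists (Ordinal j1); rewrite eqxx andbT; apply: IHd => /=; lia.
apply/eqP; rewrite eqEcard card_ord_lt; last first.
  by rewrite -[X in (_ <= X)%N]card_ord max_card.
rewrite leqnn andbT; apply/fintype.subsetP => i iS; rewrite inE.
apply: (@leq_trans #|[set j : 'I_L | (j < i.+1)%N]%SET|); first by rewrite card_ord_lt.
by apply: subset_leq_card; apply/fintype.subsetP => j; rewrite inE ltnS; exact: down.
Qed.

Context (R : realType).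

(* The states reachable from S' receive no mass from the others in the
   stationary regime with weights psi ^ 2, so the predecessor S is one of them. *)
Lemma connect_step_sym S S' : step S S' -> connect (@step L) S' S.
Proof.
move=> SS'; apply: contraT => S'S.
pose T := [pred V | connect (@step L) S' V].
have cT V : V \in T -> #|V| = #|S| by move/card_connect ->; exact: card_step.
have right : \sum_(V in T) psi (R := R) V * \sum_(W | step V W) psi W =
    lam R L #|S| * \sum_(V in T) psi V * psi V.
  rewrite mulr_sumr; apply: eq_bigr => V VT.
  by rewrite psi_right // cT // mulrCA.
have left : \sum_(V in T) psi (R := R) V * \sum_(W | step W V) psi W =
    lam R L #|S| * \sum_(V in T) psi V * psi V.
  rewrite mulr_sumr; apply: eq_bigr => V VT.
  by rewrite psi_left // cT // mulrCA.
have : \sum_(W | W \notin T) \sum_(V in T | step W V) psi (R := R) W * psi V = 0.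
  apply: (@addrI _ (\sum_(V in T) psi V * \sum_(W | step V W) psi W)).
  rewrite addr0 {2}right -left; apply/esym.
  rewrite (eq_bigr (fun V => \sum_(W | step W V) psi W * psi V)); last first.
    by move=> V _; rewrite mulr_sumr; apply: eq_bigr => W _; rewrite mulrC.
  rewrite (exchange_big_dep predT) //= (bigID (mem T)) /=; congr (_ + _).
  apply: eq_bigr => V VT; rewrite mulr_sumr; apply: eq_bigl => W.
  case: (boolP (step V W)) => [VW|]; rewrite ?andbF ?andbT //.
  exact: connect_trans VT (connect1 VW).
have pp V W : 0 < psi (R := R) V * psi W by rewrite mulr_gt0 ?psi_gt0.
move/eqP; rewrite (bigD1 S) //= (bigD1 S') /=; last by rewrite SS' andbT inE connect0.
rewrite gt_eqF // -addrA ltr_wpDr // addr_ge0 // sumr_ge0 // => W _; first exact: ltW.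
by rewrite sumr_ge0 // => V _; exact: ltW.
Qed.

(** Every state is reached from the initial segment of its cardinality, and reachability is
    symmetric by [connect_step_sym]. *)
Lemma connect_step S S' : #|S| = #|S'| -> connect (@step L) S S'.
Proof.
move=> SS'.
suff sym V W : connect (@step L) V W -> connect (@step L) W V.
  apply: (@connect_trans _ _ [set i : 'I_L | (i < #|S|)%N]%SET).
    exact/sym/connect_initial_segment.
  by rewrite SS'; exact: connect_initial_segment.
case/connectP => p; elim: p V => [V _ ->//|V1 p IHp V /= /andP[VV1 pp] E].
exact: connect_trans (IHp _ pp E) (connect_step_sym VV1).
Qed.

End irreducibility.

(** * Stationary processes with given word probabilities *)

Section finite_partition.
Context d (T : measurableType d) (R : realType) (m : {measure set T -> \bar R}).

Lemma measure_finType_bigcup (I : finType) (F : I -> set T) (A : set T) :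
  (forall i, measurable (F i)) -> (forall i j x, F i x -> F j x -> i = j) ->
  A = \bigcup_i F i -> m A = (\sum_i m (F i))%E.
Proof.
move=> mF F1 ->; rewrite measure_fin_bigcup //; last first.
- by move=> i j _ _ [x []]; exact: F1.
- exact: finite_finset.
rewrite -[index_enum I]/(index_enum I) (_ : [set: I] = [set` index_enum I]); last first.
  by apply/seteqP; split => // i _ /=; rewrite mem_index_enum.
by rewrite -fsbig_seq ?index_enum_uniq.
Qed.

End finite_partition.

Lemma measurable_prop d (T : measurableType d) (P : Prop) : measurable [set _ : T | P].
Proof.
have [p|p] := pselect P.
  by rewrite (_ : [set _ | P] = setT) //; apply/seteqP; split.
by rewrite (_ : [set _ | P] = set0) //; apply/seteqP; split.
Qed.

Lemma measurable_map_fiber d (W : measurableType d) (J T : Type) (f : W -> J -> T)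
    (s : seq J) (w : seq T) :
  (forall j a, measurable [set x | f x j = a]) ->
  measurable [set x | map (f x) s = w].
Proof.
move=> mf; elim: s w => [|j s IHs] [|a w] /=.
- exact: measurable_prop.
- exact: measurable_prop.
- by rewrite (_ : [set _ | _] = set0) //; apply/seteqP; split.
rewrite (_ : [set _ | _] = [set x | f x j = a] `&` [set x | map (f x) s = w]).
  exact: measurableI.
by apply/seteqP; split => x /= [-> ->].
Qed.

Lemma probability_setI_full d (T : measurableType d) (R : realType)
    (P : probability T R) (A B : set T) :
  measurable A -> measurable B -> P A = 1%E -> P (A `&` B) = P B.
Proof.
move=> mA mB PA.
have PA0 : P (~` A) = 0%E by rewrite probability_setC // PA subee.
rewrite -[in RHS](setIT B) -(setUv A) setIUr measureU //.
- rewrite [X in (_ + X)%E](_ : _ = 0%E) ?adde0 1?setIC //.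
  apply/eqP; rewrite eq_le measure_ge0 andbT -PA0 le_measure // ?inE.
  + by apply: measurableI => //; exact: measurableC.
  + exact: measurableC.
- exact: measurableI.
- by apply: measurableI => //; exact: measurableC.
- by rewrite setIACA setICr setI0.
Qed.

(* Subdividing [0, 1[ into nested half-open intervals of lengths p l turns a
   uniform variable into a random sequence whose prefixes have law p. *)
Section interval_coding.
Context {R : realType} {T : finType} (x0 : T) (p : seq T -> R).
Hypothesis p1 : p [::] = 1.
Hypothesis p_ge0 : forall l, 0 <= p l.
Hypothesis p_rcons : forall l, \sum_a p (rcons l a) = p l.
Implicit Types (l : seq T) (a b : T) (x : R).

Let offset l k : R := \sum_(b | (enum_rank b < k)%N) p (rcons l b).

(** The recursion runs on the reversed word because an interval is subdivided according to the
    letter appended at the end of its word. *)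
Fixpoint code_left_rev (l : seq T) : R :=
  if l is a :: l' then code_left_rev l' + offset (rev l') (enum_rank a) else 0.

Definition code_left l := code_left_rev (rev l).

Definition code_itv l : set R := `[code_left l, code_left l + p l[%classic.

Let code_left_rcons l a : code_left (rcons l a) = code_left l + offset l (enum_rank a).
Proof. by rewrite /code_left rev_rcons /= revK. Qed.

Let offset0 l : offset l 0 = 0.
Proof. by rewrite /offset big_pred0. Qed.

Let offsetT l : offset l #|T| = p l.
Proof. by rewrite -p_rcons; apply: eq_bigl => b; rewrite ltn_ord. Qed.

Let offset_le l k k' : (k <= k')%N -> offset l k <= offset l k'.
Proof.
move=> kk'; rewrite /offset [leRHS]big_mkcond [leLHS]big_mkcond; apply: ler_sum => b _.
by case: ltnP => bk; [rewrite (leq_trans bk kk')|case: ifP].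
Qed.

Let offsetS l a : offset l (enum_rank a).+1 = offset l (enum_rank a) + p (rcons l a).
Proof.
rewrite /offset (bigD1 a) //= addrC; congr (_ + _); apply: eq_bigl => b.
rewrite ltnS [in RHS]ltn_neqAle andbC; congr (_ && _).
by rewrite -(inj_eq enum_rank_inj).
Qed.

Let code_itv_sub l a : code_itv (rcons l a) `<=` code_itv l.
Proof.
move=> x; rewrite /code_itv /= !in_itv /= code_left_rcons -addrA -offsetS => /andP[h1 h2].
rewrite (le_trans _ h1) ?lerDl -?(offset0 l) ?offset_le //=.
by rewrite (lt_le_trans h2) // lerD2l -offsetT offset_le // ltn_ord.
Qed.

Let code_itv_cover l x : code_itv l x -> exists a, code_itv (rcons l a) x.
Proof.
rewrite /code_itv /= in_itv /= => /andP[lx xl].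
have ex : exists k, x < code_left l + offset l k by exists #|T|; rewrite offsetT.
case: (ex_minnP ex) => -[|k] xk mink.
  by move: xk; rewrite offset0 addr0 ltNge lx.
have kT : (k < #|T|)%N.
  rewrite ltnNge; apply/negP => Tk; suff /mink : x < code_left l + offset l #|T|.
    by rewrite ltnNge Tk.
  by rewrite offsetT.
exists (enum_val (Ordinal kT)).
rewrite /= in_itv /= code_left_rcons -addrA -offsetS enum_valK /= xk andbT leNgt.
by apply/negP => /mink; rewrite ltnn.
Qed.

Let code_itv_disj l a b x : code_itv (rcons l a) x -> code_itv (rcons l b) x -> a = b.
Proof.
rewrite /code_itv /= !in_itv /= !code_left_rcons -!addrA -!offsetS => /andP[a1 a2] /andP[b1 b2].
have le (c e : T) : code_left l + offset l (enum_rank c) <= x ->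
    x < code_left l + offset l (enum_rank e).+1 -> (enum_rank c <= enum_rank e)%N.
  move=> xc xe; rewrite leqNgt; apply/negP => ec.
  have := le_lt_trans xc (lt_le_trans xe (_ : _ <= code_left l + offset l (enum_rank c))).
  by rewrite ltxx lerD2l => H; apply: notF; apply: H; exact: offset_le.
apply/eqP; rewrite -(inj_eq enum_rank_inj) -val_eqE eqn_leq.
by apply/andP; split; apply: le.
Qed.

Fixpoint code_word (x : R) (n : nat) : seq T :=
  if n is n'.+1 then let l := code_word x n' in
    rcons l (odflt x0 [pick a | `[< code_itv (rcons l a) x >]])
  else [::].

Definition code_letter (x : R) (n : nat) : T :=
  if `[< code_itv [::] x >] then last x0 (code_word x n.+1) else x0.

Let code_wordP x n : code_itv [::] x -> code_itv (code_word x n) x.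
Proof.
move=> x1; elim: n => //= n IHn.
case: pickP => [a /asboolP //|] H.
by have [a xa] := code_itv_cover IHn; have := H a; rewrite asboolT.
Qed.

Let code_word_letters x n : code_itv [::] x -> code_word x n = mkseq (code_letter x) n.
Proof.
move=> x1; elim: n => // n IHn.
rewrite /mkseq -addn1 iotaD map_cat add0n -/(mkseq _ _) -IHn addn1 /= cats1 /code_letter asboolT //=.
by rewrite last_rcons.
Qed.

Let code_itv_nil l x : code_itv l x -> code_itv [::] x.
Proof. by elim/last_ind: l => // l a IHl /code_itv_sub. Qed.

Let code_word_uniq l x : code_itv l x -> l = code_word x (size l).
Proof.
elim/last_ind: l => // l a IHl xa; rewrite size_rcons /=.
have <- := IHl (code_itv_sub xa); congr (rcons _ _).
case: pickP => [b /asboolP xb|/(_ a)]; last by rewrite asboolT.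
exact: code_itv_disj xa xb.
Qed.

Let code_itv01 : code_itv [::] = `[0, 1[%classic.
Proof. by rewrite /code_itv /code_left /= p1 add0r. Qed.

(** At each depth the intervals partition [0, 1[, and the one that contains x is labelled by the
    first letters of x. *)
Lemma code_itvE l : code_itv l = [set x | code_itv [::] x /\ mkseq (code_letter x) (size l) = l].
Proof.
apply/seteqP; split => x /=.
  move=> xl; have x1 := code_itv_nil xl; split=> //.
  by rewrite -code_word_letters // -code_word_uniq.
by case=> x1 <-; rewrite -code_word_letters //; exact: code_wordP.
Qed.

Lemma code_letter_fiber n a : measurable [set x : measurableTypeR R | code_letter x n = a].
Proof.
rewrite (_ : [set _ | _] =
   (~` code_itv [::] `&` [set _ | x0 = a]) `|`
   \bigcup_(l : n.-tuple T) code_itv (rcons l a)); last first.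
  apply/seteqP; split => x /=.
    case: (pselect (code_itv [::] x)) => x1; last by rewrite /code_letter asboolF //; left.
    move=> xa; right; exists [tuple of mkseq (code_letter x) n] => //.
    rewrite code_itvE /= size_rcons size_mkseq; split=> //.
    by rewrite /mkseq -addn1 iotaD map_cat add0n cats1 /= xa.
  case=> [[x1 <-]|[l _]]; first by rewrite /code_letter asboolF.
  rewrite code_itvE /= size_rcons size_tuple => -[x1].
  by rewrite /mkseq -addn1 iotaD map_cat add0n cats1 /= => /rcons_inj[].
apply: measurableU.
  by apply: measurableI; [apply: measurableC; exact: measurable_itv|exact: measurable_prop].
apply: fin_bigcup_measurable; first exact: finite_finset.
by move=> l _; exact: measurable_itv.
Qed.

Lemma uniform_prob_co (a b : R) : 0 <= a -> a <= b -> b <= 1 ->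
  uniform_prob (@ltr01 R) `[a, b[%classic = (b - a)%:E.
Proof.
move=> a0 ab b1.
have mab : measurable (`[a, b[%classic : set (measurableTypeR R)) by exact: measurable_itv.
rewrite -(setIT `[a, b[%classic) -integral_indic //= integral_uniform //; last first.
  by apply/measurable_EFinP; exact: measurable_indic.
rewrite subr0 invr1 mul1e integral_indic //=.
rewrite (_ : _ `&` _ = `[a, b[%classic) ?lebesgue_measure_itv /= ?lte_fin.
  by case: ltP => // ba; rewrite (_ : b = a) ?subrr //; apply/eqP; rewrite eq_le ba.
rewrite setIidl // => x; rewrite /= !in_itv /= => /andP[ax xb].
by rewrite (le_trans a0 ax) (le_trans (ltW xb) b1).
Qed.

Lemma uniform_prob_code l :
  uniform_prob (@ltr01 R) [set x | mkseq (code_letter x) (size l) = l] = (p l)%:E.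
Proof.
have mA : measurable ([set x | mkseq (code_letter x) (size l) = l] : set (measurableTypeR R)).
  by apply: measurable_map_fiber => n a; exact: code_letter_fiber.
have mI : measurable (code_itv [::] : set (measurableTypeR R)) by exact: measurable_itv.
have I1 : uniform_prob (@ltr01 R) (code_itv [::]) = 1%E.
  by rewrite code_itv01 uniform_prob_co // subr0.
rewrite -(probability_setI_full mI mA I1).
rewrite (_ : _ `&` _ = code_itv l); last by rewrite [RHS]code_itvE.
have bd k : 0 <= code_left k /\ code_left k + p k <= 1.
  elim/last_ind: k => [|k a [IH1 IH2]].
    by rewrite /code_left /= p1 add0r.
  rewrite code_left_rcons -addrA -offsetS; split.
    by rewrite addr_ge0 // -(offset0 k) offset_le.
  by rewrite (le_trans _ IH2) // lerD2l -offsetT offset_le // ltn_ord.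
have [h1 h2] := bd l.
apply: (eq_trans (uniform_prob_co h1 _ h2)); first by rewrite lerDl.
by rewrite addrAC subrr add0r.
Qed.

End interval_coding.

Lemma exists_distribution d d' (T : measurableType d) (T' : measurableType d')
    (R : realType) (P : probability T R) (f : T -> T') :
  measurable_fun setT f ->
  exists Q : probability T' R, forall A, Q A = P (f @^-1` A).
Proof.
move=> mf; pose X : {mfun T >-> T'} := HB.pack f (isMeasurableFun.Build _ _ _ _ f mf).
by exists (distribution P X).
Qed.

Section sequence_space.
Context {d} {T : measurableType d}.

Lemma measurable_coord (i : int) (B : set T) : measurable B ->
  measurable [set X : Zseq T | B (X i)].
Proof. by move=> mB; apply: sub_sigma_algebra; exists i, B. Qed.

Lemma measurable_fun_coord (i : int) :
  measurable_fun setT (fun X : Zseq T => (X i : T)).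
Proof. by move=> _ B mB; rewrite setTI; exact: measurable_coord. Qed.

Lemma measurable_fun_Zseq d' (W : measurableType d') (f : W -> Zseq T) :
  (forall i, measurable_fun setT (fun x => (f x i : T))) -> measurable_fun setT f.
Proof.
move=> mf; refine (@measurability _ _ W (Zseq T) setT f (coord_cylinders T) erefl _).
by move=> _ [_ [i [B [mB ->]]] <-]; have := mf i measurableT B mB.
Qed.

End sequence_space.

Definition word_cyl (T : Type) (i : int) (w : seq T) : set (int -> T) :=
  [set X | [seq X (i + Posz j) | j <- iota 0 (size w)] = w].

Section words.
Context {I : finType}.
Local Notation T := {set I}.

Lemma measurable_word_cyl i (w : seq T) : measurable (word_cyl i w : set (Zseq T)).
Proof.
by apply: measurable_map_fiber => j a; exact: (@measurable_coord _ T _ [set a]).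
Qed.

Lemma word_cyl_split_right (R : realType) (m : {measure set (Zseq T) -> \bar R}) i (w : seq T) :
  m (word_cyl i w) = (\sum_a m (word_cyl i (rcons w a)))%E.
Proof.
apply: measure_finType_bigcup.
- by move=> a; exact: measurable_word_cyl.
- move=> a b X; rewrite /word_cyl /= !size_rcons -addn1 iotaD map_cat add0n !cats1.
  by move=> -> /rcons_inj[].
- apply/seteqP; split => X; rewrite /word_cyl /=.
    move=> Xw; exists (X (i + Posz (size w))) => //.
    by rewrite /= size_rcons -addn1 iotaD map_cat add0n cats1 Xw.
  by case=> a _ /=; rewrite size_rcons -addn1 iotaD map_cat add0n cats1 => /rcons_inj[].
Qed.

Lemma word_cyl_eq i (w : seq T) X Y j : word_cyl i w X -> word_cyl i w Y -> (j < size w)%N ->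
  X (i + Posz j) = Y (i + Posz j).
Proof.
rewrite /word_cyl /= => Xw; rewrite -[RHS]Xw => /esym E jw.
have := congr1 (fun s => nth (X i) s j) E.
by rewrite !(nth_map 0%N) ?size_iota // nth_iota // add0n.
Qed.

Lemma word_cyl_agree i (w : seq T) X Y : word_cyl i w X ->
  (forall j, (j < size w)%N -> X (i + Posz j) = Y (i + Posz j)) -> word_cyl i w Y.
Proof.
rewrite /word_cyl /= => Xw XY; rewrite -[RHS]Xw; apply/eq_in_map => j.
by rewrite mem_iota add0n => /andP[_ /XY].
Qed.

Lemma word_cyl_cons i a (w : seq T) :
  word_cyl i (a :: w) = [set X | X i = a] `&` word_cyl (i + 1) w.
Proof.
have E (X : int -> T) : [seq X (i + Posz j) | j <- iota 0 (size (a :: w))] =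
    X i :: [seq X (i + 1 + Posz j) | j <- iota 0 (size w)].
  rewrite /= addr0 (iotaDl 1 0) -map_comp; congr (_ :: _); apply: eq_map => j /=.
  by rewrite -addrA.
apply/seteqP; split => X; first by move/(eq_trans (esym (E X))) => [].
by case=> /= Xa Xw; apply: (eq_trans (E X)); rewrite Xa; congr (_ :: _).
Qed.

Lemma word_cyl_split_left (R : realType) (m : {measure set (Zseq T) -> \bar R}) i (w : seq T) :
  m (word_cyl (i + 1) w) = (\sum_a m (word_cyl i (a :: w)))%E.
Proof.
apply: measure_finType_bigcup.
- by move=> a; exact: measurable_word_cyl.
- by move=> a b X; rewrite !word_cyl_cons => -[/= -> _] [/= -> _].
- apply/seteqP; split => X.
    by move=> Xw; exists (X i) => //; rewrite word_cyl_cons.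
  by case=> a _; rewrite word_cyl_cons => -[].
Qed.

End words.

Section Z_enumeration.

Definition Zcode (i : int) : nat :=
  match i with Posz 0 => 0 | Posz k.+1 => (k.*2).+1 | Negz k => (k.+1).*2 end.

Definition Zpos (n : nat) : int := if odd n then Posz (n./2).+1 else - Posz n./2.

Definition Zstart (n : nat) : int := 1 - Posz (n.+1)./2.

Lemma ZposK : cancel Zpos Zcode.
Proof.
move=> n; rewrite /Zpos; case: ifP => nodd /=.
  by rewrite -[RHS]odd_double_half nodd.
have <- : n./2.*2 = n by rewrite -[RHS]odd_double_half nodd.
by rewrite doubleK; case: n./2.
Qed.

Lemma ZcodeK : cancel Zcode Zpos.
Proof.
case=> [[|k]|k]; rewrite /Zpos //=.
  by rewrite odd_double /= uphalf_double.
by rewrite odd_double /= doubleK.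
Qed.

Lemma Zpos_bound k n : (k < n)%N -> 0 <= Zpos k - Zstart n < Posz n.
Proof. by rewrite /Zpos /Zstart; case: ifP => ?; lia. Qed.

Lemma Zcode_bound j n : (j < n)%N -> (Zcode (Zstart n + Posz j)%R < n)%N.
Proof.
move=> jn; rewrite /Zstart; case E : (_ + _) => [[|k]|k] /=; lia.
Qed.

End Z_enumeration.

Section stationary_process.
Context {R : realType} {I : finType}.
Local Notation T := {set I}.

(* The first n terms of the enumeration 0, 1, -1, 2, -2, ... of int form an
   interval starting at Zstart n; Zwindow reads it from left to right. *)
Definition Zwindow (n : nat) (x : nat -> T) : seq T :=
  [seq x (Zcode (Zstart n + Posz j)) | j <- iota 0 n].

Lemma eq_Zwindow n (x y : nat -> T) : (forall k, (k < n)%N -> x k = y k) ->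
  Zwindow n x = Zwindow n y.
Proof.
move=> xy; apply/eq_in_map => j; rewrite mem_iota add0n => /andP[_ jn].
exact/xy/Zcode_bound.
Qed.

Lemma ZwindowS n (x : nat -> T) : Zwindow n.+1 x =
  if odd n then rcons (Zwindow n x) (x n) else x n :: Zwindow n x.
Proof.
case: ifPn => nodd.
  rewrite /Zwindow -addn1 iotaD map_cat add0n cats1 addn1.
  have -> : Zstart n.+1 = Zstart n by rewrite /Zstart; lia.
  congr (rcons _ (x _)).
  rewrite -[RHS]ZposK; congr Zcode; rewrite /Zpos nodd /Zstart; lia.
rewrite /Zwindow /= addr0; congr (x _ :: _).
  rewrite -[RHS]ZposK; congr Zcode; rewrite /Zpos (negPf nodd) /Zstart; lia.
rewrite (iotaDl 1 0) -map_comp; apply: eq_map => j /=; congr (x (Zcode _)).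
by rewrite /Zstart; lia.
Qed.

Variable q : seq T -> R.
Hypothesis q1 : q [::] = 1.
Hypothesis q_ge0 : forall w, 0 <= q w.
Hypothesis q_rcons : forall w, \sum_a q (rcons w a) = q w.
Hypothesis q_cons : forall w, \sum_a q (a :: w) = q w.

(** The interval coding produces one-sided sequences, so the coordinates are revealed in the order
    0, 1, -1, 2, -2, ... At each stage the known coordinates fill an interval whose word has law
    [q], and the next one is added at its right or left end, where [q_rcons] or [q_cons] gives the
    consistency required by the coding. *)
Lemma stationary_process : exists mu : probability (Zseq T) R,
  forall i w, mu (word_cyl i w) = (q w)%:E.
Proof.
pose x0 : T := finset.set0.
pose p l := q (Zwindow (size l) (nth x0 l)).
have p1 : p [::] = 1 by [].
have p_ge0 l : 0 <= p l by exact: q_ge0.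
have p_rcons l : \sum_a p (rcons l a) = p l.
  have E a : Zwindow (size l) (nth x0 (rcons l a)) = Zwindow (size l) (nth x0 l).
    by apply: eq_Zwindow => k kl; rewrite nth_rcons kl.
  have En a : nth x0 (rcons l a) (size l) = a by rewrite nth_rcons ltnn eqxx.
  rewrite /p; case: (boolP (odd (size l))) => lodd.
    rewrite -[RHS]q_rcons; apply: eq_bigr => a _.
    by rewrite size_rcons ZwindowS lodd E En.
  rewrite -[RHS]q_cons; apply: eq_bigr => a _.
  by rewrite size_rcons ZwindowS (negPf lodd) E En.
pose f (x : measurableTypeR R) : Zseq T := fun i => code_letter x0 p x (Zcode i).
have mf : measurable_fun setT f.
  apply: measurable_fun_Zseq => i _ B _; rewrite setTI.
  rewrite (_ : _ @^-1` _ = \bigcup_(a in B) [set x | code_letter x0 p x (Zcode i) = a]); last first.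
    by apply/seteqP; split => x /=; [exists (f x i)|case=> a Ba /= xa; rewrite /f xa].
  apply: fin_bigcup_measurable; first exact: finite_finset.
  by move=> a _; exact: code_letter_fiber.
have [mu muE] := exists_distribution (uniform_prob (@ltr01 R)) mf.
exists mu.
have base n w : size w = n -> mu (word_cyl (Zstart n) w) = (q w)%:E.
  move=> wn; rewrite muE.
  pose y k := nth x0 w `|Zpos k - Zstart n|%N.
  have yw : Zwindow n y = w.
    apply: (@eq_from_nth _ x0); first by rewrite size_map size_iota.
    rewrite size_map size_iota => j jn; rewrite (nth_map 0%N) ?size_iota // nth_iota // add0n.
    by rewrite /y ZcodeK addrC addKr.
  have Ew : Zwindow n (nth x0 (mkseq y n)) = w.
    by rewrite -[RHS]yw; apply: eq_Zwindow => k kn; rewrite nth_mkseq.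
  have := uniform_prob_code x0 p1 p_ge0 p_rcons (mkseq y n).
  rewrite /p size_mkseq Ew => <-; congr (uniform_prob _ _).
  apply/seteqP; split => x /=; rewrite /word_cyl /= wn.
    move=> E; apply: (@eq_from_nth _ x0); rewrite !size_mkseq // => k kn.
    rewrite !nth_mkseq // /y -E.
    have /andP[k0 k1] := Zpos_bound kn.
    rewrite (nth_map 0%N) ?size_iota ?nth_iota ?add0n; try lia.
    by rewrite /f (_ : _ + _ = Zpos k) ?ZposK //; lia.
  move=> E; rewrite -[RHS]yw /Zwindow; apply/eq_in_map => j.
  rewrite mem_iota add0n => /andP[_ jn]; rewrite /f.
  have cn := Zcode_bound jn.
  by have := congr1 (fun s => nth x0 s (Zcode (Zstart n + j))) E; rewrite !nth_mkseq.
(* A word in arbitrary position is padded by [l] letters on the left and [r] on the right until it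
   fills one of the windows handled by [base]; the added letters are then summed out. *)
have ext l : forall r i w, (forall v, size v = (l + size w + r)%N ->
    mu (word_cyl (i - Posz l) v) = (q v)%:E) -> mu (word_cyl i w) = (q w)%:E.
  elim: l => [|l IHl].
    elim=> [|r IHr] i w H; first by rewrite -(subr0 i); apply: H; rewrite addn0.
    rewrite word_cyl_split_right -q_rcons -sumEFin; apply: eq_bigr => a _.
    by apply: IHr => v vE; apply: H; rewrite vE size_rcons; lia.
  move=> r i w H; rewrite -(subrK 1 i) word_cyl_split_left -q_cons -sumEFin.
  apply: eq_bigr => a _; apply: (IHl r) => v vE.
  rewrite (_ : i - 1 - Posz l = i - Posz l.+1); last by lia.
  by apply: H; rewrite vE /=; lia.
move=> i w.
pose n := (2 * (`|i| + size w + 1))%N.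
pose l := absz (i - Zstart n).
have il : i - Posz l = Zstart n.
  by rewrite /l /Zstart /n; lia.
have ln : (l + size w <= n)%N by rewrite /l /Zstart /n; lia.
apply: (ext l (n - (l + size w))%N) => v vE; rewrite il; apply: base.
by rewrite vE; lia.
Qed.

End stationary_process.

Section process_law.
Context {R : realType} {I : finType}.
Local Notation T := {set I}.

(** Cylinders over windows centred at 0, with the empty set and the whole space, form a generating
    pi-system: if two of them meet, the one with the longer word is contained in the other. *)
Lemma eq_word_cyl_law (mu nu : probability (Zseq T) R) :
  (forall i w, mu (word_cyl i w) = nu (word_cyl i w)) ->
  forall A, measurable A -> mu A = nu A.
Proof.
move=> mn A mA.
pose G : set (set (Zseq T)) := [set C | C = set0 \/ C = setT \/
  exists n w, size w = n.*2.+1 /\ C = word_cyl (- Posz n) w].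
have GI : setI_closed G.
  move=> C C' [->|[->|[n [w [wn ->]]]]]; rewrite ?set0I ?setTI //; first by left.
  case=> [->|[->|[m [v [vm ->]]]]]; rewrite ?setI0 ?setIT; first by left.
    by right; right; exists n, w.
  have [->|/set0P[X [Xw Xv]]] := eqVneq (word_cyl (- Posz n) w `&` word_cyl (- Posz m) v) set0.
    by left.
  right; right; have [nm|mn'] := leqP n m.
    exists m, v; split=> //; apply: setIidr => Y Yv.
    apply: (word_cyl_agree Xw) => j jw; rewrite (_ : _ + _ = - Posz m + Posz (m - n + j)); last by lia.
    by apply: (word_cyl_eq Xv Yv); rewrite vm; move: jw; rewrite wn; lia.
  exists n, w; split=> //; apply: setIidl => Y Yw.
  apply: (word_cyl_agree Xv) => j jw; rewrite (_ : _ + _ = - Posz n + Posz (n - m + j)); last by lia.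
  by apply: (word_cyl_eq Xw Yw); rewrite wn; move: jw; rewrite vm; lia.
have GE : measurable = <<s G >> :> set (set (Zseq T)).
  apply/seteqP; split.
    apply: smallest_sub; first exact: smallest_sigma_algebra.
    move=> _ [i [B [_ ->]]].
    pose n := absz i; pose m := absz (i + Posz n).
    have mi : - Posz n + Posz m = i by rewrite /m /n; lia.
    have mn' : (m < n.*2.+1)%N by rewrite /m /n; lia.
    have E (X : int -> T) : nth finset.set0 [seq X (- Posz n + Posz j) | j <- iota 0 (n.*2.+1)] m = X i.
      by rewrite (nth_map 0%N) ?size_iota // nth_iota // add0n mi.
    rewrite (_ : [set _ | _] = \bigcup_(w in [set w : (n.*2.+1).-tuple T | B (nth finset.set0 w m)])
        word_cyl (- Posz n) w); last first.
      apply/seteqP; split => X /=.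
        move=> BX; exists [tuple of [seq X (- Posz n + Posz j) | j <- iota 0 (n.*2.+1)]].
          by move: BX; rewrite -E.
        by rewrite /word_cyl /= size_map size_iota.
      by case=> w /= Bw Xw; move: Bw; rewrite -{1}Xw size_tuple E.
    apply: (@fin_bigcup_measurable _ (g_sigma_algebraType G)); first exact: finite_finset.
    move=> w _; apply: sub_sigma_algebra; right; right; exists n, w.
    by rewrite size_tuple.
  apply: smallest_sub; first exact: sigma_algebra_measurable.
  move=> C [->|[->|[n [w [_ ->]]]]] //; exact: measurable_word_cyl.
apply: (@measure_unique _ R (Zseq T) G (fun=> setT) GE GI).
- by move=> _; right; left.
- by rewrite bigcup_const //; exists 0%N.
- move=> C [->|[->|[n [w [_ ->]]]]]; rewrite ?measure0 //.
  exact: (eq_trans (probability_setT mu) (esym (probability_setT nu))).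
  exact: mn.
- by move=> _; apply: (@le_lt_trans _ _ 1%E); [exact: probability_le1|exact: ltry].
- by [].
Qed.

Lemma shift_invariant (mu : probability (Zseq T) R) :
  (forall i j w, mu (word_cyl i w) = mu (word_cyl j w)) ->
  forall A : set (Zseq T), measurable A -> mu [set X | A (Defs.shift X)] = mu A.
Proof.
move=> muE A mA.
have ms : measurable_fun setT (@Defs.shift T : Zseq T -> Zseq T).
  by apply: measurable_fun_Zseq => i; exact: measurable_fun_coord.
have [nu nuE] := exists_distribution mu ms.
rewrite -[LHS]nuE; apply: eq_word_cyl_law mA => i w; rewrite nuE -[RHS](muE (i + 1)).
congr (mu _); apply/seteqP; split => X; rewrite /word_cyl /= => E; rewrite -[RHS]E;
  by apply: eq_map => j; rewrite /Defs.shift addrAC.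
Qed.

End process_law.

(** * Entropy *)

Section divergence.
Context {R : realType}.
Implicit Types x y : R.

(** The summand of a relative entropy, with the correction y - x that makes each term nonnegative
    and not only the sum over two laws of equal mass. At x = 0 it is y. *)
Definition kl x y : R := x * ln (x / y) - x + y.

Let klE x y : 0 < x -> 0 < y -> kl x y = x * (expR (ln (y / x)) - 1 - ln (y / x)).
Proof.
move=> x0 y0; rewrite /kl lnK ?posrE ?divr_gt0 //.
rewrite !ln_div ?posrE //; field; lra.
Qed.

Lemma kl_ge0 x y : 0 <= x -> 0 <= y -> (y = 0 -> x = 0) -> 0 <= kl x y.
Proof.
rewrite le_eqVlt => /predU1P[<- y0 _|x0]; first by rewrite /kl mul0r subrr add0r.
rewrite le_eqVlt => /predU1P[<- x0'|y0 _]; first by rewrite x0' ?ltxx in x0.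
rewrite klE // mulr_ge0 ?(ltW x0) //.
by have := expR_ge1Dx (ln (y / x)); lra.
Qed.

Lemma kl_eq0 x y : 0 <= x -> 0 <= y -> (y = 0 -> x = 0) -> kl x y = 0 -> x = y.
Proof.
rewrite le_eqVlt => /predU1P[<- y0 _|x0]; first by rewrite /kl mul0r subrr add0r.
rewrite le_eqVlt => /predU1P[<- x0'|y0 _]; first by rewrite x0' ?ltxx in x0.
rewrite klE // => /eqP; rewrite mulf_eq0 gt_eqF //= => /eqP E.
have [t0|t0] := eqVneq (ln (y / x)) 0; last first.
  by have := expR_gt1Dx t0; lra.
have : y / x = 1 by rewrite -[LHS]lnK ?t0 ?expR0 // posrE divr_gt0.
by move/divr1_eq.
Qed.

Lemma kl_refl x : kl x x = 0.
Proof.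
rewrite /kl addrAC -addrA subrr addr0.
have [->|x0] := eqVneq x 0; first by rewrite mul0r.
by rewrite divff // ln1 mulr0.
Qed.

(** The log-sum inequality. The difference of the two sides is the sum of the divergences of [x i]
    from [y i * (X / Y)], the second family being rescaled to the total mass of the first. The cases
    where a total vanishes are treated apart. *)
Lemma kl_sum (I : finType) (x y : I -> R) :
  (forall i, 0 <= x i) -> (forall i, 0 <= y i) -> (forall i, y i = 0 -> x i = 0) ->
  kl (\sum_i x i) (\sum_i y i) <= \sum_i kl (x i) (y i).
Proof.
move=> x0 y0 xy; set X := \sum_i x i; set Y := \sum_i y i.
have X0 : 0 <= X by exact: sumr_ge0.
have Y0 : 0 <= Y by exact: sumr_ge0.
have [YE|YN] := eqVneq Y 0.
  have yE i : y i = 0.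
    by move/eqP: YE; rewrite psumr_eq0 // => /allP/(_ i (mem_index_enum _))/eqP.
  have xE i : x i = 0 by exact: xy.
  have -> : X = 0 by rewrite /X big1.
  by rewrite YE kl_refl sumr_ge0 // => i _; rewrite xE yE kl_refl.
have [XE|XN] := eqVneq X 0.
  have xE i : x i = 0.
    by move/eqP: XE; rewrite psumr_eq0 // => /allP/(_ i (mem_index_enum _))/eqP.
  rewrite XE {1}/kl mul0r subrr add0r /Y ler_sum // => i _.
  by rewrite xE /kl mul0r subrr add0r.
have {}X0 : 0 < X by rewrite lt_def XN.
have {}Y0 : 0 < Y by rewrite lt_def YN.
suff : 0 <= \sum_i kl (x i) (y i * (X / Y)).
  rewrite [leRHS](_ : _ = \sum_i kl (x i) (y i) - kl X Y) ?subr_ge0 //.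
  have -> : kl X Y = \sum_i (x i * ln (X / Y) - x i + y i).
    by rewrite /kl big_split /= sumrB -mulr_suml.
  rewrite -sumrB.
  rewrite (eq_bigr (fun i => (kl (x i) (y i) - (x i * ln (X / Y) - x i + y i)) +
       (y i * (X / Y) - x i))); last first.
    move=> i _; have := x0 i; rewrite le_eqVlt => /predU1P[<-|xi].
      by rewrite /kl !mul0r; ring.
    have yi : 0 < y i.
      rewrite lt_def y0 andbT; apply/eqP => /xy xE.
      by rewrite xE ltxx in xi.
    rewrite /kl (_ : x i / (y i * (X / Y)) = x i / y i / (X / Y)); last by rewrite invfM mulrA.
    by rewrite [ln (_ / (X / Y))]ln_div ?posrE ?divr_gt0 //; ring.
  rewrite big_split /= [X in _ + X]sumrB -mulr_suml -/X -/Y.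
  by rewrite [Y * _]mulrC divfK // subrr addr0.
apply: sumr_ge0 => i _; apply: kl_ge0 => //; first by rewrite mulr_ge0 // ltW // divr_gt0.
by move=> /eqP; rewrite mulf_eq0 (gt_eqF (divr_gt0 X0 Y0)) orbF => /eqP /xy.
Qed.

End divergence.

Section word_sums.
Context {T : finType}.

(** Words are plain sequences here, so that letters can be added or removed at either end without
    any cast; [sumw_tuple] and [sumw_ffun] connect with indexed sums. *)
Fixpoint sumw (V : nmodType) (n : nat) (F : seq T -> V) : V :=
  if n is n'.+1 then \sum_a sumw n' (fun w => F (a :: w)) else F [::].

Lemma eq_sumw (V : nmodType) n (F G : seq T -> V) :
  (forall w, size w = n -> F w = G w) -> sumw n F = sumw n G.
Proof.
elim: n F G => [|n IHn] F G FG /=; first exact: FG.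
by apply: eq_bigr => a _; apply: IHn => w wn; apply: FG; rewrite /= wn.
Qed.

Lemma sumw_rcons (V : nmodType) n (F : seq T -> V) :
  sumw n.+1 F = sumw n (fun w => \sum_a F (rcons w a)).
Proof. by elim: n F => // n IHn F; apply: eq_bigr => a _; exact: (IHn (fun w => F (a :: w))). Qed.

Lemma sumw_exchange (V : nmodType) (I : finType) n (F : I -> seq T -> V) :
  \sum_i sumw n (F i) = sumw n (fun w => \sum_i F i w).
Proof.
elim: n F => // n IHn F /=; rewrite exchange_big /=.
by apply: eq_bigr => a _; rewrite IHn.
Qed.

Lemma sumwD (V : nmodType) n (F G : seq T -> V) :
  sumw n (fun w => F w + G w) = sumw n F + sumw n G.
Proof. by elim: n F G => // n IHn F G /=; rewrite -big_split; apply: eq_bigr. Qed.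

Lemma sumwN (V : zmodType) n (F : seq T -> V) : sumw n (fun w => - F w) = - sumw n F.
Proof. by elim: n F => // n IHn F /=; rewrite -sumrN; apply: eq_bigr. Qed.

Lemma sumwZ (R : pzRingType) n (c : R) (F : seq T -> R) :
  sumw n (fun w => c * F w) = c * sumw n F.
Proof. by elim: n F => // n IHn F /=; rewrite mulr_sumr; apply: eq_bigr. Qed.

Lemma sumw_tuple (V : nmodType) n (F : seq T -> V) :
  sumw n F = \sum_(w : n.-tuple T) F w.
Proof.
elim: n F => [|n IHn] F /=.
  by rewrite (big_pred1 [tuple]) // => w; apply/esym/eqP; exact: tuple0.
under eq_bigr do rewrite IHn.
rewrite pair_big /= (reindex (fun p : T * n.-tuple T => [tuple of p.1 :: p.2])) //=.
exists (fun w : n.+1.-tuple T => (thead w, [tuple of behead w])) => [[a w] _|w _] /=.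
  by congr (_, _); apply/val_inj.
by rewrite [RHS]tuple_eta; apply/val_inj.
Qed.

Lemma sumw_ffun (V : nmodType) n (F : seq T -> V) :
  sumw n F = \sum_(w : {ffun 'I_n -> T}) F [seq w i | i <- enum 'I_n].
Proof.
rewrite sumw_tuple (reindex (fun w : {ffun 'I_n -> T} => [tuple w i | i < n])) //=.
exists (fun w : n.-tuple T => [ffun i => tnth w i]) => w _.
  apply/ffunP => i; rewrite ffunE (tnth_nth (w i)) /=.
  by rewrite (nth_map i) ?nth_ord_enum // size_enum_ord.
by apply: eq_from_tnth => i; rewrite tnth_mktuple ffunE.
Qed.

End word_sums.

(** * Stationary word probabilities and comparison with the Parry law *)

Section stationary_families.
Context {R : realType} {T : finType}.

Definition stationary_family (v : seq T -> R) : Prop :=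
  [/\ v [::] = 1, forall w, 0 <= v w,
      forall w, \sum_a v (rcons w a) = v w & forall w, \sum_a v (a :: w) = v w].

Definition word_entropy (v : seq T -> R) (n : nat) : R :=
  - sumw n (fun w => v w * ln (v w)).

Lemma sumw_marginal v n s : stationary_family v -> sumw n (fun w => v (w ++ s)) = v s.
Proof.
case=> _ _ _ vl; elim: n => // n IHn /=.
by rewrite sumw_exchange -[RHS]IHn; apply: eq_sumw => w _; rewrite vl.
Qed.

Lemma sumw_family v n : stationary_family v -> sumw n v = 1.
Proof.
move=> sv; have [v1 _ _ _] := sv; rewrite -[RHS]v1 -(sumw_marginal n [::] sv).
by apply: eq_sumw => w _; rewrite cats0.
Qed.

Lemma family_le_rcons v w a : stationary_family v -> v (rcons w a) <= v w.
Proof.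
case=> _ v0 vr _; rewrite -[leRHS]vr (bigD1 a) //= lerDl; exact: sumr_ge0.
Qed.

Lemma word_entropy_nondecreasing v n : stationary_family v ->
  word_entropy v n <= word_entropy v n.+1.
Proof.
move=> sv; have [_ v0 vr _] := sv.
rewrite /word_entropy sumw_rcons lerN2 !sumw_tuple ler_sum // => w _.
rewrite -[X in _ <= X * _]vr mulr_suml ler_sum // => a _.
have := v0 (rcons w a); rewrite le_eqVlt => /predU1P[<-|va]; first by rewrite !mul0r.
rewrite ler_pM2l // ler_ln ?posrE //; first exact: family_le_rcons.
exact: lt_le_trans va (family_le_rcons _ _ sv).
Qed.

End stationary_families.

Section parry_family.
Context {R : realType} {L N : nat}.
Hypothesis L_gt1 : (1 < L)%N.
Hypothesis N_range : (0 < N < L)%N.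
Local Notation T := {set 'I_L}.
Local Notation psi := (@psi R L).
Local Notation lam := (lam R L N).
Implicit Types (a b S : T) (w : seq T).

Definition allowed w : bool := if w is a :: w' then (#|a| == N) && path (@step L) a w' else true.

Definition psi_norm : R := \sum_(S : T | #|S| == N) psi S ^+ 2.

Definition parry w : R :=
  if w is a :: w' then
    if allowed w then psi a * psi (last a w') / (psi_norm * lam ^+ size w') else 0
  else 1.

Lemma psi_norm_gt0 : 0 < psi_norm.
Proof.
have N0 : (N <= L)%N by case/andP: N_range => _ /ltnW.
rewrite /psi_norm (bigD1 [set i : 'I_L | (i < N)%N]%SET) /=; last by rewrite card_ord_lt.
rewrite ltr_pwDl ?exprn_gt0 ?psi_gt0 // sumr_ge0 // => S _.
by rewrite exprn_ge0 // ltW // psi_gt0.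
Qed.

Let lam0 : 0 < lam. Proof. exact: lam_gt0. Qed.

Let psi_r S : #|S| = N -> \sum_(S' | step S S') psi S' = lam * psi S.
Proof. by move=> SN; rewrite psi_right // SN. Qed.

Let psi_l S : #|S| = N -> \sum_(S' | step S' S) psi S' = lam * psi S.
Proof. by move=> SN; rewrite psi_left // SN. Qed.

Lemma allowed_last a w : allowed (a :: w) -> #|last a w| = N.
Proof.
rewrite /allowed => /andP[/eqP aN aw]; rewrite -aN; apply: card_connect.
by apply/connectP; exists w.
Qed.

Lemma allowed_rcons a w b : allowed (rcons (a :: w) b) = allowed (a :: w) && step (last a w) b.
Proof. by rewrite /= rcons_path andbA. Qed.

(** Consistency on the right is the eigenvector equation [psi_right], on the left [psi_left], and
    [psi_norm] makes the one-letter masses add up to 1. *)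
Lemma parry_family : stationary_family parry.
Proof.
have Z0 : psi_norm != 0 by rewrite gt_eqF // psi_norm_gt0.
have l0 : lam != 0 by rewrite gt_eqF.
have nil1 : \sum_a parry [:: a] = 1.
  rewrite (bigID (fun a => #|a| == N)) /= [X in _ + X]big1 ?addr0; last first.
    by move=> a /negPf aN; rewrite /parry /= aN.
  rewrite (eq_bigr (fun a => psi a ^+ 2 / psi_norm)); last first.
    by move=> a aN; rewrite /parry /= aN expr0 mulr1 expr2.
  by rewrite -mulr_suml divff.
split=> //.
- case=> [|a w]; first exact: ler01.
  rewrite /parry; case: ifP => // _; rewrite divr_ge0 ?mulr_ge0 ?exprn_ge0 //; try exact/ltW/psi_gt0.
  + exact/ltW/psi_norm_gt0.
  + exact: ltW.
- case=> [|a w] //; rewrite /parry.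
  under eq_bigr => b do rewrite -/(rcons (a :: w) b) allowed_rcons last_rcons size_rcons.
  case: ifP => aw /=; last by rewrite big1.
  rewrite -big_mkcond /= -[RHS](_ : \sum_(b | step (last a w) b) psi a * psi b / (psi_norm * lam ^+ (size w).+1) = _) //.
  rewrite -mulr_suml -mulr_sumr psi_r ?(allowed_last aw) // exprS; field.
  by rewrite Z0 l0 expf_neq0.
- case=> [|a w] //; rewrite /parry.
  rewrite (eq_bigr (fun b => if step b a && allowed (a :: w) then
     psi b * psi (last a w) / (psi_norm * lam ^+ (size w).+1) else 0)); last first.
    move=> b _; rewrite /allowed /= andbA; case: (boolP (step b a)) => ba; rewrite ?andbF //=.
    by rewrite (card_step ba) andbT.
  case: ifP => aw; last by rewrite big1 // => b _; rewrite andbF.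
  rewrite (eq_bigr (fun b => if step b a then
     psi b * psi (last a w) / (psi_norm * lam ^+ (size w).+1) else 0)); last first.
    by move=> b _; rewrite andbT.
  rewrite -big_mkcond -!mulr_suml psi_l; last by case/andP: aw => /eqP.
  by rewrite exprS; field; rewrite Z0 l0 expf_neq0.
Qed.

Lemma parry_gt0 w : allowed w -> 0 < parry w.
Proof.
case: w => [|a w] aw; first exact: ltr01.
by rewrite /parry aw divr_gt0 ?mulr_gt0 ?exprn_gt0 ?psi_gt0 // psi_norm_gt0.
Qed.

(** The Doob transform by [psi] of the transition matrix of the graph. *)
Definition trans a b : R := if step a b then psi b / (lam * psi a) else 0.

Lemma parry_rcons w a b : parry (rcons (rcons w a) b) = parry (rcons w a) * trans a b.
Proof.
have Z0 : psi_norm != 0 by rewrite gt_eqF // psi_norm_gt0.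
have l0 : lam != 0 by rewrite gt_eqF.
have p0 S : psi S != 0 by rewrite gt_eqF // psi_gt0.
case: w => [|c w]; rewrite /parry.
  rewrite /= /trans; case: (boolP (#|a| == N)) => //= _; last by rewrite mul0r.
  rewrite andbT; case: ifP => _; last by rewrite mulr0.
  by field; rewrite Z0 l0 p0.
have E : allowed (c :: rcons (rcons w a) b) = allowed (c :: rcons w a) && step a b.
  by have := allowed_rcons c (rcons w a) b; rewrite last_rcons.
rewrite !rcons_cons E !last_rcons !size_rcons /trans.
case: (boolP (allowed _)) => _; last by rewrite mul0r.
case: (boolP (step a b)) => _ /=; last by rewrite mulr0.
by rewrite exprS; field; rewrite Z0 l0 p0 ?expf_neq0.
Qed.

Lemma sum_trans a : #|a| = N -> \sum_b trans a b = 1.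
Proof.
move=> aN; rewrite -big_mkcond -mulr_suml psi_r // divff //.
by rewrite mulf_neq0 // gt_eqF // psi_gt0.
Qed.

Lemma trans_ge0 a b : 0 <= trans a b.
Proof. by rewrite /trans; case: ifP => // _; apply: divr_ge0; [|apply: mulr_ge0]; exact/ltW/psi_gt0 || exact: ltW. Qed.

Section comparison.
Variable v : seq T -> R.
Hypothesis sv : stationary_family v.
Hypothesis v_allowed : forall w, v w != 0 -> allowed w.

Let v_ge0 w : 0 <= v w. Proof. by case: sv. Qed.
Let v_rcons w : \sum_a v (rcons w a) = v w. Proof. by case: sv. Qed.
Let v_cons w : \sum_a v (a :: w) = v w. Proof. by case: sv. Qed.

(* Relative entropy of the law of words of length n.+2 with respect to the one
   with the same n.+1 first letters followed by a Parry transition. *)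
Definition defect n : R := sumw n (fun w => \sum_a \sum_b
  kl (v (rcons (rcons w a) b)) (v (rcons w a) * trans a b)).

Let v_step w a b : v (rcons (rcons w a) b) != 0 -> step a b.
Proof.
by move/v_allowed; case: w => [|c w] /=; rewrite ?rcons_path ?last_rcons => /andP[_ /andP[]].
Qed.

Let v_card w a : v (rcons w a) != 0 -> #|a| = N.
Proof. by move/v_allowed; case: w => [/andP[/eqP]|c w /allowed_last] //; rewrite last_rcons. Qed.

Let v_abscont w a b : v (rcons w a) * trans a b = 0 -> v (rcons (rcons w a) b) = 0.
Proof.
move/eqP; rewrite mulf_eq0 => /orP[/eqP v0|].
  by apply/eqP; rewrite eq_le v_ge0 andbT -v0; exact: family_le_rcons.
rewrite /trans; case: ifPn => [_|nab _]; last first.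
  by apply/eqP; apply: contraNT nab; exact: v_step.
by rewrite gt_eqF //; apply: divr_gt0; [|apply: mulr_gt0 => //]; exact: psi_gt0.
Qed.

Let kl_term_ge0 w a b : 0 <= kl (v (rcons (rcons w a) b)) (v (rcons w a) * trans a b).
Proof. by apply: kl_ge0; rewrite ?mulr_ge0 ?trans_ge0 //; exact: v_abscont. Qed.

Lemma defect_ge0 n : 0 <= defect n.
Proof.
by rewrite /defect sumw_tuple; do 3! (apply: sumr_ge0 => ? _); exact: kl_term_ge0.
Qed.

(** By stationarity the words of length n + 2 are obtained from those of length n + 3 by summing
    over the first letter, and such a projection lowers a divergence ([kl_sum]). *)
Lemma defect_nondecreasing n : defect n <= defect n.+1.
Proof.
rewrite /defect /= sumw_exchange !sumw_tuple; apply: ler_sum => w _.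
rewrite [leRHS]exchange_big /=; apply: ler_sum => a _.
rewrite [leRHS]exchange_big /=; apply: ler_sum => b _.
rewrite -(v_cons (rcons (rcons w a) b)) -(v_cons (rcons w a)) mulr_suml.
apply: kl_sum => c //; rewrite -?rcons_cons.
  by rewrite mulr_ge0 // trans_ge0.
exact: v_abscont.
Qed.

Lemma defect_eq0 n : defect n = 0 -> forall w a b, size w = n ->
  v (rcons (rcons w a) b) = v (rcons w a) * trans a b.
Proof.
rewrite /defect sumw_tuple => /eqP.
rewrite psumr_eq0; last by move=> w _; do 2! (apply: sumr_ge0 => ? _); exact: kl_term_ge0.
move=> /allP E w a b wn.
have := E (tcast wn (in_tuple w)) (mem_index_enum _); rewrite val_tcast /=.
rewrite psumr_eq0; last by move=> ? _; apply: sumr_ge0 => ? _; exact: kl_term_ge0.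
move/allP/(_ a (mem_index_enum _)) => /=.
rewrite psumr_eq0; last by move=> ? _; exact: kl_term_ge0.
move/allP/(_ b (mem_index_enum _)) => /= /eqP; apply: kl_eq0 => //.
  by rewrite mulr_ge0 // trans_ge0.
exact: v_abscont.
Qed.

Let kl_row w a : \sum_b kl (v (rcons (rcons w a) b)) (v (rcons w a) * trans a b) =
  (\sum_b v (rcons (rcons w a) b) * ln (v (rcons (rcons w a) b)) - v (rcons w a) * ln (v (rcons w a)))
  + (v (rcons w a) * ln lam + (v (rcons w a) * ln (psi a) - \sum_b v (rcons (rcons w a) b) * ln (psi b))).
Proof.
set u := v (rcons w a).
rewrite (eq_bigr (fun b => let x := v (rcons (rcons w a) b) in
  x * ln x + x * (- ln u + ln lam + ln (psi a)) - x * ln (psi b) - x + u * trans a b)).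
  rewrite /= !big_split /= !sumrN -!mulr_suml !v_rcons -/u -mulr_sumr.
  have -> : u * \sum_b trans a b = u.
    have [->|u0] := eqVneq u 0; first by rewrite mul0r.
    by rewrite sum_trans ?mulr1 // (v_card u0).
  ring.
move=> b _ /=; rewrite /kl; set x := v _.
have [->|x0] := eqVneq x 0; first by rewrite !mul0r; ring.
have xp : 0 < x by rewrite lt_def x0 v_ge0.
have up : 0 < u by apply: (lt_le_trans xp); exact: family_le_rcons.
have pa := psi_gt0 (R := R) a; have pb := psi_gt0 (R := R) b.
have lpa : 0 < lam * psi a by rewrite pmulr_rgt0.
have E : ln (u * (psi b / (lam * psi a))) = ln u + (ln (psi b) - (ln lam + ln (psi a))).
  by rewrite lnM ?posrE ?divr_gt0 // ln_div ?posrE // lnM ?posrE.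
rewrite /trans (v_step x0) ln_div ?posrE // ?E; last by rewrite pmulr_rgt0 // divr_gt0.
by ring.
Qed.

(** The logarithm of the Parry transition from a to b is ln (psi b) - ln (psi a) - ln lam. Under a
    stationary family the two terms in psi have the same mean and cancel, which leaves ln lam. *)
Lemma word_entropyS n : word_entropy v n.+2 = word_entropy v n.+1 + ln lam - defect n.
Proof.
pose X := \sum_a v [:: a] * ln (psi a).
have E1 m : sumw m (fun w => \sum_a v (rcons w a) * ln (psi a)) = X.
  rewrite -sumw_exchange; apply: eq_bigr => a _.
  rewrite (eq_sumw (G := fun w => ln (psi a) * v (w ++ [:: a]))); last first.
    by move=> w _; rewrite cats1 mulrC.
  by rewrite sumwZ sumw_marginal // mulrC.
have E2 : sumw n (fun w => \sum_a \sum_b v (rcons (rcons w a) b) * ln (psi b)) = X.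
  by rewrite -(sumw_rcons n (fun w => \sum_b v (rcons w b) * ln (psi b))) E1.
have E3 : sumw n (fun w => \sum_a v (rcons w a) * ln lam) = ln lam.
  rewrite (eq_sumw (G := fun w => ln lam * v w)); last by move=> w _; rewrite -mulr_suml v_rcons mulrC.
  by rewrite sumwZ sumw_family // mulr1.
have E4 : defect n =
    (sumw n.+2 (fun w => v w * ln (v w)) - sumw n.+1 (fun w => v w * ln (v w))) + ln lam.
  rewrite sumw_rcons !(sumw_rcons n) -[X in _ + X]E3 -[RHS]addr0 -[X in _ + X](subrr X).
  rewrite -{1}(E1 n) -E2 -!sumwN -!sumwD; apply: eq_sumw => w _.
  rewrite (eq_bigr _ (fun a _ => kl_row w a)) !big_split /= !sumrN; ring.
rewrite /word_entropy E4; ring.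
Qed.

(** Vanishing defects make [v] a Markov chain with the Parry transitions, and only its one-letter
    law remains to be found. The density [u] with respect to psi ^ 2 is at each state an average of
    its values at the predecessors, so the maximum principle and irreducibility force it to be
    constant on the states. *)
Lemma defect0_parry : (forall n, defect n = 0) -> forall w, v w = parry w.
Proof.
move=> d0.
have dE n w a b : size w = n -> v (rcons (rcons w a) b) = v (rcons w a) * trans a b.
  by apply: defect_eq0.
pose u a := v [:: a] / psi a ^+ 2.
have p2 a : 0 < psi a ^+ 2 by rewrite exprn_gt0 // psi_gt0.
have NL : (N <= L)%N by case/andP: N_range => _ /ltnW.
have S0P : #|[set i : 'I_L | (i < N)%N]%SET| == N by rewrite card_ord_lt.
(* [m] is a state where [u] is maximal; [pred_max] below propagates the maximum backwards along the
   arrows. *)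
have [m mN mmax] := @arg_maxP _ R _ _ (fun S : T => #|S| == N) u S0P.
have pred_max a b : step a b -> #|b| = N -> u b = u m -> u a = u m.
  move=> ab bN ub; have aN : #|a| = N by rewrite -bN (card_step ab).
  have E : \sum_(c | step c b) (u m - u c) * psi c = 0.
    rewrite (eq_bigr (fun c => u m * psi c - u c * psi c)); last by move=> c _; rewrite mulrBl.
    rewrite sumrB -mulr_sumr psi_l // -ub.
    rewrite [X in _ - X](_ : _ = u b * (lam * psi b)) ?subrr //.
    rewrite [in RHS]/u -[v [:: b]]v_cons.
    rewrite [X in X / _](eq_bigr (fun c => v [:: c] * trans c b)) => [|c _]; last exact: (dE 0%N [::] c b).
    rewrite /trans !mulr_suml big_mkcond; apply: eq_bigr => c _.
    case: ifP => cb; last by rewrite mulr0 !mul0r.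
    by rewrite /u; field; rewrite !gt_eqF // psi_gt0.
  move/eqP: E; rewrite psumr_eq0.
    move/allP/(_ a (mem_index_enum _)); rewrite ab /= mulf_eq0 (gt_eqF (psi_gt0 a)) orbF subr_eq0.
    by move/eqP.
  move=> c cb; rewrite mulr_ge0 ?(ltW (psi_gt0 _)) // subr_ge0.
  by apply: mmax; rewrite -(card_step cb) bN.
have um a : #|a| = N -> u a = u m.
  move=> aN; have /connectP[p] := connect_step L_gt1 R (etrans aN (esym (eqP mN))).
  elim: p a aN => [|c p IHp] a aN /=; first by move=> _ ->.
  case/andP=> ac cp pm; have cN : #|c| = N by rewrite (card_step ac).
  by apply: (pred_max _ c) => //; exact: IHp.
have v1 a : #|a| = N -> v [:: a] = u m * psi a ^+ 2.
  by move=> aN; rewrite -(um a aN) /u divfK // gt_eqF.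
have v1N a : #|a| != N -> v [:: a] = 0.
  by apply: contraNeq => /v_allowed; rewrite /= andbT.
have uE : u m * psi_norm = 1.
  have [vnil _ _ _] := sv; rewrite -[RHS]vnil -(v_cons [::]).
  rewrite (bigID (fun a => #|a| == N)) /= [X in _ + X]big1 => [|a /v1N //].
  by rewrite addr0 mulr_sumr; apply: eq_bigr => a /eqP aN; rewrite v1.
elim/last_ind => [|w b]; first by case: sv.
case/lastP: w => [|w a] IHw; last by rewrite (dE (size w)) // IHw parry_rcons.
rewrite /parry /= andbT; case: eqP => [bN|/eqP /v1N //].
have Z0 := psi_norm_gt0.
rewrite v1 // mulr1 -expr2 [RHS]mulrC; congr (_ * _).
by rewrite -[RHS]mul1r -uE mulfK // gt_eqF.
Qed.

(** The increment ln lam - defect of the word entropy is nonnegative, since word entropies are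
    nondecreasing in the length. *)
Lemma defect_le n : defect n <= ln lam.
Proof.
have := word_entropy_nondecreasing n.+1 sv; rewrite word_entropyS; lra.
Qed.

Lemma word_entropy_sum n :
  word_entropy v n.+1 = word_entropy v 1 + n%:R * ln lam - \sum_(i < n) defect i.
Proof.
elim: n => [|n IHn]; first by rewrite mul0r big_ord0 addr0 subr0.
by rewrite word_entropyS IHn big_ord_recr /= -natr1; ring.
Qed.

(** The quotient is a Cesaro mean of the increments of the word entropy, and these converge because
    the defects are nondecreasing and bounded. *)
Lemma cvg_word_entropy :
  word_entropy v n / n%:R @[n --> \oo] --> ln lam - sup (range defect).
Proof.
have dnd : nondecreasing_seq defect by apply/nondecreasing_seqP; exact: defect_nondecreasing.
have dub : has_ubound (range defect).
  by exists (ln lam) => _ [n _ <-]; exact: defect_le.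
have dcvg : defect @ \oo --> sup (range defect) by exact: nondecreasing_cvgn.
(* The mean starts with the one-letter entropy, which is not of the form ln lam - defect; the
   increments come after it. *)
pose g k := if k is k'.+1 then ln lam - defect k' else word_entropy v 1.
have gcvg : g @ \oo --> ln lam - sup (range defect).
  rewrite -(cvg_shiftS g) /=; apply: cvgB => //; exact: cvg_cst.
rewrite -(cvg_shiftS (fun n => word_entropy v n / n%:R)) /=.
have -> : (fun n => word_entropy v n.+1 / n.+1%:R) = arithmetic_mean g; last exact: cesaro.
apply/funext => n.
rewrite /arithmetic_mean /= seriesEord /= big_ord_recl /= sumrB sumr_const card_ord.
by rewrite mulrC word_entropy_sum mulr_natl addrA.
Qed.

End comparison.

End parry_family.

(** * Existence and uniqueness of the measure of maximal entropy *)

Section max_entropy.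
Context {R : realType} {L N : nat}.
Hypothesis L_gt1 : (1 < L)%N.
Hypothesis N_range : (0 < N < L)%N.
Local Notation T := {set 'I_L}.
Local Notation lam := (lam R L N).
Local Notation parry := (@parry R L N).
Implicit Types nu : probability (Zseq T) R.

Lemma measure_countable_bigcup0 d (U : measurableType d) (m : {measure set U -> \bar R})
    (I : countType) (F : I -> set U) :
  (forall i, measurable (F i)) -> (forall i, m (F i) = 0%E) -> m (\bigcup_i F i) = 0%E.
Proof.
move=> mF m0; pose G k := if unpickle k is Some i then F i else set0.
have -> : \bigcup_i F i = \bigcup_k G k.
  apply/seteqP; split => x [i _ Fx]; first by exists (pickle i); rewrite // /G pickleK.
  by move: Fx; rewrite /G; case: unpickle => // j Fj; exists j.
have mG k : measurable (G k) by rewrite /G; case: unpickle.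
apply/negligibleP; first exact: bigcupT_measurable.
apply: negligible_bigcup => k; apply/negligibleP; first exact: mG.
by rewrite /G; case: unpickle => //; exact: measure0.
Qed.

Definition word_law nu (w : seq T) : R := fine (nu (word_cyl 0 w)).

Let chain_bad (p : int * (T * T)) : set (Zseq T) :=
  if (#|p.2.1| == N) && step p.2.1 p.2.2 then set0 else word_cyl p.1 [:: p.2.1; p.2.2].

Let chainC : ~` (chain N : set (Zseq T)) = \bigcup_p chain_bad p.
Proof.
apply/seteqP; split => X /=.
  move=> nX; apply: contrapT => H; apply: nX.
  suff H' i : (#|X i| == N) && step (X i) (X (i + 1)).
    by split=> i; case/andP: (H' i) => // /eqP.
  apply: contraT => nst; exfalso; apply: H; exists (i, (X i, X (i + 1))) => //.
  by rewrite /chain_bad /= (negPf nst) /word_cyl /= addr0.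
case=> -[i [a b]] _; rewrite /chain_bad /=; case: ifPn => // nab.
rewrite /word_cyl /= addr0 => -[Xa Xb] [cX sX].
by move: nab; rewrite -Xa -Xb cX eqxx sX.
Qed.

Let measurable_chain_bad p : measurable (chain_bad p).
Proof. by rewrite /chain_bad; case: ifP => // _; exact: measurable_word_cyl. Qed.

Lemma measurable_chain : measurable (chain N : set (Zseq T)).
Proof.
rewrite -(setCK (chain N)); apply: measurableC; rewrite chainC.
by apply: countable_bigcupT_measurable.
Qed.

Lemma chain_allowed X w : chain N X -> word_cyl 0 w X -> @allowed L N w.
Proof.
move=> [cX sX] Xw; rewrite -Xw.
elim: (size w) {Xw} => [|n IHn] //.
move: IHn; case: n => [|n] IHn; first by rewrite /= cX eqxx.
rewrite -addn1 iotaD map_cat add0n cats1.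
rewrite [iota 0 n.+1]/= [map _ (_ :: _)]/= allowed_rcons.
rewrite [X in allowed X && _](_ : _ = [seq X (0 + Posz j) | j <- iota 0 n.+1]) // IHn /=.
have -> : last (X (0 + 0)) [seq X (0 + Posz j) | j <- iota 1 n] = X (Posz n).
  have lastE m k : last (X (0 + Posz k)) [seq X (0 + Posz j) | j <- iota k.+1 m] = X (Posz (k + m)).
    by elim: m k => [|m IHm] k /=; rewrite ?addn0 ?add0r // IHm addSnnS.
  by rewrite lastE add0n.
by rewrite add0r; have := sX (Posz n); rewrite intS addrC.
Qed.

(** Turns positive probability into existence: an event of positive mass contains a bi-infinite path
    of the chain. This is how allowed words are related to actual paths. *)
Lemma meet_chain nu A : measurable A -> nu (chain N) = 1%E -> nu A != 0%E ->
  A `&` chain N !=set0.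
Proof.
move=> mA nuN; apply: contraPP => /set0P/negP/negPn/eqP E; apply/negP/negPn/eqP.
by have := probability_setI_full measurable_chain mA nuN; rewrite setIC E measure0 => <-.
Qed.

Section invariant.
Variable nu : probability (Zseq T) R.
Hypothesis nu_inv : invariant_on_chain N nu.

Lemma invariant_word_cyl i w : nu (word_cyl i w) = nu (word_cyl 0 w).
Proof.
have E j : nu (word_cyl (j + 1) w) = nu (word_cyl j w).
  have [_ /(_ _ (measurable_word_cyl j w)) <-] := nu_inv.
  congr (nu _); apply/seteqP; split => X; rewrite /word_cyl /= => H; rewrite -[RHS]H;
  by apply: eq_map => k; rewrite /Defs.shift addrAC.
case: i => n; elim: n => [|n IHn] //.
- by rewrite -IHn -(E (Posz n)) intS addrC.
- by rewrite -(E (Negz 0)).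
- by rewrite -IHn -(E (Negz n.+1)); congr (nu (word_cyl _ _)); lia.
Qed.

Lemma word_lawE i w : nu (word_cyl i w) = (word_law nu w)%:E.
Proof.
rewrite invariant_word_cyl /word_law fineK // fin_num_measure //.
exact: measurable_word_cyl.
Qed.

Lemma word_law_stationary : stationary_family (word_law nu).
Proof.
split.
- apply: EFin_inj; rewrite -(word_lawE 0) (_ : word_cyl 0 [::] = setT) ?probability_setT //.
  by apply/seteqP; split.
- by move=> w; rewrite -lee_fin -(word_lawE 0).
- move=> w; apply: EFin_inj; rewrite -sumEFin -(word_lawE 0 w) word_cyl_split_right.
  by apply: eq_bigr => a _; exact/esym/word_lawE.
- move=> w; apply: EFin_inj; rewrite -sumEFin -(word_lawE (-1 + 1) w) word_cyl_split_left.
  by apply: eq_bigr => a _; exact/esym/word_lawE.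
Qed.

Lemma word_law_allowed w : word_law nu w != 0 -> @allowed L N w.
Proof.
move=> w0.
have : word_cyl 0 w `&` chain N !=set0.
  apply: (@meet_chain nu) => //; [exact: measurable_word_cyl|exact: nu_inv.1|].
  by rewrite word_lawE eqe.
by case=> X [Xw XN]; exact: chain_allowed XN Xw.
Qed.

Lemma block_entropyE n : block_entropy nu n = word_entropy (word_law nu) n.
Proof.
rewrite /block_entropy /word_entropy sumw_ffun; congr (- _); apply: eq_bigr => w _.
suff -> : word_prob nu w = word_law nu [seq w i | i <- enum 'I_n] by [].
rewrite /word_prob /word_law; congr (fine (nu _)); apply/seteqP; split => X /=; rewrite /word_cyl /=.
  move=> Xw; rewrite size_map size_enum_ord -val_enum_ord -map_comp.
  by apply: eq_map => i /=; rewrite add0r.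
rewrite size_map size_enum_ord -val_enum_ord -map_comp => E i.
by have /eq_in_map/(_ i) := E; rewrite /= add0r => -> //; rewrite mem_enum.
Qed.

Lemma entropy_invariant : entropy nu = ln lam - sup (range (@defect R L N (word_law nu))).
Proof.
apply/cvg_lim => //; under eq_fun do rewrite block_entropyE.
exact: (cvg_word_entropy L_gt1 N_range word_law_stationary word_law_allowed).
Qed.

Let defect_sup n : @defect R L N (word_law nu) n <= sup (range (@defect R L N (word_law nu))).
Proof.
apply: ub_le_sup; last by exists n.
exists (ln lam) => _ [k _ <-].
exact: (defect_le L_gt1 N_range word_law_stationary word_law_allowed).
Qed.

Let defect_pos n : 0 <= @defect R L N (word_law nu) n.
Proof. exact: (defect_ge0 L_gt1 N_range word_law_stationary word_law_allowed). Qed.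

Lemma entropy_invariant_le : entropy nu <= ln lam.
Proof.
rewrite entropy_invariant gerBl.
exact: le_trans (defect_pos 0) (defect_sup 0).
Qed.

Lemma entropy_max_parry : ln lam <= entropy nu -> forall w, word_law nu w = parry w.
Proof.
rewrite entropy_invariant => H.
apply: (defect0_parry L_gt1 N_range word_law_stationary word_law_allowed) => n.
by have := defect_sup n; have := defect_pos n; lra.
Qed.

End invariant.

Lemma exists_parry_measure : exists mu : probability (Zseq T) R,
  [/\ forall i w, mu (word_cyl i w) = (parry w)%:E,
      max_entropy_measure N mu,
      (forall nu, max_entropy_measure N nu -> forall A, measurable A -> nu A = mu A)
    & entropy mu = ln lam].
Proof.
have [p1 p0 pr pl] := @parry_family R L N L_gt1 N_range.
have [mu muE] := stationary_process p1 p0 pr pl.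
exists mu.
have mu_inv : invariant_on_chain N mu.
  split; last by apply: shift_invariant => i j w; rewrite !muE.
  have : mu (~` chain N) = 0%E.
    rewrite chainC; apply: measure_countable_bigcup0 => //.
    move=> -[i [a b]]; rewrite /chain_bad /=; case: ifPn => ab; rewrite ?measure0 //.
    by rewrite muE /parry /= andbT (negPf ab).
  have mc := measurable_chain.
  move=> h0; rewrite -(setCK (chain N)) probability_setC ?h0 ?sube0 //; exact: measurableC.
have lawE w : word_law mu w = parry w by rewrite /word_law muE.
have mu_ent : entropy mu = ln lam.
  rewrite entropy_invariant // (_ : range _ = [set 0]) ?sup1 ?subr0 //.
  have d0 n : @defect R L N (word_law mu) n = 0.
    rewrite /defect sumw_tuple big1 // => w _; rewrite big1 // => a _; rewrite big1 // => b _.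
    by rewrite !lawE parry_rcons // kl_refl.
  by apply/seteqP; split => [_ [n _ <-]|_ ->]; [rewrite d0|exists 0%N].
have mu_max : max_entropy_measure N mu.
  by split=> // nu nu_inv; rewrite mu_ent; exact: entropy_invariant_le.
split=> // nu [nu_inv nu_max]; apply: eq_word_cyl_law => i w.
rewrite muE word_lawE // entropy_max_parry // -mu_ent; exact: nu_max.
Qed.

End max_entropy.

Lemma psi_bounds (R : realType) (L : nat) : exists c : R * R,
  [/\ 0 < c.1, 0 < c.2 & forall S : {set 'I_L}, c.1 <= psi S <= c.2].
Proof.
pose B : R := \sum_(S : {set 'I_L}) (psi S)^-1.
have B0 : 0 < B.
  rewrite /B (bigD1 finset.set0) //= ltr_pwDl ?invr_gt0 ?psi_gt0 // sumr_ge0 // => S _.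
  by rewrite invr_ge0 ltW // psi_gt0.
exists (B^-1, \sum_(S : {set 'I_L}) psi S) => /=; split.
- by rewrite invr_gt0.
- rewrite (bigD1 finset.set0) //= ltr_pwDl ?psi_gt0 // sumr_ge0 // => S _.
  by rewrite ltW // psi_gt0.
move=> S; apply/andP; split.
  rewrite -[leRHS]invrK lef_pV2 ?posrE ?invr_gt0 ?psi_gt0 //.
  rewrite /B (bigD1 S) //= lerDl sumr_ge0 // => S' _.
  by rewrite invr_ge0 ltW // psi_gt0.
by rewrite (bigD1 S) //= lerDl sumr_ge0 // => S' _; rewrite ltW // psi_gt0.
Qed.

(** * Exponential growth of the number of words *)

Section topological_entropy.
Context {R : realType} {L N : nat}.
Hypothesis L_gt1 : (1 < L)%N.
Hypothesis N_range : (0 < N < L)%N.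
Local Notation T := {set 'I_L}.
Local Notation lam := (lam R L N).

(** An allowed word extends to a bi-infinite path because its cylinder has positive Parry
    measure. *)
Lemma card_chain_words n : #|chain_words L N n|%:R =
  sumw n (fun w : seq T => (@allowed L N w)%:R) :> R.
Proof.
rewrite sumw_ffun -sum1_card natr_sum [RHS]big_mkcond [LHS]big_mkcond /=.
have [mu [muE [mu_inv _] _ _]] := @exists_parry_measure R L N L_gt1 N_range.
apply: eq_bigr => w _; rewrite inE.
set s := [seq w i | i <- enum 'I_n].
have E X : (forall i : 'I_n, X (Posz i) = w i) <-> word_cyl 0 s X.
  rewrite /word_cyl /= /s size_map size_enum_ord -val_enum_ord -map_comp; split=> [Xw|Xw i].
    by apply: eq_map => i /=; rewrite add0r.
  by have /eq_in_map/(_ i) := Xw; rewrite /= add0r => -> //; rewrite mem_enum.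
case: (boolP (allowed s)) => [sa|sna].
  have [X [Xs XN]] : word_cyl 0 s `&` chain N !=set0.
    apply: (@meet_chain _ _ _ mu) => //; [exact: measurable_word_cyl|exact: mu_inv.1|].
    by rewrite muE eqe gt_eqF // parry_gt0.
  by rewrite asboolT //; exists X => //; apply/E.
rewrite asboolF // => -[X XN /E Xs]; move/negP: sna; apply; exact: chain_allowed XN Xs.
Qed.

Let C n : R := sumw n (fun w : seq T => (@allowed L N w)%:R).

(** Weighting words by [psi] of their last letter makes the count exactly geometric with ratio lam
    ([AE]); the bounds on [psi] then compare it with the true count [C n.+1]. *)
Let A n : R := sumw n (fun w : seq T => \sum_b (@allowed L N (rcons w b))%:R * psi b).

Let AE n : A n = lam ^+ n * A 0.
Proof.
elim: n => [|n IHn]; first by rewrite expr0 mul1r.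
rewrite exprS -mulrA -IHn /A -sumwZ sumw_rcons; apply: eq_sumw => w _.
rewrite mulr_sumr; apply: eq_bigr => c _.
have [cc|cc] := boolP (@allowed L N (rcons w c)); last first.
  rewrite mul0r mulr0 big1 // => b _.
  rewrite (_ : allowed _ = false) ?mul0r //; apply: contraNF cc.
  by case: w => [|d w]; [rewrite /= !andbT => /andP[]|rewrite !rcons_cons -rcons_cons allowed_rcons => /andP[]].
have cN : #|c| = N.
  by move: cc; case: w => [/andP[/eqP]|d w /allowed_last] //; rewrite last_rcons.
have stE b : @allowed L N (rcons (rcons w c) b) = step c b.
  move: cc; case: w => [|d w] cc; first by rewrite /= cN eqxx andbT.
  have := @allowed_rcons L N d (rcons w c) b; rewrite last_rcons => E.
  by rewrite !rcons_cons E -rcons_cons cc.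
rewrite mul1r; have := psi_right (R := R) L_gt1 c; rewrite cN => <-.
rewrite [RHS]big_mkcond; apply: eq_bigr => b _; rewrite stE.
by case: (step c b); rewrite ?mul1r ?mul0r.
Qed.

Let A0_gt0 : 0 < A 0.
Proof.
have NL : (N <= L)%N by case/andP: N_range => _ /ltnW.
rewrite /A /= (bigD1 [set i : 'I_L | (i < N)%N]%SET) //= card_ord_lt // eqxx mul1r.
rewrite ltr_pwDl ?psi_gt0 // sumr_ge0 // => b _.
by rewrite mulr_ge0 // ltW // psi_gt0.
Qed.

Lemma cvg_topological_entropy :
  ln #|chain_words L N n|%:R / n%:R @[n --> \oo] --> ln lam.
Proof.
have [[c1 c2] /= [c10 c20 psiB]] := psi_bounds R L.
have l0 : 0 < lam by exact: lam_gt0.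
have CA n : c1 * C n.+1 <= A n <= c2 * C n.+1.
  rewrite /C /A sumw_rcons -!sumwZ !sumw_tuple.
  apply/andP; split; apply: ler_sum => w _; rewrite mulr_sumr; apply: ler_sum => b _.
    by rewrite [leLHS]mulrC ler_wpM2l //; case/andP: (psiB b).
  by rewrite [leRHS]mulrC ler_wpM2l //; case/andP: (psiB b).
have C0 n : 0 < C n.+1.
  have /andP[_] := CA n; rewrite AE => H; rewrite -(pmulr_rgt0 _ c20).
  by apply: lt_le_trans H; rewrite mulr_gt0 // exprn_gt0.
have lnC n : n%:R * ln lam + (ln (A 0) - ln c2) <= ln (C n.+1) <=
    n%:R * ln lam + (ln (A 0) - ln c1).
  have E : n%:R * ln lam + ln (A 0) = ln (lam ^+ n * A 0).
    by rewrite lnM ?posrE ?exprn_gt0 // lnXn // mulr_natl.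
  rewrite !addrA E lerBlDr lerBrDr -!lnM ?posrE // !ler_ln ?posrE ?mulr_gt0 ?exprn_gt0 //.
  by rewrite -AE ![C _ * _]mulrC andbC; exact: CA.
have lim K : (n%:R * ln lam + K) / n.+1%:R @[n --> \oo] --> ln lam.
  have -> : (fun n => (n%:R * ln lam + K) / n.+1%:R) =
      (fun n => ln lam + (K - ln lam) * harmonic n).
    apply/funext => n; rewrite /harmonic /= -natr1; field.
    by rewrite natr1 pnatr_eq0.
  rewrite -[X in _ --> X](_ : ln lam + (K - ln lam) * 0 = _); last by rewrite mulr0 addr0.
  by apply: cvgD; [exact: cvg_cst|apply: cvgMr; exact: cvg_harmonic].
rewrite -(cvg_shiftS (fun n => ln #|chain_words L N n|%:R / n%:R)) /=.
apply: (squeeze_cvgr _ (lim (ln (A 0) - ln c2)) (lim (ln (A 0) - ln c1))).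
near=> n; rewrite card_chain_words -/(C _).
by rewrite !ler_pM2r ?invr_gt0 ?ltr0n //; exact: lnC.
Unshelve. all: by end_near.
Qed.

End topological_entropy.

(** * Sums over marked times and their limits *)

Section expectation.
Context {d} {T : measurableType d} {R : realType} (P : probability T R).

Lemma integrable_bounded (f : T -> R) (C : R) :
  measurable_fun setT f -> (forall x, `|f x| <= C) -> P.-integrable setT (EFin \o f).
Proof.
move=> mf fC; apply: measurable_bounded_integrable => //.
  by apply: (@le_lt_trans _ _ 1%E); [exact: probability_le1|exact: ltry].
exists C; split; first exact: num_real.
by move=> M CM x _; exact: le_trans (fC x) (ltW CM).
Qed.

Lemma bounded_cvg_Rintegral (f_ : nat -> T -> R) (f : T -> R) (C : R) (N : set T) :
  (forall n, measurable_fun setT (f_ n)) -> measurable_fun setT f ->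
  (forall n x, `|f_ n x| <= C) -> measurable N -> P N = 0%E ->
  (forall x, ~ N x -> f_ n x @[n --> \oo] --> f x) ->
  \int[P]_x f_ n x @[n --> \oo] --> \int[P]_x f x.
Proof.
move=> mf_ mf fC mN N0 cvgf.
have [|||||fi _ H] := @dominated_convergence _ _ _ P setT measurableT
  (fun n => EFin \o f_ n) (EFin \o f) (EFin \o cst C).
- by move=> n; apply/measurable_EFinP.
- exact/measurable_EFinP.
- exists N; split => // x /= H; apply: contrapT => Nx; apply: H => _.
  by apply: cvg_EFin; [exact: nearW|exact: cvgf].
- exact: finite_measure_integrable_cst.
- by apply: aeW => x n _; rewrite lee_fin.
have fint : (\int[P]_x (EFin \o f) x)%E \is a fin_num by exact: integrable_fin_num.
move: H; rewrite -[in X in _ --> X -> _](fineK fint).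
by move/fine_cvg; exact.
Qed.

Lemma Rintegral_finite_range (F : finType) (X : T -> F) (g : F -> R) :
  (forall z, measurable [set x | X x = z]) ->
  \int[P]_x g (X x) = \sum_z g z * fine (P [set x | X x = z]).
Proof.
move=> mX.
pose ind z : T -> R := \1_[set x | X x = z].
have mind z : measurable_fun setT (ind z) by exact: measurable_indic.
have bind z x : `|ind z x| <= 1.
  by rewrite /ind indicE; case: (_ \in _); rewrite ?normr1 ?normr0.
have E x : g (X x) = \sum_z g z * ind z x.
  rewrite (bigD1 (X x)) //= big1 ?addr0 => [|z zx]; rewrite /ind indicE.
    by rewrite mem_set //= mulr1.
  by rewrite memNset ?mulr0 //= => /esym/eqP; rewrite (negPf zx).
under eq_Rintegral do rewrite E.
suff H (r : seq F) : P.-integrable setT (EFin \o (fun x => \sum_(z <- r) g z * ind z x)) /\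
    \int[P]_x (\sum_(z <- r) g z * ind z x) = \sum_(z <- r) g z * fine (P [set x | X x = z]).
  by have [_] := H (index_enum F).
have iz z : P.-integrable setT (EFin \o (fun x => g z * ind z x)).
  apply: (@integrable_bounded _ `|g z|); first exact: measurable_funM.
  by move=> x; rewrite normrM ler_piMr.
elim: r => [|z r [IH1 IH2]].
  under eq_fun do rewrite big_nil.
  split; first exact: finite_measure_integrable_cst.
  by rewrite big_nil Rintegral_cst // mul0r.
have Er x : \sum_(z <- z :: r) g z * ind z x = g z * ind z x + \sum_(z <- r) g z * ind z x.
  by rewrite big_cons.
split.
  by under eq_fun do rewrite Er; have := integrableD measurableT (iz z) IH1.
under eq_Rintegral do rewrite Er.
rewrite RintegralD // IH2 big_cons; congr (_ + _).
rewrite RintegralZl //; last exact: (integrable_bounded (mind z) (bind z)).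
by rewrite /Rintegral integral_indic // setIT.
Qed.

End expectation.

Section tannery.
Context {R : realType}.

Lemma cvg_big_sum (W : Type) (F : set_system W) {FF : Filter F} (I : Type) (r : seq I)
    (Q : pred I) (f : W -> I -> R) (l : I -> R) :
  (forall i, Q i -> f x i @[x --> F] --> l i) ->
  \sum_(i <- r | Q i) f x i @[x --> F] --> \sum_(i <- r | Q i) l i.
Proof.
move=> fl; elim: r => [|i r IHr].
  by under eq_fun do rewrite big_nil; rewrite big_nil; exact: cvg_cst.
under eq_fun do rewrite big_cons; rewrite big_cons.
by case: ifP => [/fl fi|_ //]; exact: cvgD.
Qed.

Lemma series_tail_le (u b : nat -> R) K M : (forall n, `|u n| <= b n) -> cvgn (series b) ->
  (K <= M)%N -> `|series u M - series u K| <= limn (series b) - series b K.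
Proof.
move=> ub cb KM.
have b0 n : 0 <= b n by exact: le_trans (ub n).
rewrite sub_series_geq // (le_trans (ler_norm_sum _ _ _)) //.
apply: (@le_trans _ _ (\sum_(K <= k < M) b k)); first by apply: ler_sum => n _.
rewrite -sub_series_geq // lerD2r; apply: nondecreasing_cvgn_le => //.
by apply/nondecreasing_seqP => n; rewrite seriesSr lerDl.
Qed.

(** Dominated convergence for series: [b] controls all tails beyond a rank [K] uniformly in i, and
    the first [K] terms converge one by one. The i-th series is a finite sum, its terms being zero
    from [N i] on. *)
Lemma tannery (t : nat -> nat -> R) (s b : nat -> R) (N : nat -> nat) :
  (forall n, t i n @[i --> \oo] --> s n) -> (forall i n, `|t i n| <= b n) ->
  cvgn (series b) -> (forall i n, (N i <= n)%N -> t i n = 0) ->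
  cvgn (series s) /\ series (t i) (N i) @[i --> \oo] --> limn (series s).
Proof.
move=> ts tb cb tN.
have sb n : `|s n| <= b n.
  apply: (ler_cvg_to (cvg_norm (ts n)) (cvg_cst (b n))).
  by apply: nearW => i; exact: tb.
have cs : cvgn (series s).
  apply: normed_cvg; apply: (series_le_cvg _ _ _ cb) => // n.
  - exact: normr_ge0.
  - exact: le_trans (sb n).
split=> //.
apply/cvgrPdist_lt => e e0.
have e3 : 0 < e / 3 by rewrite divr_gt0.
have /cvgrPdist_lt/(_ _ e3)[K _ bK] := cb.
have {}bK : limn (series b) - series b K < e / 3.
  by have := bK K (leqnn K); rewrite /= ltr_norml => /andP[].
have tcvg : series (t i) K @[i --> \oo] --> series s K.
  by rewrite seriesEord; under eq_fun do rewrite seriesEord; apply: cvg_big_sum => k _; exact: ts.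
have stail : `|limn (series s) - series s K| <= limn (series b) - series b K.
  have H : (fun M => `|series s M - series s K|) @ \oo --> `|limn (series s) - series s K|.
    by apply: cvg_norm; apply: cvgB => //; exact: cvg_cst.
  apply: (ler_cvg_to H (cvg_cst (limn (series b) - series b K))).
  near=> M; apply: series_tail_le => //; near: M; exact: nbhs_infty_ge.
near=> i.
have ti : `|series s K - series (t i) K| < e / 3.
  by near: i; move/cvgrPdist_lt : tcvg; apply.
have tNi : `|series (t i) (N i) - series (t i) K| <= limn (series b) - series b K.
  case: (leqP K (N i)) => [KN|NK]; first exact: series_tail_le.
  rewrite -opprB normrN sub_series_geq ?(ltnW NK) // big_nat_cond big1 => [|k].
    rewrite normr0 subr_ge0; apply: nondecreasing_cvgn_le => //.
    by apply/nondecreasing_seqP => n; rewrite seriesSr lerDl (le_trans _ (tb i n)).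
  by rewrite andbT => /andP[Nk _]; exact: tN.
rewrite (_ : _ - _ = (limn (series s) - series s K) + (series s K - series (t i) K) -
  (series (t i) (N i) - series (t i) K)); last by ring.
rewrite (le_lt_trans (ler_normB _ _)) // (le_lt_trans (lerD (ler_normD _ _) (lexx _))) //.
by lra.
Unshelve. all: by end_near.
Qed.

End tannery.

(** * Independent uniform points and their cells *)

Section tuple_law.
Context {R : realType} {d} {Y : measurableType d} (beta : probability Y R).

(** The product law is built one factor at a time. The family [B] is indexed by [nat] rather than by
    ordinals so that the induction may shift it. *)
Lemma exists_tuple_law n : exists P : probability (n.-tuple Y) R,
  forall B : nat -> set Y, (forall i, measurable (B i)) ->
  P [set t : n.-tuple Y | forall i : 'I_n, B i (tnth t i)] = (\prod_(i < n) beta (B i))%E.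
Proof.
elim: n => [|n [P IHP]].
  have mc : measurable_fun [set: Y] (fun _ : Y => [tuple] : 0.-tuple Y) by exact: measurable_cst.
  have [P _] := exists_distribution beta mc.
  exists P => B mB; rewrite big_ord0 (_ : [set _ | _] = setT) ?probability_setT //.
  by apply/seteqP; split => // t _ [].
have mc : measurable_fun setT (fun x : Y * n.-tuple Y => [the n.+1.-tuple Y of x.1 :: x.2]).
  exact: measurable_cons.
have [Q QE] := exists_distribution (beta \x P)%E mc.
exists Q => B mB; rewrite QE big_ord_recl /=.
rewrite -(IHP (fun i => B i.+1)) // -product_measure1E //; last first.
  rewrite (_ : [set _ | _] = \bigcap_(i in [set: 'I_n]) [set t : n.-tuple Y | B i.+1 (tnth t i)]).
    apply: fin_bigcap_measurable => [|i _]; first exact: finite_finset.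
    by have := @measurable_tnth _ Y n i measurableT _ (mB i.+1); rewrite setTI.
  by apply/seteqP; split => t /= H i; [move=> _; exact: H|exact: (H i I)].
congr (_ _); apply/seteqP; split => -[y t] /= H.
  split; first by have := H ord0.
  by move=> i; have := H (lift ord0 i); rewrite /= tnthS.
case: H => H0 H i.
case: (unliftP ord0 i) => [j|] ->; last by [].
by rewrite tnthS; exact: H.
Qed.
End tuple_law.

Section cells.
Context {R : realType}.
Local Notation U := (uniform_prob (@ltr01 R)).

(** Cuts [0, 1[ into #|F| equal cells. The minimum keeps the index in range for u >= 1, so a genuine
    element of [F] is always returned. The same map draws a uniform mark and rounds a time to a
    grid. *)
Definition ucell (F : finType) (f0 : F) (u : R) : F :=
  nth f0 (enum F) (minn (Num.truncn (#|F|%:R * u)) #|F|.-1).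

Lemma measurable_truncn_fiber (c : R) i : 0 < c ->
  measurable ([set u : R | Num.truncn (c * u) = i] : set (measurableTypeR R)).
Proof.
move=> c0.
have m r : measurable ([set u : R | c * u < r] : set (measurableTypeR R)).
  rewrite (_ : [set _ | _] = `]-oo, r / c[%classic); first exact: measurable_itv.
  by apply/seteqP; split => u /=; rewrite in_itv /= ltr_pdivlMr // mulrC.
have -> : [set u : R | Num.truncn (c * u) = i] =
    [set u | c * u < i.+1%:R] `\` (if i is j.+1 then [set u | c * u < j.+1%:R] else set0).
  case: i => [|j]; apply/seteqP; split => u /=.
  - by move=> u0; split=> //; have := truncnS_gt (c * u); rewrite u0.
  - by case=> c1 _; apply/eqP; rewrite -leqn0 truncn_le_nat.
  - by rewrite -!truncn_le_nat => ->; rewrite leqnn; split=> //; rewrite ltnn.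
  - by rewrite -!truncn_le_nat => -[h1 /negP h2]; apply/eqP; rewrite eqn_leq h1 ltnNge.
by apply: measurableD => //; case: i.
Qed.

Lemma measurable_ucell_fiber (F : finType) (f0 f : F) :
  measurable ([set u : R | ucell f0 u = f] : set (measurableTypeR R)).
Proof.
have F0 : (0 : R) < #|F|%:R by rewrite ltr0n; apply/card_gt0P; exists f0.
rewrite (_ : [set _ | _] = \bigcup_(i in [set i | nth f0 (enum F) (minn i #|F|.-1) = f])
    [set u : R | Num.truncn (#|F|%:R * u) = i]).
  by apply: bigcup_measurable => i _; exact: measurable_truncn_fiber.
by apply/seteqP; split => u /=; [exists (Num.truncn (#|F|%:R * u))|case=> i /= fi ui; rewrite /ucell ui].
Qed.

Lemma ucell_ord m (u : R) : (ucell (ord0 : 'I_m.+1) u : nat) = minn (Num.truncn (m.+1%:R * u)) m.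
Proof. by rewrite /ucell card_ord nth_enum_ord // ltnS geq_minr. Qed.

Lemma uniform_ucell (F : finType) (f0 f : F) : U [set u | ucell f0 u = f] = (#|F|%:R^-1)%:E.
Proof.
have cF : (0 < #|F|)%N by apply/card_gt0P; exists f0.
have F0 : (0 : R) < #|F|%:R by rewrite ltr0n.
have m01 : measurable (`[0, 1[%classic : set (measurableTypeR R)) by exact: measurable_itv.
have U01 : U `[0, 1[%classic = 1%E by rewrite uniform_prob_co // subr0.
rewrite -(probability_setI_full m01 (measurable_ucell_fiber f0 f) U01).
pose r := index f (enum F).
have rF : (r < #|F|)%N by rewrite cardE index_mem mem_enum.
have -> : `[0, 1[%classic `&` [set u | ucell f0 u = f] = `[r%:R / #|F|%:R, r.+1%:R / #|F|%:R[%classic.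
  apply/seteqP; split => u /=; rewrite !in_itv /= ler_pdivrMr // ltr_pdivlMr // ![u * _]mulrC.
    move=> [/andP[u0 u1] uf].
    have tF : (Num.truncn (#|F|%:R * u) < #|F|)%N.
      by rewrite truncn_lt_nat ?gtr_pMr // mulr_ge0 // ltW.
    have := truncn_itv (mulr_ge0 (ltW F0) u0).
    suff -> : Num.truncn (#|F|%:R * u) = r by [].
    move: uf; rewrite /ucell (minn_idPl _); last by rewrite -ltnS prednK.
    by move=> uf; rewrite /r -uf index_uniq ?enum_uniq // -cardE.
  move=> H; have /andP[H1 H2] := H.
  have u0 : 0 <= u by rewrite -(pmulr_rge0 _ F0) (le_trans _ H1).
  split.
    rewrite u0 -(ltr_pM2l F0) mulr1 (lt_le_trans H2) // ler_nat.
    by [].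
  by rewrite /ucell (truncn_def H) (minn_idPl _) ?nth_index ?mem_enum // -ltnS prednK.
apply: (eq_trans (uniform_prob_co _ _ _)).
- by rewrite divr_ge0.
- by rewrite ler_pM2r ?invr_gt0 // ler_nat.
- by rewrite ler_pdivrMr // mul1r ler_nat.
- by rewrite -mulrBl -natrB // subSnn mul1r.
Qed.

End cells.

Section marked_points.
Context {R : realType} {K : finType}.
Variable k0 : K.
Local Notation U := (uniform_prob (@ltr01 R)).
Local Notation Y := (measurableTypeR R * measurableTypeR R)%type.

(* A point y of Y stands for the mark ucell k0 y.1 and the time y.2. *)
Definition mark_law n : probability (n.-tuple Y) R :=
  sval (cid (exists_tuple_law (U \x U)%E n)).

Lemma mark_lawE n (B : nat -> set Y) : (forall i, measurable (B i)) ->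
  mark_law n [set t : n.-tuple Y | forall i : 'I_n, B i (tnth t i)] =
  (\prod_(i < n) (U \x U)%E (B i))%E.
Proof. by rewrite /mark_law; case: cid => P /= /(_ B). Qed.

(** The n marks and the n cells are independent and uniform, so all words of marked cells are
    equally likely. Read from right to left, this writes a finite sum over marked grid points
    exactly as an expectation. *)
Lemma mark_law_cells n m (G : seq (K * 'I_m.+1) -> R) :
  \int[mark_law n]_y G [seq (ucell k0 x.1, ucell ord0 x.2) | x <- (y : n.-tuple Y)] =
  (#|K|%:R * m.+1%:R) ^- n * sumw n G.
Proof.
pose c (x : Y) : K * 'I_m.+1 := (ucell k0 x.1, ucell ord0 x.2).
have mc z : measurable [set x : Y | c x = z].
  rewrite (_ : [set _ | _] = [set u | ucell k0 u = z.1] `*` [set u | ucell ord0 u = z.2]).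
    by apply: measurableX; exact: measurable_ucell_fiber.
  by case: z => k j; apply/seteqP; split => x /= => [[xk xj]|[/= xk xj]]; [split|rewrite /c xk xj].
have cE z : (U \x U)%E [set x : Y | c x = z] = ((#|K|%:R * m.+1%:R)^-1)%:E.
  rewrite (_ : [set _ | _] = [set u | ucell k0 u = z.1] `*` [set u | ucell ord0 u = z.2]).
    rewrite product_measure1E; try exact: measurable_ucell_fiber.
    by rewrite [X in (X * _)%E]uniform_ucell [X in (_ * X)%E]uniform_ucell card_ord -EFinM -invfM.
  by case: z => k j; apply/seteqP; split => x /= => [[xk xj]|[/= xk xj]]; [split|rewrite /c xk xj].
pose X (y : n.-tuple Y) : n.-tuple (K * 'I_m.+1) := [tuple of map c y].
have XE z : [set y | X y = z] =
    [set y : n.-tuple Y | forall i : 'I_n, [set x | c x = nth (k0, ord0) z i] (tnth y i)].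
  apply/seteqP; split => y /=.
    by move=> <- i; rewrite -tnth_nth tnth_map.
  by move=> H; apply: eq_from_tnth => i; rewrite tnth_map H -tnth_nth.
rewrite (Rintegral_finite_range _ (X := X) G); last first.
  move=> z; rewrite XE (_ : [set _ | _] = \bigcap_(i in [set: 'I_n])
     [set y : n.-tuple Y | [set x | c x = nth (k0, ord0) z i] (tnth y i)]).
    apply: fin_bigcap_measurable => [|i _]; first exact: finite_finset.
    by have := @measurable_tnth _ Y n i measurableT _ (mc (nth (k0, ord0) z i)); rewrite setTI.
  by apply/seteqP; split => t /= H i; [move=> _; exact: H|exact: (H i I)].
rewrite sumw_tuple mulr_sumr; apply: eq_bigr => z _.
rewrite XE (mark_lawE n (B := fun i => [set x | c x = nth (k0, ord0) z i])) //.
rewrite (eq_bigr (fun=> ((#|K|%:R * m.+1%:R)^-1)%:E)); last by move=> i _; exact: cE.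
by rewrite prodEFin /= prodr_const card_ord exprVn mulrC.
Qed.


(* The sum of e ^ (size s) * H s over the subsequences of ts with marks in K. *)
Fixpoint msum (e : R) (ts : seq R) (H : seq (K * R) -> R) : R :=
  if ts is t :: ts' then
    msum e ts' H + e * \sum_k msum e ts' (fun s => H ((k, t) :: s))
  else H [::].

(** The contribution to [msum] of the subsequences with n elements, without its power of e. The type
    of times is arbitrary so that cell indices may stand for times ([mterm_map]). *)
Fixpoint mterm (A : Type) (ts : seq A) (n : nat) (H : seq (K * A) -> R) : R :=
  if n is n'.+1 then
    if ts is t :: ts' then mterm ts' n H + \sum_k mterm ts' n' (fun s => H ((k, t) :: s))
    else 0
  else H [::].

Lemma mterm_gt_size (A : Type) (ts : seq A) n (H : seq (K * A) -> R) :
  (size ts < n)%N -> mterm ts n H = 0.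
Proof.
elim: ts n H => [|t ts IHts] [|n] H //= nts.
rewrite IHts ?add0r; last exact: ltnW.
by rewrite big1 // => k _; exact: IHts.
Qed.

Lemma msum_mterm e ts H :
  msum e ts H = series (fun n => e ^+ n * mterm ts n H) (size ts).+1.
Proof.
elim: ts H => [|t ts IHts] H.
  by rewrite seriesEord /= big_ord_recl big_ord0 addr0 expr0 mul1r.
rewrite /= !seriesEord /= big_ord_recl /= expr0 mul1r.
under [X in _ = _ + X]eq_bigr do rewrite mulrDr.
rewrite big_split /= addrA; congr (_ + _).
  rewrite IHts seriesEord /= big_ord_recl expr0 mul1r /=.
  have -> : mterm ts 0 H = H [::] by case: (ts).
  congr (_ + _); rewrite big_ord_recr /=.
  by rewrite (mterm_gt_size (n := (size ts).+1)) // mulr0 addr0.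
rewrite mulr_sumr; under [RHS]eq_bigr do rewrite mulr_sumr.
rewrite exchange_big /=; apply: eq_bigr => k _.
rewrite IHts seriesEord mulr_sumr; apply: eq_bigr => n _.
by rewrite exprS mulrA.
Qed.

Lemma mterm_map (A B : Type) (f : A -> B) (ts : seq A) n (H : seq (K * B) -> R) :
  mterm (map f ts) n H = mterm ts n (fun z => H [seq (x.1, f x.2) | x <- z]).
Proof.
elim: ts n H => [|t ts IHts] [|n] H //=.
by rewrite IHts; congr (_ + _); apply: eq_bigr => k _; rewrite IHts.
Qed.

(** In a duplicate-free sequence a subsequence occurs at only one set of positions, so summing over
    positions is summing over the words that are subsequences. *)
Lemma mterm_sumw (A : finType) (s : seq A) n (H : seq (K * A) -> R) : uniq s ->
  mterm s n H = sumw n (fun z => if subseq (map snd z) s then H z else 0).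
Proof.
elim: s n H => [|a s IHs] [|n] H //=; first by rewrite big1 // => x _; rewrite sumw_tuple big1.
case/andP=> aS uS; rewrite IHs //=.
transitivity (\sum_(x : K * A) (sumw n (fun w => if subseq (x.2 :: map snd w) s then H (x :: w) else 0) +
   (if x.2 == a then sumw n (fun w => if subseq (map snd w) s then H (x :: w) else 0) else 0))).
  rewrite big_split /=; congr (_ + _).
  pose g k b := if b == a then
     sumw n (fun w => if subseq (map snd w) s then H ((k, b) :: w) else 0) else 0.
  rewrite [RHS](eq_bigr (fun p => g p.1 p.2)); last by case.
  rewrite -(pair_bigA _ g) /=.
  by apply: eq_bigr => k _; rewrite IHs // /g -big_mkcond big_pred1_eq.
apply: eq_bigr => -[k b] _ /=; case: eqP => [->|_]; last by rewrite addr0.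
rewrite -[RHS]add0r; congr (_ + _).
rewrite sumw_tuple big1 // => w _; case: ifP => // /mem_subseq/(_ a).
by rewrite inE eqxx (negPf aS) => /(_ isT).
Qed.

Lemma mterm_le (A : Type) (ts : seq A) n (H : seq (K * A) -> R) (C : R) :
  (forall z, `|H z| <= C) -> `|mterm ts n H| <= C * (#|K| ^ n * 'C(size ts, n))%:R.
Proof.
move=> HC; have C0 : 0 <= C by exact: le_trans (HC [::]).
elim: ts n H HC => [|t ts IHts] [|n] H HC /=; rewrite ?expn0 ?bin0 ?mulr1 //.
  by rewrite normr0 mulr_ge0.
rewrite (le_trans (ler_normD _ _)) // binS mulnDr natrD mulrDr lerD //; first exact: IHts.
rewrite (le_trans (ler_norm_sum _ _ _)) //.
apply: (@le_trans _ _ (\sum_(k : K) C * (#|K| ^ n * 'C(size ts, n))%:R)).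
  by apply: ler_sum => k _; exact: IHts.
by rewrite sumr_const -mulrnAr -mulrnA mulnAC -expnSr.
Qed.

Lemma bin_le_exp M n : ('C(M, n) * n`! <= M ^ n)%N.
Proof.
rewrite bin_ffact; elim: n M => // n IHn [|M]; first by rewrite ffact0n.
rewrite ffactnS expnS leq_mul2l /= (leq_trans (IHn M)) //.
by case: n {IHn} => // n; rewrite leq_exp2r.
Qed.

Lemma subseq_enum_ord m (s : seq 'I_m) :
  subseq s (enum 'I_m) = sorted (fun i j : 'I_m => (i < j)%N) s.
Proof.
have tr : transitive (fun i j : 'I_m => (i < j)%N) by move=> i j k; exact: ltn_trans.
have so : sorted (fun i j : 'I_m => (i < j)%N) (enum 'I_m).
  by have := iota_ltn_sorted 0 m; rewrite -val_enum_ord sorted_map.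
apply/idP/idP => [/subseq_sorted|ss]; first exact.
have -> : s = [seq i <- enum 'I_m | i \in s]; last exact: filter_subseq.
apply: (irr_sorted_eq tr) => //; first by move=> i; rewrite ltnn.
  exact: sorted_filter.
by move=> i; rewrite mem_filter mem_enum andbT.
Qed.

Let cell m (x : Y) : K * 'I_m.+1 := (ucell k0 x.1, ucell ord0 x.2).

Lemma measurable_cell_fun n m (G : seq (K * 'I_m.+1) -> R) :
  measurable_fun setT (fun y : n.-tuple Y => G [seq cell m x | x <- y]).
Proof.
have mc z : measurable [set x : Y | cell m x = z].
  rewrite (_ : [set _ | _] = [set u | ucell k0 u = z.1] `*` [set u | ucell ord0 u = z.2]).
    by apply: measurableX; exact: measurable_ucell_fiber.
  by case: z => k j; apply/seteqP; split => x /= => [[xk xj]|[/= xk xj]]; [split|rewrite /cell xk xj].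
move=> _ B _; rewrite setTI.
rewrite (_ : _ @^-1` _ = \bigcup_(z in [set z : n.-tuple (K * 'I_m.+1) | B (G z)])
    [set y : n.-tuple Y | map (cell m) y = z]); last first.
  apply/seteqP; split => y /=; first by exists [tuple of map (cell m) y].
  by case=> z /= Bz yz; rewrite yz.
apply: fin_bigcup_measurable; first exact: finite_finset.
move=> z _.
rewrite (_ : [set _ | _] = \bigcap_(i in [set: 'I_n])
   [set y : n.-tuple Y | [set x | cell m x = tnth z i] (tnth y i)]).
  apply: fin_bigcap_measurable => [|i _]; first exact: finite_finset.
  by have := @measurable_tnth _ Y n i measurableT _ (mc (tnth z i)); rewrite setTI.
apply/seteqP; split => y /=.
  move=> yz i _ /=; rewrite -[X in _ = X](_ : tnth [tuple of map (cell m) y] i = _).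
    by rewrite tnth_map.
  by congr (tnth _ i); apply/val_inj.
move=> yz; suff <- : [tuple of map (cell m) y] = z by [].
by apply: eq_from_tnth => i; rewrite tnth_map; exact: (yz i I).
Qed.

Definition marks_at (c tau : R) (y : seq Y) : seq (K * R) :=
  [seq (ucell k0 x.1, c + tau * x.2) | x <- y].

Definition ordered (y : seq Y) : bool := sorted <%R (map snd y).

Lemma measurable_ordered n : measurable [set y : n.-tuple Y | ordered y].
Proof.
have mnth i : measurable_fun setT (fun y : n.-tuple Y => nth 0 (map snd y) i : measurableTypeR R).
  case: (ltnP i n) => [il|il].
    rewrite (_ : (fun y : n.-tuple Y => _) = snd \o (fun y : n.-tuple Y => tnth y (Ordinal il))).
      apply: measurableT_comp; first exact: measurable_snd.
      exact: measurable_tnth.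
    by apply/funext => y /=; rewrite (tnth_nth (0, 0)) (nth_map (0, 0)) // size_tuple.
  rewrite (_ : (fun y : n.-tuple Y => _) = cst 0) //.
  by apply/funext => y /=; rewrite nth_default // size_map size_tuple.
rewrite (_ : [set _ | _] = \bigcap_(i in [set i | (i.+1 < n)%N])
  [set y : n.-tuple Y | nth 0 (map snd y) i < nth 0 (map snd y) i.+1]).
  apply: fin_bigcap_measurable => [|i _].
    by apply: (@sub_finite_set _ _ `I_n); [move=> i /= /ltnW|exact: finite_II].
  have := measurable_fun_ltr (mnth i) (mnth i.+1).
  move=> /(_ measurableT [set true] _); rewrite setTI; apply.
  by [].
apply/seteqP; split => y /=; rewrite /ordered.
  by move/(sortedP 0) => H i /= iN; apply: H; rewrite size_map size_tuple.
by move=> H; apply/(sortedP 0) => i; rewrite size_map size_tuple => iN; exact: (H i iN).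
Qed.

(** The integral of [H] over n increasing marked times in [c, c + tau]: the test [ordered] keeps one
    of the n! orders of the points, and the prefactor undoes the normalisation of the uniform laws
    of marks and times. *)
Definition lterm (c tau : R) (H : seq (K * R) -> R) (n : nat) : R :=
  (#|K|%:R * tau) ^+ n *
  \int[mark_law n]_y (if ordered (y : n.-tuple Y) then H (marks_at c tau y) else 0).

Definition mlim (c tau : R) (H : seq (K * R) -> R) : R := limn (series (lterm c tau H)).

(** Sequential continuity in the times, the marks being fixed, at points none of whose times lies in
    [D]. Moving the times by maps [phi_ i] keeps the length and the marks of [e] by construction. In
    the applications [D] is empty or consists of the two ends of the window. *)
Definition cont_off (D : seq R) (H : seq (K * R) -> R) : Prop :=
  forall (e : seq (K * R)) (phi_ : nat -> R -> R) (phi : R -> R),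
  (forall x, x \in e -> phi_ i x.2 @[i --> \oo] --> phi x.2) ->
  (forall x, x \in e -> phi x.2 \notin D) ->
  H [seq (x.1, phi_ i x.2) | x <- e] @[i --> \oo] --> H [seq (x.1, phi x.2) | x <- e].

Definition mark_measurable (H : seq (K * R) -> R) : Prop :=
  forall n c tau, measurable_fun setT (fun y : n.-tuple Y => H (marks_at c tau y)).

Lemma uniform_prob_finite (D : seq R) : U [set` D] = 0%E.
Proof.
rewrite (_ : [set` D] = \bigcup_(i : 'I_(size D)) [set tnth (in_tuple D) i]).
  apply: measure_countable_bigcup0 => i; first exact: measurable_set1.
  have /null_content_dominatesP := dominates_uniform_prob (@ltr01 R).
  by apply => //; exact: lebesgue_measure_set1.
apply/seteqP; split => x /=.
  by move=> /(tnthP (in_tuple D))[i ->]; exists i.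
by case=> i _ ->; exact: mem_tnth.
Qed.

Lemma mark_law_generic n c tau (D : seq R) : tau != 0 ->
  exists N : set (n.-tuple Y), [/\ measurable N, mark_law n N = 0%E &
    forall y, ~ N y -> forall x, x \in (y : seq Y) -> (0 <= x.2 < 1) && (c + tau * x.2 \notin D)].
Proof.
move=> tau0; pose E := [seq (d - c) / tau | d <- D].
pose A : set Y := setT `*` (`[0, 1[%classic `\` [set` E]).
have mE : measurable ([set` E] : set (measurableTypeR R)).
  by apply: countable_measurable => [x|]; [exact: measurable_set1|exact/finite_set_countable/finite_seq].
have mI : measurable (`[0, 1[%classic : set (measurableTypeR R)) by exact: measurable_itv.
have mA : measurable A by apply: measurableX => //; exact: measurableD.
have U01 : U `[0, 1[%classic = 1%E by rewrite uniform_prob_co // subr0.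
have UA : (U \x U)%E A = 1%E.
  rewrite product_measure1E //; last exact: measurableD.
  rewrite [X in (X * _)%E](_ : _ = 1%E); last exact: (probability_setT U).
  rewrite mul1e setDE -[RHS]U01.
  rewrite setIC [LHS](probability_setI_full (P := U)) //; first exact: measurableC.
  have := probability_setC U mE; rewrite [X in _ = (_ - X)%E](uniform_prob_finite E) sube0.
  by [].
have mG : measurable [set y : n.-tuple Y | forall i : 'I_n, A (tnth y i)].
  rewrite (_ : [set _ | _] = \bigcap_(i in [set: 'I_n]) [set y : n.-tuple Y | A (tnth y i)]).
    apply: fin_bigcap_measurable => [|i _]; first exact: finite_finset.
    by have := @measurable_tnth _ Y n i measurableT _ mA; rewrite setTI.
  by apply/seteqP; split => t /= H i; [move=> _; exact: H|exact: (H i I)].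
exists (~` [set y : n.-tuple Y | forall i : 'I_n, A (tnth y i)]); split.
- exact: measurableC.
- rewrite probability_setC // (mark_lawE n (B := fun=> A)) //.
  rewrite (eq_bigr (fun=> 1%E)); last by move=> i _; exact: UA.
  by rewrite big1 // subee.
move=> y /contrapT /= H x /(tnthP y)[i ->].
have [_ [/=]] := H i; rewrite in_itv /= => -> nE /=.
apply/negP => cD; apply: nE; apply/mapP; exists (c + tau * (tnth y i).2) => //.
by field.
Qed.

Section riemann_sums.
Variables (H : seq (K * R) -> R) (C : R) (D : seq R) (eps : nat -> R) (M : nat -> nat).
Variables (c_ : nat -> R) (c tau : R).
Hypothesis tau_gt0 : 0 < tau.
Hypothesis H_le : forall z, `|H z| <= C.
Hypothesis H_cont : cont_off D H.
Hypothesis H_meas : mark_measurable H.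
Hypothesis eps_gt0 : forall i, 0 < eps i.
Hypothesis eps_cvg : eps i @[i --> \oo] --> 0.
Hypothesis M_cvg : eps i * (M i)%:R @[i --> \oo] --> tau.
Hypothesis c_cvg : c_ i @[i --> \oo] --> c.

Let C_ge0 : 0 <= C. Proof. exact: le_trans (H_le [::]). Qed.

(* The rounding of a time to the left end of its cell. *)
Let rnd i (u : R) : R :=
  if M i is m.+1 then c_ i + eps i * (ucell (ord0 : 'I_m.+1) u : nat)%:R else 0.

Let M_gt (A : R) : \forall i \near \oo, A < (M i)%:R.
Proof.
have tau2 : 0 < tau / 2 by rewrite divr_gt0.
have A1 : 0 < `|A| + 1 by rewrite ltr_wpDl.
near=> i.
have H1 : tau / 2 < eps i * (M i)%:R.
  by near: i; apply: (cvgr_gt _ M_cvg); lra.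
have H2 : eps i < tau / 2 / (`|A| + 1).
  by near: i; apply: (cvgr_lt _ eps_cvg); rewrite divr_gt0.
rewrite (le_lt_trans (ler_norm A)) // (@lt_trans _ _ (`|A| + 1)) ?ltrDl //.
rewrite -(ltr_pM2l (eps_gt0 i)) (lt_trans _ H1) //.
by rewrite -ltr_pdivlMr.
Unshelve. all: by end_near.
Qed.

Let M_gt0 : \forall i \near \oo, (0 < M i)%N.
Proof. by near=> i; rewrite -(ltr_nat R); near: i; exact: M_gt. Unshelve. all: by end_near. Qed.

Let rnd_cvg u : 0 <= u < 1 -> rnd i u @[i --> \oo] --> c + tau * u.
Proof.
move=> /andP[u0 u1].
have l1 : (fun i => c_ i + eps i * (M i)%:R * u) @ \oo --> c + tau * u.
  by apply: cvgD => //; apply: cvgMl.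
have l2 : (fun i => c_ i + eps i * (M i)%:R * u - eps i) @ \oo --> c + tau * u.
  by rewrite -[X in _ --> X]subr0; apply: cvgB.
apply: (squeeze_cvgr _ l2 l1); near=> i.
have Mi : (0 < M i)%N by near: i; exact: M_gt0.
rewrite /rnd; case EM : (M i) Mi => [//|m] _.
have e0 := eps_gt0 i.
have u0' : 0 <= m.+1%:R * u by rewrite mulr_ge0.
rewrite ucell_ord (minn_idPl _); last first.
  by rewrite -ltnS truncn_lt_nat // gtr_pMr // ltr0n.
have /andP[h1 h2] := truncn_itv u0'.
rewrite -addrA !lerD2l -mulrA; apply/andP; split; last by rewrite ler_pM2l.
by rewrite lerBlDr -[X in _ <= _ + X]mulr1 -mulrDr ler_pM2l // natr1 ltW.
Unshelve. all: by end_near.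
Qed.

Let rnd_lt u u' : 0 <= u < 1 -> 0 <= u' < 1 -> u < u' -> \forall i \near \oo, rnd i u < rnd i u'.
Proof.
move=> u01 u01' uu'; have h1 := rnd_cvg u01; have h2 := rnd_cvg u01'.
have l : c + tau * u < c + tau * u' by rewrite ltrD2l ltr_pM2l.
have [q /andP[q1 q2]] : exists q, c + tau * u < q < c + tau * u'.
  by exists ((c + tau * u + (c + tau * u')) / 2); rewrite !midf_lt.
near=> i; apply: (@lt_trans _ _ q); near: i.
  exact: (cvgr_lt _ h1).
exact: (cvgr_gt _ h2).
Unshelve. all: by end_near.
Qed.

(** The integrands before and in the limit: [f_] sees the marks and times only through cells and
    requires strictly increasing cells, [f] sees the exact times. *)
Let f_ n i (y : n.-tuple Y) : R :=
  if M i is m.+1 then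
    let z := [seq cell m x | x <- y] in
    if subseq (map snd z) (enum 'I_m.+1)
    then H [seq (x.1, c_ i + eps i * (nat_of_ord x.2)%:R) | x <- z] else 0
  else 0.

Let f n (y : n.-tuple Y) : R := if ordered y then H (marks_at c tau y) else 0.

Let f_rnd n i y : (0 < M i)%N -> @f_ n i y =
  if sorted <%R (map (rnd i) (map snd y)) then H [seq (ucell k0 x.1, rnd i x.2) | x <- y] else 0.
Proof.
rewrite /f_ /rnd; case: (M i) => // m _.
rewrite subseq_enum_ord -!map_comp [in RHS]sorted_map sorted_map.
congr (if _ then _ else _); apply: eq_sorted => x x' /=.
by rewrite ltrD2l ltr_pM2l // ltr_nat.
Qed.

Let f_meas n i : measurable_fun setT (@f_ n i).
Proof.
rewrite /f_; case: (M i) => [|m]; first exact: measurable_cst.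
exact: (@measurable_cell_fun n m (fun z => if subseq (map snd z) (enum 'I_m.+1)
    then H [seq (x.1, c_ i + eps i * (nat_of_ord x.2)%:R) | x <- z] else 0)).
Qed.

Let f_le n i y : `|@f_ n i y| <= C.
Proof. by rewrite /f_; case: (M i) => [|m] /=; [|case: ifP => _]; rewrite ?normr0. Qed.

Let fmeas n : measurable_fun setT (@f n).
Proof.
apply: measurable_fun_ifT.
- apply: (measurable_fun_bool true); rewrite setTI.
  rewrite (_ : _ @^-1` _ = [set y : n.-tuple Y | ordered y]) //; exact: measurable_ordered.
- exact: H_meas.
- exact: measurable_cst.
Qed.

(** Rounding never reverses the order of two times, and for large i it separates distinct ones;
    hence the order test on the rounded times eventually agrees with the one on the exact times, and
    the values converge by [cont_off]. *)
Let f_cvg n (y : n.-tuple Y) :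
  (forall x, x \in (y : seq Y) -> (0 <= x.2 < 1) && (c + tau * x.2 \notin D)) ->
  @f_ n i y @[i --> \oo] --> @f n y.
Proof.
move=> yG.
have Hc : H [seq (ucell k0 x.1, rnd i x.2) | x <- y] @[i --> \oo] --> H (marks_at c tau y).
  pose e : seq (K * R) := [seq (ucell k0 x.1, x.2) | x <- y].
  have E phi : H [seq (x.1, phi x.2) | x <- e] = H [seq (ucell k0 x.1, phi x.2) | x <- y].
    by rewrite /e -map_comp.
  have Ef : (fun i => H [seq (x.1, rnd i x.2) | x <- e]) =
      (fun i => H [seq (ucell k0 x.1, rnd i x.2) | x <- y]).
    by apply/funext => i; exact: E.
  have := H_cont (e := e) (phi_ := rnd) (phi := fun u => c + tau * u).
  rewrite Ef (E (fun u => c + tau * u)); apply.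
    by move=> _ /mapP[x /yG /andP[x1 _] ->] /=; exact: rnd_cvg.
  by move=> _ /mapP[x /yG /andP[_ x2] ->].
have mono i u u' : rnd i u < rnd i u' -> u < u'.
  rewrite /rnd; case: (M i) => [|m]; first by rewrite ltxx.
  rewrite ltrD2l ltr_pM2l // ltr_nat !ucell_ord; apply: contraTT; rewrite -!leNgt -leqNgt => uu'.
  rewrite leq_min geq_minr andbT geq_min le_truncn //.
  by rewrite ler_pM2l // ltr0n.
have ordE : \forall i \near \oo, sorted <%R (map (rnd i) (map snd y)) = ordered y.
  rewrite /ordered; case: (boolP (sorted <%R (map snd y))) => [so|nso]; last first.
    apply: nearW => i; apply/negbTE; apply: contra nso; rewrite sorted_map.
    by apply: sub_sorted => u u'; exact: mono.
  have u01 x : x \in map snd y -> 0 <= x < 1 by move=> /mapP[z /yG /andP[+ _] ->].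
  move: so u01; elim: (map snd y) => [|u s IHs] /=; first by move=> *; exact: nearW.
  case: s IHs => [|u' s] IHs; first by move=> *; exact: nearW.
  move=> /= /andP[uu' so] u01.
  have H1 : \forall i \near \oo, rnd i u < rnd i u'.
    by apply: rnd_lt => //; apply: u01; rewrite !inE eqxx ?orbT.
  have H2 := IHs so (fun x xs => u01 x (mem_behead (s := u :: u' :: s) xs)).
  by apply: filterS2 H1 H2 => i /= -> ->.
rewrite /f; case: ifP => yo.
  apply: cvg_trans Hc; apply: near_eq_cvg; near=> i.
  have Mi : (0 < M i)%N by near: i; exact: M_gt0.
  have oi : sorted <%R (map (rnd i) (map snd y)) = ordered y by near: i; exact: ordE.
  by rewrite f_rnd // oi yo.
have l0 : (fun=> 0 : R) @ \oo --> (0 : R) by exact: cvg_cst.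
apply: cvg_trans l0; apply: near_eq_cvg; near=> i.
have Mi : (0 < M i)%N by near: i; exact: M_gt0.
have oi : sorted <%R (map (rnd i) (map snd y)) = ordered y by near: i; exact: ordE.
by rewrite f_rnd // oi yo.
Unshelve. all: by end_near.
Qed.

Let grid i := [seq c_ i + eps i * (j : nat)%:R | j <- iota 0 (M i)].

Let mterm_grid n i : (0 < M i)%N -> eps i ^+ n * mterm (grid i) n H =
  (#|K|%:R * (eps i * (M i)%:R)) ^+ n * \int[mark_law n]_y @f_ n i y.
Proof.
rewrite /f_ /grid; case EM : (M i) => [//|m] _.
have -> : [seq c_ i + eps i * (j : nat)%:R | j <- iota 0 m.+1] =
    [seq c_ i + eps i * (nat_of_ord j)%:R | j <- enum 'I_m.+1].
  by rewrite -val_enum_ord -map_comp.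
rewrite mterm_map mterm_sumw ?enum_uniq //.
rewrite [X in _ = _ * X](mark_law_cells n (fun z => if subseq (map snd z) (enum 'I_m.+1)
    then H [seq (x.1, c_ i + eps i * (nat_of_ord x.2)%:R) | x <- z] else 0)).
have K0 : #|K|%:R != 0 :> R by rewrite pnatr_eq0 -lt0n; apply/card_gt0P; exists k0.
have M0 : m.+1%:R != 0 :> R by rewrite pnatr_eq0.
rewrite [RHS]mulrA; congr (_ * _).
rewrite mulrCA [X in _ = X / _]exprMn mulfK //.
by rewrite expf_neq0 // mulf_neq0.
Qed.

(** [tannery] over the number n of jumps. For fixed n the Riemann sum is an expectation and
    converges by bounded convergence; since a binomial 'C(M, n) is at most M ^ n / n!, the n-th term
    is dominated by C (#|K| B) ^ n / n!, where B bounds all the products eps M. *)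
Lemma msum_cvg : cvgn (series (lterm c tau H)) /\
  msum (eps i) (grid i) H @[i --> \oo] --> mlim c tau H.
Proof.
have [B epsB] : exists B, forall i, eps i * (M i)%:R <= B.
  have /cvg_seq_bounded[B [_ HB]] : cvgn (fun i => eps i * (M i)%:R) by apply/cvg_ex; exists tau.
  exists (B + 1) => i; apply: le_trans (ler_norm _) _.
  by apply: HB => //; rewrite ltrDl.
have epsM0 i : 0 <= eps i * (M i)%:R by rewrite mulr_ge0 // ltW.
pose t i n := eps i ^+ n * mterm (grid i) n H.
have ts n : t i n @[i --> \oo] --> lterm c tau H n.
  have [N [mN N0 yN]] := @mark_law_generic n c tau D (lt0r_neq0 tau_gt0).
  have fl := bounded_cvg_Rintegral (P := mark_law n) (f_ := @f_ n) (f := @f n)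
    (C := C) (N := N) (f_meas (n := n)) (@fmeas n) (@f_le n) mN N0
    (fun y ny => f_cvg (yN y ny)).
  have pl : (#|K|%:R * (eps i * (M i)%:R)) ^+ n @[i --> \oo] --> (#|K|%:R * tau) ^+ n.
    have h : (fun i => #|K|%:R * (eps i * (M i)%:R)) @ \oo --> #|K|%:R * tau by apply: cvgMr.
    exact: (cvg_comp _ _ h (@exprn_continuous R n (#|K|%:R * tau))).
  apply: cvg_trans (cvgM pl fl); apply: near_eq_cvg; near=> i.
  rewrite /t mterm_grid //; near: i; exact: M_gt0.
have en0 i n : 0 <= eps i ^+ n by exact/exprn_ge0/ltW.
have tb i n : `|t i n| <= C * exp_coeff (#|K|%:R * B) n.
  rewrite /t normrM (ger0_norm (en0 i n)).
  apply: (@le_trans _ _ (eps i ^+ n * (C * (#|K| ^ n * 'C(M i, n))%:R))).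
    rewrite (ler_wpM2l (en0 i n)) //.
    by have := mterm_le (grid i) n H_le; rewrite size_map size_iota.
  rewrite mulrCA ler_wpM2l // /exp_coeff ler_pdivlMr ?ltr0n ?fact_gt0 //.
  rewrite natrM -mulrA -mulrA -natrM natrX.
  apply: (@le_trans _ _ (eps i ^+ n * (#|K|%:R ^+ n * (M i)%:R ^+ n))).
    apply: (ler_wpM2l (en0 i n)); apply: ler_wpM2l; first exact: exprn_ge0.
    rewrite -natrX ler_nat.
    exact: bin_le_exp.
  rewrite mulrCA -!exprMn; apply: lerXn2r; rewrite ?nnegrE.
  - by apply: mulr_ge0.
  - by apply: mulr_ge0 => //; exact: le_trans (epsM0 i) (epsB i).
  - by apply: ler_wpM2l.
have cb : cvgn (series (fun n => C * exp_coeff (#|K|%:R * B) n)).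
  by apply: (@is_cvg_seriesZ _ (exp_coeff (#|K|%:R * B)) C); exact: is_cvg_series_exp_coeff.
have tN i n : ((M i).+1 <= n)%N -> t i n = 0.
  by move=> Mn; rewrite /t mterm_gt_size ?mulr0 // size_map size_iota.
have [h1 h2] := tannery ts tb cb tN; split=> //.
by under eq_fun do rewrite msum_mterm size_map size_iota.
Unshelve. all: by end_near.
Qed.

End riemann_sums.

End marked_points.

(** * Trajectories and windows *)

Section mixture.
Context {R : realType} {d} {W : measurableType d}.

Lemma exists_restricted_law d' (T : measurableType d') (P : probability T R) (f : T -> W)
    (A : set T) : measurable_fun setT f -> measurable A ->
  exists m : {measure set W -> \bar R},
    (forall B, m B = P (f @^-1` B `&` A)) /\
    forall F : W -> \bar R, measurable_fun setT F -> (forall w, 0 <= F w)%E ->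
      (\int[m]_w F w = \int[P]_(y in A) F (f y))%E.
Proof.
move=> mf mA; pose X : {mfun T >-> W} := HB.pack f (isMeasurableFun.Build _ _ _ _ f mf).
exists (pushforward (mrestr P mA) X); split=> // F mF F0.
have mFf : measurable_fun setT (F \o f) by exact: measurableT_comp.
rewrite ge0_integral_pushforward //= preimage_setT.
have -> : (\int[mrestr P mA]_x (F \o f) x = \int[mrestr P mA]_(x in A) (F \o f) x)%E.
  rewrite (ge0_negligible_integral (measurableC mA) measurableT mFf) ?setTD ?setCK //.
    by move=> x _; exact: F0.
  exact: (eq_trans (congr1 P (setICl A)) (measure0 P)).
by apply: eq_measure_integral => B mB BA; exact: (congr1 P (setIidl BA)).
Unshelve. exact: mf.
Qed.

(** Serves to realise the process on a finite time interval as a genuine law: the number n of jumps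
    is drawn with the weights c, then the marked times given n. Countable sums of measures integrate
    nonnegative functions termwise, so a bounded [F] is first shifted by its bound [C]. *)
Lemma exists_mixture d' (T : nat -> measurableType d') (P : forall n, probability (T n) R)
    (f : forall n, T n -> W) (A : forall n, set (T n)) (c : nat -> R) :
  (forall n, measurable_fun setT (f n)) -> (forall n, measurable (A n)) ->
  (forall n, 0 <= c n) -> series (fun n => c n * fine (P n (A n))) @ \oo --> (1 : R) ->
  exists Q : probability W R, forall (F : W -> R) (C : R), measurable_fun setT F ->
    (forall w, `|F w| <= C) ->
    series (fun n => c n * \int[P n]_(y in A n) F (f n y)) @ \oo --> \int[Q]_w F w.
Proof.
move=> mf mA c0 c1.
pose m n := sval (cid (exists_restricted_law (P n) (mf n) (mA n))).
have mE n B : m n B = P n (f n @^-1` B `&` A n) by rewrite /m; case: cid => ? [].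
have mI n : forall F : W -> \bar R, measurable_fun setT F -> (forall w, 0 <= F w)%E ->
    (\int[m n]_w F w = \int[P n]_(y in A n) F (f n y))%E.
  by rewrite /m; case: cid => ? [].
pose ms n : {measure set W -> \bar R} := mscale (NngNum (c0 n)) (m n).
pose Q := mseries ms 0.
have PA n : P n (A n) \is a fin_num by exact/fin_num_measure/mA.
have Q1 : Q setT = 1%E.
  rewrite /Q /mseries.
  rewrite (_ : (fun n => _) = EFin \o series (fun n => c n * fine (P n (A n)))).
    by rewrite EFin_lim; [rewrite (cvg_lim _ c1)|apply/cvg_ex; exists 1].
  apply/funext => n /=; rewrite /series /= -sumEFin; apply: eq_bigr => k _.
  by rewrite /ms /= /mscale /= mE preimage_setT setTI EFinM fineK.
pose Qp : probability W R := HB.pack Q (Measure_isProbability.Build _ _ _ Q Q1).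
have ge0_case (F : W -> R) C : measurable_fun setT F -> (forall w, 0 <= F w) ->
    (forall w, `|F w| <= C) ->
    series (fun n => c n * \int[P n]_(y in A n) F (f n y)) @ \oo --> \int[Qp]_w F w.
  move=> mF F0 FC.
  have iF : Qp.-integrable setT (EFin \o F) by exact: integrable_bounded mF FC.
  have fin : (\int[Qp]_w (F w)%:E)%E \is a fin_num by exact: integrable_fin_num.
  have E : (\int[Qp]_w (F w)%:E = \sum_(n <oo) (c n * \int[P n]_(y in A n) F (f n y))%:E)%E.
    rewrite [LHS]ge0_integral_measure_series //; last 2 first.
    - by move=> w _; rewrite lee_fin.
    - exact/measurable_EFinP.
    apply: eq_eseriesr => n _.
    rewrite ge0_integral_mscale //; last 2 first.
    - exact/measurable_EFinP.
    - by move=> w _; rewrite lee_fin.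
    rewrite mI; [|exact/measurable_EFinP|by move=> w; rewrite lee_fin].
    rewrite [RHS]EFinM /Rintegral fineK //.
    apply: integrable_fin_num => //.
    apply: (@integrableS _ _ _ _ setT) => //.
    by apply: (@integrable_bounded _ _ _ _ _ C) => //; exact: measurableT_comp.
  have cs : (fun n => (series (fun n => c n * \int[P n]_(y in A n) F (f n y)) n)%:E) @ \oo -->
     (fine (\int[Qp]_w (F w)%:E))%:E.
    rewrite fineK // E.
    rewrite (_ : (fun n => _) =
        fun n => (\sum_(0 <= k < n) (c k * \int[P k]_(y in A k) F (f k y))%:E)%E).
      apply: is_cvg_nneseries => k _ _; rewrite lee_fin mulr_ge0 //.
      by apply: Rintegral_ge0 => y _; exact: F0.
    by apply/funext => n /=; rewrite /series /= -sumEFin.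
  by move/fine_cvg : cs; exact.
exists Qp => F C mF FC.
have C0 : 0 <= C by exact: le_trans (FC point).
have mFC : measurable_fun setT (fun w => F w + C) by exact: measurable_funD.
have FC0 w : 0 <= F w + C by have := FC w; rewrite ler_norml; lra.
have FCC w : `|F w + C| <= C + C by rewrite (le_trans (ler_normD _ _)) // lerD // ger0_norm.
have H1 := ge0_case _ _ mFC FC0 FCC.
have H2 := ge0_case (cst C) C (@measurable_cst _ _ _ _ _ _) (fun=> C0) (fun=> ltac:(by rewrite /cst ger0_norm)).
have iF (d0 : measure_display) (V : measurableType d0) (p : probability V R) (g : V -> W) B :
    measurable_fun setT g -> measurable B -> p.-integrable B (EFin \o (F \o g)).
  move=> mg mB; apply: (@integrableS _ _ _ _ setT) => //.
  exact: (integrable_bounded p (measurableT_comp mF mg) (fun x => FC (g x))).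
have iC (d0 : measure_display) (V : measurableType d0) (p : probability V R) B :
    measurable B -> p.-integrable B (EFin \o (cst C)).
  by move=> mB; exact: finite_measure_integrable_cst.
have E1 : \int[Qp]_w F w = \int[Qp]_w (F w + C) - \int[Qp]_w cst C w.
  rewrite RintegralD //; first by rewrite addrK.
    by have := iF _ _ Qp id setT (@measurable_id _ _ _) measurableT.
  exact: iC.
rewrite E1; have := cvgB H1 H2.
suff <- : series (fun n => c n * \int[P n]_(y in A n) F (f n y)) =
  series (fun n => c n * \int[P n]_(y in A n) (F (f n y) + C)) -
  series (fun n => c n * \int[P n]_(y in A n) cst C (f n y)) by exact.
apply/funext => n; rewrite fctE /series /= -sumrB; apply: eq_bigr => k _.
rewrite -mulrBr RintegralD; [by rewrite addrK|exact: mA|exact: (iF _ _ (P k) (f k) (A k) (mf k) (mA k))|exact/iC/mA].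
Qed.

End mixture.

Lemma measurable_bigcup_countType d (T : measurableType d) (I : countType) (P : set I)
    (F : I -> set T) : (forall i, P i -> measurable (F i)) -> measurable (\bigcup_(i in P) F i).
Proof.
move=> mF; rewrite bigcup_mkcond; apply: countable_bigcupT_measurable => [|i]; first exact: countableP.
by case: ifP => // /set_mem; exact: mF.
Qed.

(** * The trajectory space, continuity and measurability of windows *)

Section trajectory_measurability.
Context {R : realType} {L : nat}.
Local Notation traj := (trajectory R L).
Local Notation W := (borel_trajectory R L).

Definition times (w : traj) : seq R := map fst (events w).
Definition marks (w : traj) : seq ({set 'I_L} * {set 'I_L}) := map snd (events w).

Lemma trajectory_at_times S m t :
  times (@trajectory_at R L S m t) = [seq t ord0 i | i <- enum 'I_(size m)].
Proof. by rewrite /times /= -map_comp. Qed.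

Lemma trajectory_at_marks S m t : marks (@trajectory_at R L S m t) = m.
Proof.
rewrite /marks /= -map_comp; apply: (@eq_from_nth _ (finset.set0, finset.set0)).
  by rewrite size_map size_enum_ord.
move=> i; rewrite size_map size_enum_ord => im.
rewrite (nth_map (Ordinal im)) ?size_enum_ord //=.
by rewrite (tnth_nth (finset.set0, finset.set0)) /= nth_enum_ord.
Qed.

Lemma nth_trajectory_at_times S m t (i : 'I_(size m)) :
  nth 0 (times (@trajectory_at R L S m t)) i = t ord0 i.
Proof. by rewrite trajectory_at_times (nth_map i) ?size_enum_ord // nth_ord_enum. Qed.

Lemma trajectory_eq (w w' : traj) : start w = start w' -> marks w = marks w' ->
  times w = times w' -> w = w'.
Proof.
case: w w' => [S e] [S' e'] /= -> ; rewrite /marks /times /= => E2 E1; congr Trajectory.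
by rewrite -(zip_unzip e) -(zip_unzip e') /unzip1 /unzip2 E1 E2.
Qed.

Lemma trajectory_atE (w : traj) :
  w = trajectory_at (start w) (m := marks w) (\row_i nth 0 (times w) i).
Proof.
apply: trajectory_eq => //; first by rewrite trajectory_at_marks.
apply: (@eq_from_nth _ 0); first by rewrite trajectory_at_times [RHS]size_map [RHS]size_enum_ord !size_map.
move=> i; rewrite size_map => iw.
have im : (i < size (marks w))%N by rewrite size_map.
by rewrite (nth_trajectory_at_times _ _ (Ordinal im)) mxE.
Qed.

Lemma open_trajectoryE (U : set traj) : open U = trajectory_open U.
Proof. by []. Qed.

Lemma continuous_trajectory_at S m : continuous (@trajectory_at R L S m).
Proof.
by apply/continuousP => U /(_ S m).
Qed.

(** An open set of rows is a countable union of the cubes [B p], with rational centre [p.1] and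
    half-side 1 / (p.2 + 1). *)
Lemma measurable_open_row d (T : measurableType d) n (f : T -> 'rV[R]_n) (V : set 'rV[R]_n) :
  (forall i, measurable_fun setT (fun x => f x ord0 i)) -> open V -> measurable (f @^-1` V).
Proof.
move=> mf oV.
pose B (p : 'rV[rat]_n * nat) : set 'rV[R]_n :=
  [set t | forall i, ratr (p.1 ord0 i) - p.2.+1%:R^-1 < t ord0 i < ratr (p.1 ord0 i) + p.2.+1%:R^-1].
have -> : f @^-1` V = \bigcup_(p in [set p | B p `<=` V]) (f @^-1` (B p)).
  apply/seteqP; split => x /=; last by case=> p /= pV Bx; exact: pV.
  move=> Vx; have /nbhs_ballP[e /= e0 eV] : nbhs (f x) V by exact: open_nbhs_nbhs.
  (* Two points of one cube differ in each coordinate by less than 2 / (n0 + 1), which this choice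
     makes smaller than e. *)
  pose n0 := Num.truncn (2 / e).
  have n0e : n0.+1%:R^-1 < e / 2.
    rewrite -[e / 2]invrK ltf_pV2 ?posrE ?invr_gt0 ?divr_gt0 // invf_div.
    by rewrite truncnS_gt.
  have rq i : exists q : rat, f x ord0 i - n0.+1%:R^-1 < ratr q < f x ord0 i + n0.+1%:R^-1.
    have l : f x ord0 i - n0.+1%:R^-1 < f x ord0 i + n0.+1%:R^-1.
      by rewrite ltrD2l (lt_trans (y := 0)) ?oppr_lt0.
    have [q] := rat_in_itvoo l; rewrite in_itv /= => qi.
    by exists q.
  have [q qE] := choice rq.
  exists (\row_i q i, n0); last first.
    by move=> i /=; rewrite mxE; case/andP: (qE i) => q1 q2; rewrite ltrBlDr q2 -ltrBlDr q1.
  move=> t /= Bt; apply: eV; split => // i j; rewrite ord1 /ball /=.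
  have /andP[b1 b2] := Bt j; have /andP[q1 q2] := qE j; move: b1 b2; rewrite /= mxE => b1 b2.
  rewrite -[`|_|]/(`|f x ord0 j - t ord0 j|) ltr_norml.
  move: n0e b1 b2 q1 q2; move: (f x ord0 j) (t ord0 j) (ratr (q j)) (n0.+1%:R^-1) => u v r s *.
  by apply/andP; split; lra.
apply: measurable_bigcup_countType => p _.
rewrite (_ : _ @^-1` _ = \bigcap_(i in [set: 'I_n])
   ((fun x => f x ord0 i) @^-1` `]ratr (p.1 ord0 i) - p.2.+1%:R^-1, ratr (p.1 ord0 i) + p.2.+1%:R^-1[)).
  apply: fin_bigcap_measurable => [|i _]; first exact: finite_finset.
  rewrite -[X in measurable X]setTI; apply: mf => //.
by apply/seteqP; split => x /= H i; [move=> _ /=; rewrite in_itv; exact: H|have := H i I; rewrite /= in_itv].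
Qed.

(** Initial state and marks are constant on each component of the disjoint union, so a condition on
    them alone defines an open set. *)
Lemma measurable_start_marks (P : {set 'I_L} -> seq ({set 'I_L} * {set 'I_L}) -> Prop) :
  measurable [set w : W | P (start w) (marks w)].
Proof.
apply: sub_sigma_algebra; rewrite /= open_trajectoryE => S m.
rewrite (_ : _ @^-1` _ = [set t | P S m]).
  case: (pselect (P S m)) => Pm.
    by rewrite (_ : [set _ | _] = setT); [exact: openT|apply/seteqP; split].
  by rewrite (_ : [set _ | _] = set0); [exact: open0|apply/seteqP; split].
by apply/seteqP; split => t /=; rewrite trajectory_at_marks.
Qed.

Lemma measurable_time i : measurable_fun setT (fun w : W => nth 0 (times w) i).
Proof.
apply: (measurability _ (RGenOInfty.measurableE R)) => _ [_ [x ->] <-].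
rewrite setTI; apply: sub_sigma_algebra; rewrite /= open_trajectoryE => S m.
have [im|mi] := ltnP i (size m).
  rewrite (_ : _ @^-1` _ = (fun t : 'rV[R]_(size m) => t ord0 (Ordinal im)) @^-1` [set` `]x, +oo[]).
    by apply: open_comp => [t _|]; [exact: coord_continuous|exact: interval_open].
  apply/seteqP; split => t /=;
    by rewrite -(nth_trajectory_at_times S t (Ordinal im)).
rewrite (_ : _ @^-1` _ = [set t | [set` `]x, +oo[] (0 : R)]).
  case: (pselect ([set` `]x, +oo[] (0 : R))) => Pm.
    by rewrite (_ : [set _ | _] = setT); [exact: openT|apply/seteqP; split].
  by rewrite (_ : [set _ | _] = set0); [exact: open0|apply/seteqP; split].
have E t : nth 0 (times (@trajectory_at R L S m t)) i = 0.
  by rewrite nth_default // trajectory_at_times size_map size_enum_ord.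
by apply/seteqP; split => t /=; rewrite E.
Qed.

Lemma trajectory_at_eq (w w' : traj) : start w' = start w -> marks w' = marks w ->
  w' = trajectory_at (start w) (m := marks w) (\row_i nth 0 (times w') i).
Proof. by move=> s m; have := trajectory_atE w'; rewrite s m. Qed.

(** There are only countably many components, and on the preimage of each one the times form a
    measurable map into a space of rows. *)
Lemma measurable_fun_trajectory d (T : measurableType d) (G : T -> W) :
  (forall S m, measurable [set x | start (G x) = S /\ marks (G x) = m]) ->
  (forall i, measurable_fun setT (fun x => nth 0 (times (G x)) i)) ->
  measurable_fun setT G.
Proof.
move=> mG mt; refine (@measurability _ _ T W setT G (@open (trajectory R L)) erefl _).
move=> _ [U oU <-]; rewrite setTI.
pose row (p : {set 'I_L} * seq ({set 'I_L} * {set 'I_L})) x : 'rV[R]_(size p.2) :=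
  \row_i nth 0 (times (G x)) i.
rewrite (_ : _ @^-1` _ = \bigcup_(p in setT)
    ([set x | start (G x) = p.1 /\ marks (G x) = p.2] `&`
     row p @^-1` (@trajectory_at R L p.1 p.2 @^-1` U))).
  apply: measurable_bigcup_countType => p _; apply: measurableI => //.
  apply: measurable_open_row; last exact: oU.
  by move=> i; under eq_fun do rewrite mxE; exact: mt.
apply/seteqP; split => x /=.
  move=> Ux; exists (start (G x), marks (G x)) => //=; split=> //.
  by rewrite /row /= -trajectory_at_eq.
case=> -[S m] _ [/= [<- <-]]; by rewrite /row /= -trajectory_at_eq.
Qed.

Lemma cvg_trajectory (w_ : nat -> traj) (w : traj) (f : traj -> R) : continuous f ->
  (\forall i \near \oo, start (w_ i) = start w /\ marks (w_ i) = marks w) ->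
  (forall j, nth 0 (times (w_ i)) j @[i --> \oo] --> nth 0 (times w) j) ->
  f (w_ i) @[i --> \oo] --> f w.
Proof.
move=> cf sm tw; pose row w' : 'rV[R]_(size (marks w)) := \row_j nth 0 (times w') j.
have rc : row (w_ i) @[i --> \oo] --> row w.
  apply/cvgrPdist_lt => e e0; near=> i.
  have H : forall j : 'I_(size (marks w)), `|nth 0 (times w) j - nth 0 (times (w_ i)) j| < e / 2.
    near: i; apply: filter_forall => j; have /cvgrPdist_lt := tw j; apply.
    by rewrite divr_gt0.
  have e2 : e / 2 < e by rewrite gtr_pMr // invf_lt1 // ltr1n.
  have : ball (row w) e (row (w_ i)).
    split=> // k j; rewrite /ball /= !mxE; exact: lt_trans (H j) e2.
  by rewrite mx_norm_ball.
have := cvg_comp _ _ rc (cvg_comp _ _ (@continuous_trajectory_at (start w) (marks w) (row w)) (cf _)).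
rewrite -(trajectory_at_eq (w := w) erefl erefl).
apply: cvg_trans; apply: near_eq_cvg; near=> i.
have [s m] : start (w_ i) = start w /\ marks (w_ i) = marks w by near: i.
by rewrite /= -trajectory_at_eq.
Unshelve. all: by end_near.
Qed.

Section window.
Variables a b : R.

(** The window depends on the comparisons with a and b only through these two bit patterns: while
    they are constant it is a fixed selection among the marks and times. Measurability follows by
    cutting along the patterns, and continuity holds where no time equals a or b, since the patterns
    are locally constant there. *)
Let before (w : traj) := [seq t < a | t <- times w].
Let inside (w : traj) := [seq a <= t <= b | t <- times w].

Lemma start_window (w : traj) :
  start (window a b w) = last (start w) [seq x.2 | x <- mask (before w) (marks w)].
Proof.
rewrite /= filter_mask (map_comp snd snd) map_mask; congr (last _ (map _ (mask _ _))).
by rewrite /before /times -map_comp.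
Qed.

Lemma marks_window (w : traj) : marks (window a b w) = mask (inside w) (marks w).
Proof. by rewrite /marks /= filter_mask map_mask /inside /times -map_comp. Qed.

Lemma times_window (w : traj) : times (window a b w) = mask (inside w) (times w).
Proof. by rewrite /times /= filter_mask map_mask /inside /times -map_comp. Qed.

Lemma nth_mask_times (bs : bitseq) (s : seq R) j :
  let l := mask bs (iota 0 (size s)) in
  nth 0 (mask bs s) j = if (j < size l)%N then nth 0 s (nth 0%N l j) else 0.
Proof.
move=> l; have -> : mask bs s = [seq nth 0 s i | i <- l].
  by rewrite map_mask map_nth_iota0 // take_size.
case: ltnP => jl; first by rewrite (nth_map 0%N).
by rewrite nth_default // size_map.
Qed.

Lemma measurable_fun_pieces d d' (T : measurableType d) (X : measurableType d') (I : countType)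
    (D : T -> I) (g_ : I -> T -> X) (g : T -> X) :
  (forall i, measurable [set x | D x = i]) -> (forall i, measurable_fun setT (g_ i)) ->
  (forall x, g x = g_ (D x) x) -> measurable_fun setT g.
Proof.
move=> mD mg gE _ B mB; rewrite setTI.
rewrite (_ : _ @^-1` _ = \bigcup_(i in setT) ([set x | D x = i] `&` g_ i @^-1` B)).
  apply: measurable_bigcup_countType => i _; apply: measurableI => //.
  by rewrite -[X in measurable X]setTI; exact: mg.
apply/seteqP; split => x /=; first by move=> Bx; exists (D x) => //; split => //; rewrite /preimage /mkset -gE.
by case=> i _ [/= <-]; rewrite /preimage /mkset -gE.
Qed.

Lemma measurable_nth_mask_times (bs : bitseq) n j :
  measurable_fun setT (fun w : W => if (j < size (mask bs (iota 0 n)))%N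
     then nth 0 (times w) (nth 0%N (mask bs (iota 0 n)) j) else 0).
Proof.
by case: (ltnP j (size (mask bs (iota 0 n)))) => _; [exact: measurable_time|exact: measurable_cst].
Qed.

Let code (w : W) : {set 'I_L} * seq ({set 'I_L} * {set 'I_L}) * (bitseq * bitseq) :=
  (start w, marks w, (before w, inside w)).

Let measurable_code c : measurable [set w | code w = c].
Proof.
case: c => -[S m] [p q].
pose t i (w : W) := nth 0 (times w) i.
have mlt (i : nat) v : measurable [set w : W | (t i w < a) = v].
  rewrite (_ : [set _ | _] = (fun w => t i w < a) @^-1` [set v]) //.
  rewrite -[X in measurable X]setTI.
  by apply: measurable_fun_ltr => //; exact: measurable_time.
have min (i : nat) v : measurable [set w : W | (a <= t i w <= b) = v].
  rewrite (_ : [set _ | _] = (fun w => (a <= t i w) && (t i w <= b)) @^-1` [set v]) //.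
  rewrite -[X in measurable X]setTI.
  by apply: measurable_and => //; apply: measurable_fun_ler => //; exact: measurable_time.
rewrite (_ : [set _ | _] = [set w : W | [/\ start w = S, marks w = m, size p = size m & size q = size m]] `&`
   \bigcap_(i in [set i | (i < size m)%N]) ([set w : W | (t i w < a) = nth false p i] `&`
      [set w : W | (a <= t i w <= b) = nth false q i])).
  apply: measurableI.
    exact: (measurable_start_marks (fun S' m' => [/\ S' = S, m' = m, size p = size m & size q = size m])).
  by apply: fin_bigcap_measurable => [|i _]; [exact: finite_II|exact: measurableI].
have sm (w : W) : size (marks w) = size (times w) by rewrite !size_map.
apply/seteqP; split => w.
  rewrite /code /= => -[<- <- <- <-]; rewrite /before /inside; split => /=.
    by split=> //; rewrite size_map sm.
  by move=> i /=; rewrite sm => im; rewrite !(nth_map 0).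
case=> /= -[<- <- pm qm] H; rewrite /code /before /inside; congr (_, _, (_, _)).
  apply: (@eq_from_nth _ false); first by rewrite size_map pm sm.
  move=> i; rewrite size_map => im; rewrite (nth_map 0) //.
  by have [] := H i (eq_ind_r (fun n => (i < n)%N) im (sm w)).
apply: (@eq_from_nth _ false); first by rewrite size_map qm sm.
move=> i; rewrite size_map => im; rewrite (nth_map 0) //.
by have [] := H i (eq_ind_r (fun n => (i < n)%N) im (sm w)).
Qed.

Lemma measurable_window : measurable_fun setT (window a b : W -> W).
Proof.
have sm (w : W) : size (times w) = size (marks w) by rewrite !size_map.
apply: measurable_fun_trajectory => [S m|i].
  rewrite (_ : [set _ | _] = \bigcup_(c in [set c | last c.1.1 [seq x.2 | x <- mask c.2.1 c.1.2] = S /\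
      mask c.2.2 c.1.2 = m]) [set w | code w = c]).
    exact: measurable_bigcup_countType.
  apply/seteqP; split => w; rewrite /mkset start_window marks_window.
    by move=> H; exists (code w).
  by case=> c /= [H1 H2] cw; move: H1 H2; rewrite -cw.
apply: (measurable_fun_pieces (D := code) (g_ := fun c w =>
     if (i < size (mask c.2.2 (iota 0 (size c.1.2))))%N
     then nth 0 (times w) (nth 0%N (mask c.2.2 (iota 0 (size c.1.2))) i) else 0)) => //.
  by move=> c; exact: measurable_nth_mask_times.
by move=> w; rewrite times_window nth_mask_times sm.
Qed.

Lemma cvg_window (w_ : nat -> traj) (w : traj) (f : traj -> R) : continuous f ->
  (\forall i \near \oo, start (w_ i) = start w /\ marks (w_ i) = marks w) ->
  (forall j, nth 0 (times (w_ i)) j @[i --> \oo] --> nth 0 (times w) j) ->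
  (forall t, t \in times w -> (t != a) && (t != b)) ->
  f (window a b (w_ i)) @[i --> \oo] --> f (window a b w).
Proof.
move=> cf sm tw ab.
have st (v : traj) : size (times v) = size (marks v) by rewrite !size_map.
have cmp c j : (forall t, t \in times w -> t != c) -> (j < size (marks w))%N ->
    \forall i \near \oo, ((nth 0 (times (w_ i)) j < c) = (nth 0 (times w) j < c)) /\
       ((nth 0 (times (w_ i)) j <= c) = (nth 0 (times w) j <= c)).
  move=> cw jm; have := cw _ (mem_nth 0 (eq_ind_r (fun n => (j < n)%N) jm (st w))).
  case: ltgtP => // [lt|gt] _; near=> i.
    have H : nth 0 (times (w_ i)) j < c by near: i; exact: cvgr_lt (tw j) _ lt.
    by rewrite H ltW.
  have H : c < nth 0 (times (w_ i)) j by near: i; exact: cvgr_gt (tw j) _ gt.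
  by rewrite ltNge (ltW H) leNgt H.
have pat : \forall i \near \oo, before (w_ i) = before w /\ inside (w_ i) = inside w.
  have cmpn : \forall i \near \oo, forall j : 'I_(size (marks w)),
     [/\ (nth 0 (times (w_ i)) j < a) = (nth 0 (times w) j < a),
       (nth 0 (times (w_ i)) j <= b) = (nth 0 (times w) j <= b) &
       (a <= nth 0 (times (w_ i)) j) = (a <= nth 0 (times w) j)].
    apply: filter_forall => j.
    have Ha := cmp a j (fun t tw => proj1 (andP (ab t tw))) (ltn_ord j).
    have Hb := cmp b j (fun t tw => proj2 (andP (ab t tw))) (ltn_ord j).
    by apply: filterS2 Ha Hb => i [h1 _] [_ h2]; split=> //; rewrite !leNgt h1.
  apply: filterS2 sm cmpn => i [_ mi] H.
  have E : size (times (w_ i)) = size (times w) by rewrite !st mi.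
  have G (j : nat) (jt : (j < size (times w))%N) :=
    H (Ordinal (eq_ind _ (fun n => (j < n)%N) jt _ (st w))).
  rewrite /before /inside; split; apply: (@eq_from_nth _ false).
  - by rewrite [LHS]size_map [RHS]size_map E.
  - move=> j; rewrite size_map E => jt; rewrite !(nth_map 0) ?E //.
    by have [h1 _ _] := G j jt.
  - by rewrite [LHS]size_map [RHS]size_map E.
  - move=> j; rewrite size_map E => jt; rewrite !(nth_map 0) ?E //.
    by have [/= _ -> ->] := G j jt.
apply: cvg_trajectory => //.
  apply: filterS2 sm pat => i [s1 m1] [b1 i1].
  by rewrite !start_window !marks_window s1 m1 b1 i1.
move=> j; rewrite times_window nth_mask_times; pose l := mask (inside w) (iota 0 (size (times w))).
have C : (if (j < size l)%N then nth 0 (times (w_ i)) (nth 0%N l j) else 0) @[i --> \oo] -->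
    (if (j < size l)%N then nth 0 (times w) (nth 0%N l j) else 0).
  by case: (ltnP j (size l)) => _; [exact: tw|exact: cvg_cst].
apply: cvg_trans C; apply: near_eq_cvg; apply: filterS2 sm pat => i [s1 m1] [b1 i1].
by rewrite times_window nth_mask_times i1 !st m1 -st.
Unshelve. all: by end_near.
Qed.

End window.

End trajectory_measurability.

Lemma continuous_measurable_trajectory (R : realType) L (f : trajectory R L -> R) :
  continuous f -> measurable_fun setT (f : borel_trajectory R L -> R).
Proof.
move=> /continuousP cf; apply: (measurability _ (RGenOpens.measurableE R)).
move=> _ [_ [x [y ->]] <-]; rewrite setTI; apply: sub_sigma_algebra.
by apply: cf; exact: interval_open.
Qed.

(** * Paths with single jumps, encoded by holes and times *)

Section hole_words.
Context {R : realType} {L : nat}.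
Local Notation traj := (trajectory R L).
Local Notation W := (borel_trajectory R L).
Implicit Types (S U V : {set 'I_L}) (e : seq ('I_L * R)) (F : traj -> R).

Fixpoint legal S (ks : seq 'I_L) : bool :=
  if ks is k :: ks' then free S k && legal (hop S k) ks' else true.

Fixpoint hole_marks S (ks : seq 'I_L) : seq ({set 'I_L} * {set 'I_L}) :=
  if ks is k :: ks' then ([set k]%SET, hop S k) :: hole_marks (hop S k) ks' else [::].

Fixpoint hole_events S e : seq (R * ({set 'I_L} * {set 'I_L})) :=
  if e is x :: e' then (x.2, ([set x.1]%SET, hop S x.1)) :: hole_events (hop S x.1) e' else [::].

Definition hole_path S S' (ks : seq 'I_L) : bool := legal S ks && (foldl (@hop L) S ks == S').

(** The value of [F] on the path that starts at S and jumps from the listed holes, extended by 0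
    when a jump is forbidden or the final state is not S'. All constraints are thus carried by the
    functional and the sums over marks remain free. *)
Definition bridge S S' F e : R :=
  if hole_path S S' (map fst e) then F (Trajectory S (hole_events S e)) else 0.

Lemma marks_hole_events S e : marks (Trajectory S (hole_events S e)) = hole_marks S (map fst e).
Proof. by rewrite /marks /=; elim: e S => //= x e IHe S; rewrite IHe. Qed.

Lemma times_hole_events S e : times (Trajectory S (hole_events S e)) = map snd e.
Proof. by rewrite /times /=; elim: e S => //= x e IHe S; rewrite IHe. Qed.

Lemma bridge_le S S' F (C : R) : (forall w, `|F w| <= C) -> forall e, `|bridge S S' F e| <= C.
Proof.
move=> FC e; rewrite /bridge; case: ifP => // _.
by rewrite normr0 (le_trans _ (FC point)).
Qed.

Lemma cont_off_bridge S S' F (D : seq R) :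
  (forall (w_ : nat -> traj) (w : traj),
    (\forall i \near \oo, start (w_ i) = start w /\ marks (w_ i) = marks w) ->
    (forall j, nth 0 (times (w_ i)) j @[i --> \oo] --> nth 0 (times w) j) ->
    (forall t, t \in times w -> t \notin D) -> F (w_ i) @[i --> \oo] --> F w) ->
  cont_off D (bridge S S' F).
Proof.
move=> cF e phi_ phi pcvg pD; rewrite /bridge.
have fE (g : R -> R) : [seq x.1 | x <- [seq (x.1, g x.2) | x <- e]] = [seq x.1 | x <- e].
  by rewrite -map_comp.
have sE (g : R -> R) : [seq x.2 | x <- [seq (x.1, g x.2) | x <- e]] = [seq g x.2 | x <- e].
  by rewrite -map_comp.
under eq_fun do rewrite fE; rewrite fE; case: ifP => _; last exact: cvg_cst.
apply: cF.
- by apply: nearW => i; rewrite !marks_hole_events !fE.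
- move=> j; rewrite times_hole_events sE.
  under eq_fun do rewrite times_hole_events sE.
  case: (ltnP j (size e)) => je; last first.
    rewrite nth_default ?size_map //; under eq_fun do rewrite nth_default ?size_map //.
    exact: cvg_cst.
  case: e je pcvg {pD fE sE} => [//|x0 e'] je pcvg.
  rewrite (nth_map x0) //; under eq_fun do rewrite (nth_map x0) //.
  by apply: pcvg; exact: mem_nth.
- move=> t; rewrite times_hole_events sE => /mapP[x xe ->]; exact: pD.
Qed.

Lemma cont_off_bridge_window S S' (f : traj -> R) a b : continuous f ->
  cont_off [:: a; b] (bridge S S' (fun w => f (window a b w))).
Proof.
move=> cf; apply: cont_off_bridge => w_ w sm tw tD; apply: cvg_window => // t /tD.
by rewrite !inE negb_or.
Qed.

Lemma cont_off_bridge_continuous S S' (f : traj -> R) : continuous f ->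
  cont_off [::] (bridge S S' f).
Proof. by move=> cf; apply: cont_off_bridge => w_ w sm tw _; exact: cvg_trajectory. Qed.

Section measurability.
Variable k0 : 'I_L.
Local Notation Y := (measurableTypeR R * measurableTypeR R)%type.

Lemma measurable_holes n (P : seq 'I_L -> Prop) c tau :
  measurable [set y : n.-tuple Y | P (map fst (marks_at k0 c tau y))].
Proof.
rewrite (_ : [set _ | _] =
   \bigcup_(z in [set z : n.-tuple 'I_L | P z]) [set y : n.-tuple Y |
      forall i : 'I_n, ucell k0 (tnth y i).1 = tnth z i]).
  apply: measurable_bigcup_countType => z _.
  rewrite (_ : [set _ | _] = \bigcap_(i in [set: 'I_n])
     [set y : n.-tuple Y | ucell k0 (tnth y i).1 = tnth z i]).
    apply: fin_bigcap_measurable => [|i _]; first exact: finite_finset.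
    have mc : measurable [set x : Y | ucell k0 x.1 = tnth z i].
      rewrite (_ : [set _ | _] = [set u | ucell k0 u = tnth z i] `*` setT).
        by apply: measurableX => //; exact: measurable_ucell_fiber.
      by apply/seteqP; split => x /= => [|[]].
    by have := @measurable_tnth _ Y n i measurableT _ mc; rewrite setTI.
  by apply/seteqP; split => y /= H i; [move=> _; exact: H|exact: (H i I)].
have E (y : n.-tuple Y) : map fst (marks_at k0 c tau y) = [tuple of map (fun x : Y => ucell k0 x.1) y].
  by rewrite /marks_at -map_comp.
apply/seteqP; split => y /=; rewrite E.
  by move=> Py; exists [tuple of map (fun x : Y => ucell k0 x.1) y] => //= i; rewrite tnth_map.
case=> z /= Pz yz; suff -> : map (fun x : Y => ucell k0 x.1) y = z by [].
suff <- : [tuple of map (fun x : Y => ucell k0 x.1) y] = z by [].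
by apply: eq_from_tnth => i; rewrite tnth_map yz.
Qed.

Lemma measurable_hole_trajectory n S c tau :
  measurable_fun setT (fun y : n.-tuple Y =>
    Trajectory S (hole_events S (marks_at k0 c tau y)) : W).
Proof.
apply: measurable_fun_trajectory => [S0 m|i].
  rewrite (_ : [set _ | _] = [set y : n.-tuple Y |
     (fun ks => S = S0 /\ hole_marks S ks = m) (map fst (marks_at k0 c tau y))]).
    exact: (measurable_holes (fun ks => S = S0 /\ hole_marks S ks = m)).
  by apply/seteqP; split => y; rewrite /mkset marks_hole_events.
have E : (fun y : n.-tuple Y => nth 0 (times (Trajectory S (hole_events S (marks_at k0 c tau y)))) i) =
    if (i < n)%N then fun y : n.-tuple Y => c + tau * (nth (0, 0) y i).2 else cst 0.
  apply/funext => y; rewrite times_hole_events (_ : map snd _ = [seq c + tau * x.2 | x <- y]).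
    case: (ltnP i n) => [il|ni]; first by rewrite (nth_map (0, 0)) // size_tuple.
    by rewrite nth_default // size_map size_tuple.
  by rewrite /marks_at -map_comp.
rewrite E; case: (ltnP i n) => [il|_]; last exact: measurable_cst.
apply: measurable_funD => //; apply: measurable_funM => //.
apply: (measurableT_comp measurable_snd).
under eq_fun do rewrite -(tnth_nth _ _ (Ordinal il)).
exact: measurable_tnth.
Qed.

Lemma mark_measurable_bridge S S' F : measurable_fun setT (F : W -> R) ->
  mark_measurable k0 (bridge S S' F).
Proof.
move=> mF n c tau; rewrite /bridge; apply: measurable_fun_ifT => //.
- apply: (measurable_fun_bool true); rewrite setTI.
  exact: (measurable_holes (fun ks => hole_path S S' ks = true)).
- exact: (measurableT_comp mF (@measurable_hole_trajectory n S c tau)).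
Qed.

End measurability.

End hole_words.

Section msum_theory.
Context {R : realType} {K : finType}.
Implicit Types (H : seq (K * R) -> R) (ts : seq R) (e : R).

Lemma eq_msum e ts H H' : (forall s, {subset map snd s <= ts} -> H s = H' s) ->
  msum e ts H = msum e ts H'.
Proof.
elim: ts H H' => [|t ts IHts] H H' HH /=; first by apply: HH.
rewrite (IHts H H') => [|s sts]; last by apply: HH => x /sts; rewrite inE orbC => ->.
congr (_ + _ * _); apply: eq_bigr => k _; apply: IHts => s sts; apply: HH => x /=.
by rewrite !inE => /predU1P[->|/sts ->]; rewrite ?eqxx ?orbT.
Qed.

Lemma msum_cat e ts1 ts2 H :
  msum e (ts1 ++ ts2) H = msum e ts1 (fun s1 => msum e ts2 (fun s2 => H (s1 ++ s2))).
Proof.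
by elim: ts1 H => //= t ts1 IHts1 H; rewrite IHts1; congr (_ + _ * _); apply: eq_bigr => k _; rewrite IHts1.
Qed.

Lemma msum_sum (I : Type) (r : seq I) (Q : pred I) e ts (H : I -> seq (K * R) -> R) :
  msum e ts (fun s => \sum_(i <- r | Q i) H i s) = \sum_(i <- r | Q i) msum e ts (H i).
Proof.
elim: ts H => //= t ts IHts H; rewrite IHts big_split /=; congr (_ + _).
rewrite -mulr_sumr; congr (_ * _).
by under eq_bigr do rewrite IHts; rewrite exchange_big.
Qed.

Lemma msumZ e ts a H : msum e ts (fun s => a * H s) = a * msum e ts H.
Proof.
elim: ts H => //= t ts IHts H; rewrite IHts mulrDr mulrCA; congr (_ + _ * _).
by under eq_bigr do rewrite IHts; rewrite mulr_sumr.
Qed.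

Lemma mlim_cvg (k0 : K) H (C : R) (D : seq R) (c tau : R) : 0 < tau -> (forall z, `|H z| <= C) -> cont_off D H ->
  mark_measurable k0 H ->
  cvgn (series (lterm k0 c tau H)) /\
  msum (tau / i.+1%:R) [seq c + tau / i.+1%:R * j%:R | j <- iota 0 i.+1] H @[i --> \oo] -->
    mlim k0 c tau H.
Proof.
move=> tau0 HC Hc Hm.
apply: (msum_cvg (D := D) (C := C) (c_ := fun=> c) (M := fun i => i.+1)) => //.
- by move=> i; rewrite divr_gt0.
- rewrite -[X in _ --> X](mulr0 tau); apply: cvgMr; exact: cvg_harmonic.
- rewrite (_ : (fun i => _) = fun=> tau); first exact: cvg_cst.
  by apply/funext => i; rewrite divfK // pnatr_eq0.
- exact: cvg_cst.
Qed.

End msum_theory.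

Section path_measure.
Context {R : realType} {L : nat}.
Local Notation traj := (trajectory R L).
Local Notation W := (borel_trajectory R L).
Local Notation Y := (measurableTypeR R * measurableTypeR R)%type.
Variables (k0 : 'I_L) (S S' : {set 'I_L}) (c tau : R).
Hypothesis tau_gt0 : 0 < tau.
Hypothesis mass_gt0 : 0 < mlim k0 c tau (bridge S S' (fun=> 1)).

(** The law is the mixture over n of the images of n uniform marked points restricted to ordered
    times and legal paths, weighted by (L tau) ^ n and divided by the total mass. *)
Lemma exists_path_measure : exists Q : probability W R,
  forall (F : W -> R) (C : R), measurable_fun setT F -> (forall w, `|F w| <= C) ->
    \int[Q]_w F w = mlim k0 c tau (bridge S S' F) / mlim k0 c tau (bridge S S' (fun=> 1)).
Proof.
have := mass_gt0; set Z := mlim _ _ _ _ => Z_gt0.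
pose A n : set (n.-tuple Y) :=
  [set y | ordered y && hole_path S S' (map fst (marks_at k0 c tau y))].
have mA n : measurable (A n).
  rewrite (_ : A n = [set y | ordered y] `&`
    [set y | hole_path S S' (map fst (marks_at k0 c tau y)) = true]).
    apply: measurableI; first exact: measurable_ordered.
    exact: (measurable_holes k0 (fun ks => hole_path S S' ks = true)).
  by apply/seteqP; split => y /=; rewrite /A /=; [move=> /andP[]|case=> -> ->].
pose T n (y : n.-tuple Y) : W := Trajectory S (hole_events S (marks_at k0 c tau y)).
have mT n : measurable_fun setT (T n) by exact: measurable_hole_trajectory.
pose d n : R := (#|'I_L|%:R * tau) ^+ n / Z.
have d0 n : 0 <= d n by rewrite divr_ge0 ?(ltW Z_gt0) // exprn_ge0 // mulr_ge0 // ltW.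
have E (F : W -> R) : series (fun n => d n * \int[mark_law (R := R) n]_(y in A n) F (T n y)) =
    (fun n => series (lterm k0 c tau (bridge S S' F)) n / Z).
  apply/funext => n; rewrite /series /= mulr_suml; apply: eq_bigr => k _.
  rewrite /d /lterm [RHS]mulrAC; congr (_ * _).
  rewrite [LHS]Rintegral_mkcond; apply: eq_Rintegral => y _; rewrite /patch /bridge.
  have -> : (y \in A k) = ordered y && hole_path S S' (map fst (marks_at k0 c tau y)).
    by apply/idP/idP; rewrite inE.
  by case: (ordered y) => //=; case: ifP.
have [Z1 Z2] : cvgn (series (lterm k0 c tau (bridge S S' (fun=> 1)))) /\
    series (lterm k0 c tau (bridge S S' (fun=> 1))) @ \oo --> Z.
  have [|||h1 _] := @mlim_cvg R _ k0 (bridge S S' (fun=> 1)) 1 [::] c tau tau_gt0.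
  - by apply: bridge_le => w; rewrite normr1.
  - by apply: cont_off_bridge => w_ w _ _ _; exact: cvg_cst.
  - by apply: mark_measurable_bridge; exact: measurable_cst.
  - by split.
have [|Q QE] := @exists_mixture R _ W _ (fun n => n.-tuple Y) (fun n => mark_law (R := R) n) T A d mT mA d0.
  rewrite (_ : series _ = series (fun n => d n * \int[mark_law (R := R) n]_(y in A n) (fun=> 1) (T n y))).
    rewrite (E (fun=> 1)) -[X in _ --> X](divff (lt0r_neq0 Z_gt0)).
    by apply: cvgMl.
  apply/congr1/funext => n; congr (_ * _).
  by rewrite /Rintegral integral_cst ?mul1e //; exact: mA.
exists Q => F C mF FC; have := QE F C mF FC; rewrite E => h.
have h2 : (fun n => series (lterm k0 c tau (bridge S S' F)) n / Z * Z) @ \oo --> \int[Q]_w F w * Z.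
  exact: cvgMl.
rewrite -[LHS](mulfK (lt0r_neq0 Z_gt0)); congr (_ / _); apply/esym/cvg_lim => //.
suff <- : (fun n => series (lterm k0 c tau (bridge S S' F)) n / Z * Z) =
  series (lterm k0 c tau (bridge S S' F)) by [].
by apply/funext => n; rewrite divfK // lt0r_neq0.
Qed.

End path_measure.

(** * The limit of small weights *)

Section configuration_sums.
Context {R : realType} {L : nat}.
Hypothesis L_gt1 : (1 < L)%N.
Local Notation T := {set 'I_L}.
Local Notation traj := (trajectory R L).
Implicit Types (S J : T) (Js : seq T).

Definition jump_to S J : T := (move J @: S)%SET.

Definition jump_ok S J : bool := (J \subset S) && dinjectiveb (move J) (mem S).

Fixpoint jumps_ok S Js : bool :=
  if Js is J :: Js' then jump_ok S J && jumps_ok (jump_to S J) Js' else true.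

Fixpoint jump_events S (ts : seq R) Js : seq (R * (T * T)) :=
  match ts, Js with
  | t :: ts', J :: Js' =>
    let e := jump_events (jump_to S J) ts' Js' in
    if J == finset.set0 then e else (t, (J, jump_to S J)) :: e
  | _, _ => [::]
  end.

Lemma jumps_okP S Js : reflect (forall j, (j < size Js)%N ->
    jump_ok (foldl jump_to S (take j Js)) (nth finset.set0 Js j)) (jumps_ok S Js).
Proof.
elim: Js S => [|J Js IHJs] S /=; first by apply: ReflectT.
apply: (iffP andP) => [[J1 /IHJs J2] [|j] //=|H]; first exact: J2.
by split; [exact: (H 0%N)|apply/IHJs => j; exact: (H j.+1)].
Qed.

Lemma jump_events_map (t0 : nat -> R) S Js :
  jump_events S [seq t0 j | j <- iota 0 (size Js)] Js =
  [seq (t0 j, (nth finset.set0 Js j, foldl jump_to S (take j.+1 Js)))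
     | j <- iota 0 (size Js) & nth finset.set0 Js j != finset.set0].
Proof.
elim: Js S t0 => [|J Js IHJs] S t0 //=.
have E : [seq t0 j | j <- iota 1 (size Js)] = [seq t0 j.+1 | j <- iota 0 (size Js)].
  by rewrite (iotaDl 1 0) -map_comp.
rewrite E (IHJs (jump_to S J) (fun j => t0 j.+1)).
have E' : [seq (t0 j, (nth finset.set0 (J :: Js) j, foldl jump_to (jump_to S J) (take j Js)))
     | j <- iota 1 (size Js) & nth finset.set0 (J :: Js) j != finset.set0] =
  [seq (t0 j.+1, (nth finset.set0 Js j, foldl jump_to (jump_to S J) (take j.+1 Js)))
     | j <- iota 0 (size Js) & nth finset.set0 Js j != finset.set0].
  by rewrite (iotaDl 1 0) filter_map -map_comp.
by case: eqP => [J0|/eqP J0] /=; rewrite E' ?take0.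
Qed.

Definition levels M S (g : {ffun 'I_M -> T}) : {ffun 'I_M.+1 -> T} :=
  [ffun i : 'I_M.+1 => foldl jump_to S (take i [seq g j | j <- enum 'I_M])].

(** The levels are determined by the initial state and the jump sets, so a sum over configurations
    reduces to a sum over words of jump sets ([sum_evolution]). *)
Lemma evolutionE M S S' (c : configuration L M) :
  let Js := [seq c.2 j | j <- enum 'I_M] in
  evolution S S' c = [&& c.1 == levels S c.2, jumps_ok S Js & foldl jump_to S Js == S'].
Proof.
case: c => c g /=; set Js := map _ _.
have sJ : size Js = M by rewrite size_map size_enum_ord.
have nJ (j : 'I_M) : nth finset.set0 Js j = g j.
  by rewrite (nth_map j) ?size_enum_ord // nth_ord_enum.
have lev (i : 'I_M.+1) : levels S g i = foldl jump_to S (take i Js) by rewrite ffunE.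
have levS (j : 'I_M) : levels S g (lift ord0 j) = jump_to (levels S g (widen_ord (leqnSn M) j)) (g j).
  by rewrite !lev /= /bump /= (take_nth finset.set0) ?sJ // foldl_rcons nJ.
rewrite /evolution /=; apply/and3P/and3P => [[/eqP c0 /eqP cM /forallP cj]|[/eqP -> ok /eqP fin]].
  have cE : c = levels S g.
    apply/ffunP => -[i iM]; elim: i iM => [|i IHi] iM.
      by rewrite lev take0 /= -c0; congr (c _); apply: val_inj.
    have iM' : (i < M)%N by [].
    have /and3P[_ _ /eqP] := cj (Ordinal iM').
    rewrite /state_before /state_after /= => E.
    have -> : Ordinal iM = lift ord0 (Ordinal iM') by apply: val_inj.
    have w : widen_ord (leqnSn M) (Ordinal iM') = Ordinal (ltnW iM) by apply: val_inj.
    by rewrite levS E w (IHi (ltnW iM)).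
  split; first exact/eqP.
    apply/jumps_okP => j; rewrite sJ => jM.
    have /and3P[] := cj (Ordinal jM); rewrite /jumps /state_before /= => h1 h2 _.
    move: h1 h2; rewrite cE lev /= -(nJ (Ordinal jM)) /jump_ok /= => -> ->.
    by [].
  by rewrite -cM cE lev take_oversize ?sJ.
split.
- by rewrite lev take0.
- by rewrite lev take_oversize ?sJ // fin.
apply/forallP => j; have := jumps_okP _ _ ok j; rewrite sJ nJ => /(_ (ltn_ord j)).
rewrite /jump_ok /jumps /state_before /state_after /= lev /= => /andP[-> ->] /=.
by rewrite levS lev.
Qed.

Lemma sum_evolution (F : traj -> R) (eps tau : R) M S S' :
  \sum_(c : configuration L M | evolution S S' c) weight eps c * F (evolution_trajectory tau eps c) =
  sumw M (fun Js => if jumps_ok S Js && (foldl jump_to S Js == S')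
    then eps ^+ (\sum_(J <- Js) #|J|) *
      F (Trajectory S (jump_events S [seq - (tau / 2) + eps * j%:R | j <- iota 0 M] Js))
    else 0).
Proof.
rewrite sumw_ffun.
under eq_bigl do rewrite evolutionE.
rewrite -(pair_big_dep predT (fun c g => [&& c == levels S g, jumps_ok S [seq g j | j <- enum 'I_M]
   & foldl jump_to S [seq g j | j <- enum 'I_M] == S'])
   (fun c g => weight eps (c, g) * F (evolution_trajectory tau eps (c, g)))) /=.
rewrite (exchange_big_dep predT) //=; apply: eq_bigr => g _.
set Js := map _ _; have sJ : size Js = M by rewrite size_map size_enum_ord.
have nJ (j : 'I_M) : nth finset.set0 Js j = g j.
  by rewrite (nth_map j) ?size_enum_ord // nth_ord_enum.
case: ifPn => ok; last first.
  by rewrite big_pred0 // => c; rewrite andbF.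
rewrite (big_pred1 (levels S g)) => [|c]; last by rewrite andbT.
congr (_ * F _); first by rewrite /weight /Js big_map big_enum.
rewrite /evolution_trajectory /=; congr Trajectory; first by rewrite ffunE take0.
have -> : iota 0 M = iota 0 (size Js) by rewrite sJ.
rewrite (jump_events_map (fun j => - (tau / 2) + eps * j%:R)) sJ -val_enum_ord filter_map -map_comp.
have -> : [seq j <- enum 'I_M | jumps (levels S g, g) j != finset.set0] =
    [seq j <- enum 'I_M | preim val (fun j => nth finset.set0 Js j != finset.set0) j].
  by apply: eq_filter => j; rewrite /= nJ.
apply: eq_map => j /=; rewrite nJ addrC /state_after ffunE.
by [].
Qed.

End configuration_sums.

(** Squeeze by exp (x / (1 + x)) <= 1 + x <= exp x, raised to the power M. *)
Lemma cvg_exp1x (R : realType) (x_ : nat -> R) (M : nat -> nat) (y : R) :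
  (forall i, 0 <= x_ i) -> x_ i @[i --> \oo] --> 0 -> (M i)%:R * x_ i @[i --> \oo] --> y ->
  (1 + x_ i) ^+ M i @[i --> \oo] --> expR y.
Proof.
move=> x0 xc Mc.
have u : expR ((M i)%:R * x_ i) @[i --> \oo] --> expR y.
  exact: (cvg_comp _ _ Mc (@continuous_expR R y)).
have l : expR ((M i)%:R * x_ i / (1 + x_ i)) @[i --> \oo] --> expR y.
  have l1 : (M i)%:R * x_ i / (1 + x_ i) @[i --> \oo] --> y.
    rewrite -[y]divr1; apply: cvgM => //; apply: cvgV; first exact: oner_neq0.
    by rewrite -[X in _ --> X]addr0; apply: cvgD => //; exact: cvg_cst.
  exact: (cvg_comp _ _ l1 (@continuous_expR R y)).
apply: (squeeze_cvgr _ l u); apply: nearW => i.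
have x1 : 0 < 1 + x_ i by rewrite ltr_pwDl.
rewrite expRM_natl -mulrA expRM_natl; apply/andP; split; apply: lerXn2r; rewrite ?nnegrE ?expR_ge0 ?(ltW x1) //.
  rewrite -[leRHS]invrK -[leLHS]invrK lef_pV2 ?posrE ?invr_gt0 ?expR_gt0 //.
  rewrite -expRN (le_trans _ (expR_ge1Dx _)) //.
  suff <- : (1 + x_ i)^-1 = 1 - x_ i / (1 + x_ i) by [].
  by field; rewrite lt0r_neq0.
exact: expR_ge1Dx.
Qed.

Lemma measurable_fun_window (R : realType) L (f : trajectory R L -> R) a b : continuous f ->
  measurable_fun setT (fun w : borel_trajectory R L => f (window a b w)).
Proof. by move=> cf; exact: (measurableT_comp (continuous_measurable_trajectory cf) (measurable_window a b)). Qed.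

Lemma cont_off_bridge1 (R : realType) L (S S' : {set 'I_L}) :
  cont_off [::] (bridge S S' (fun=> 1 : R)).
Proof. by apply: cont_off_bridge => w_ w _ _ _; exact: cvg_cst. Qed.

Lemma mark_measurable_bridge1 (R : realType) L (k0 : 'I_L) (S S' : {set 'I_L}) :
  mark_measurable k0 (bridge S S' (fun=> 1 : R)).
Proof. by apply: mark_measurable_bridge; exact: measurable_cst. Qed.

Lemma norm1_le1 (R : realType) L : forall w : trajectory R L, `|(fun=> 1 : R) w| <= 1.
Proof. by move=> w; rewrite normr1. Qed.

Section single_jumps.
Context {R : realType} {L : nat}.
Hypothesis L_gt1 : (1 < L)%N.
Local Notation T := {set 'I_L}.
Implicit Types (S J : T) (Js : seq T).

Lemma neq_ordS (k : 'I_L) : (ordS k == k) = false.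
Proof.
apply/eqP => /(congr1 val) /=.
have [kL|Lk] := ltnP k.+1 L; first by rewrite modn_small //; lia.
have -> : k.+1 = L by have := ltn_ord k; lia.
by rewrite modnn; have := ltn_ord k; lia.
Qed.

Lemma jump_ok0 S : jump_ok S finset.set0.
Proof. by rewrite /jump_ok finset.sub0set; apply/dinjectiveP => x y _ _; rewrite /move !inE. Qed.

Lemma jump_to0 S : jump_to S finset.set0 = S.
Proof.
rewrite /jump_to -[RHS]imset_id; apply: eq_imset => k.
by rewrite /move inE.
Qed.

Lemma jump_ok1 S k : jump_ok S [set k]%SET = free S k.
Proof.
rewrite /jump_ok /free finset.sub1set; case: (boolP (k \in S)) => //= kS.
apply/dinjectiveP/idP => [inj|nk x y xS yS].
  apply/negP => kS'; have := inj k (ordS k) kS kS'.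
  rewrite /move !inE eqxx neq_ordS => /(_ erefl) /eqP.
  by rewrite eq_sym neq_ordS.
rewrite /move !inE; case: eqP => [->|_]; case: eqP => [->|_] //.
  by move=> E; move: nk; rewrite E yS.
by move=> E; move: nk; rewrite -E xS.
Qed.

Lemma jump_to1 S k : free S k -> jump_to S [set k]%SET = hop S k.
Proof.
move=> /andP[kS nk]; apply/setP => i; rewrite /jump_to /hop !inE; apply/imsetP/idP.
  case=> j jS ->; rewrite /move inE; case: (eqVneq j k) => [->|jk]; first by rewrite eqxx.
  by rewrite jk jS orbT.
case/predU1P => [->|/andP[ik iS]]; first by exists k => //; rewrite /move inE eqxx.
by exists i => //; rewrite /move inE (negPf ik).
Qed.

Lemma sum_card_le1 (V : nmodType) (g : T -> V) : (forall J, (1 < #|J|)%N -> g J = 0) ->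
  \sum_J g J = g finset.set0 + \sum_k g [set k]%SET.
Proof.
move=> g0; rewrite (bigD1 finset.set0) //=; congr (_ + _).
rewrite (bigID (fun J : T => #|J| == 1%N)) /= [X in _ + X]big1 ?addr0; last first.
  move=> J /andP[J0 J1]; apply: g0; rewrite ltn_neqAle eq_sym J1 lt0n cards_eq0.
  exact: J0.
have inj1 : injective (fun k : 'I_L => [set k]%SET) by exact: finset.set1_inj.
transitivity (\sum_(J in [set [set k]%SET | k in [set: 'I_L]%SET]%SET) g J); last first.
  rewrite big_imset /=; last by move=> k k' _ _; exact: inj1.
  by apply: eq_bigl => k; rewrite inE.
apply: eq_bigl => J; apply/andP/imsetP => [[J0 /cards1P[k ->]]|[k _ ->]]; first by exists k.
by rewrite cards1 eqxx -card_gt0 cards1.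
Qed.

Definition single (J : T) : bool := (#|J| <= 1)%N.

(** A jump set with at most one element is either empty, which means that the time is skipped, or a
    hole attached to the time: such words of jump sets are the marked subsequences summed by
    [msum]. *)
Lemma msum_single (eps : R) (G : seq (R * (T * T)) -> R) ts S S' :
  sumw (size ts) (fun Js => if all single Js && (jumps_ok S Js && (foldl jump_to S Js == S'))
     then eps ^+ (\sum_(J <- Js) #|J|) * G (jump_events S ts Js) else 0) =
  msum eps ts (fun e => if hole_path S S' (map fst e) then G (hole_events S e) else 0).
Proof.
elim: ts S G => [|t ts IHts] S G /=.
  by rewrite /hole_path /= big_nil expr0 mul1r.
rewrite sum_card_le1 => [|J J1]; last first.
  rewrite sumw_tuple big1 // => w _ /=.
  by rewrite /single leqNgt J1.
congr (_ + _).
  rewrite -IHts; apply: eq_sumw => Js _ /=.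
  by rewrite /single cards0 /= jump_ok0 jump_to0 big_cons cards0 add0n eqxx.
rewrite mulr_sumr; apply: eq_bigr => k _.
case: (boolP (free S k)) => fk; last first.
  rewrite [RHS](_ : _ = 0); last first.
    rewrite (eq_msum _ (H' := fun=> 0 * 0)) => [|s _]; first by rewrite msumZ mul0r mulr0.
    by rewrite /hole_path /= (negPf fk) mulr0.
  rewrite sumw_tuple big1 // => w _ /=.
  by rewrite jump_ok1 (negPf fk) /= andbF.
rewrite (eq_msum _ (H' := fun s => if hole_path (hop S k) S' (map fst s) then
   G ((t, ([set k]%SET, hop S k)) :: hole_events (hop S k) s) else 0)); last first.
  by move=> s _; rewrite /hole_path /= fk.
rewrite -(IHts (hop S k) (fun z => G ((t, ([set k]%SET, hop S k)) :: z))) -sumwZ.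
apply: eq_sumw => Js _; rewrite /= jump_ok1 fk (jump_to1 fk) /single cards1 /= big_cons cards1.
rewrite -cards_eq0 cards1 /=.
by case: ifP => _; rewrite ?mulr0 // exprD expr1 mulrA.
Qed.

End single_jumps.

Section evolution_limit.
Context {R : realType} {L : nat}.
Hypothesis L_gt1 : (1 < L)%N.
Local Notation T := {set 'I_L}.
Local Notation traj := (trajectory R L).
Implicit Types (S J : T) (Js : seq T) (F : traj -> R).

Lemma sumw_prod (A : finType) n (g : A -> R) :
  sumw n (fun w => \prod_(a <- w) g a) = (\sum_a g a) ^+ n.
Proof.
elim: n => [|n IHn] /=; first by rewrite big_nil.
rewrite exprS mulr_suml; apply: eq_bigr => a _; rewrite -IHn -sumwZ.
by apply: eq_sumw => w _; rewrite big_cons.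
Qed.

(** The difference comes from the words with at least one simultaneous jump. Forgetting the
    exclusion rule, their total weight factorises over the levels into a difference of M-th powers;
    as eps <= 1, the at most 2 ^ L sets with several holes weigh at most eps ^ 2 each. *)
Lemma evolution_msum_le F C (eps tau : R) M S S' : 0 < eps -> eps <= 1 ->
  (forall w, `|F w| <= C) ->
  `|\sum_(c : configuration L M | evolution S S' c) weight eps c * F (evolution_trajectory tau eps c) -
    msum eps [seq - (tau / 2) + eps * j%:R | j <- iota 0 M] (bridge S S' F)| <=
  C * ((1 + (L%:R * eps + (2 ^ L)%:R * eps ^+ 2)) ^+ M - (1 + L%:R * eps) ^+ M).
Proof.
move=> e0 e1 FC; have C0 : 0 <= C by exact: le_trans (FC point).
set ts := map _ _; have sts : size ts = M by rewrite size_map size_iota.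
have := msum_single L_gt1 eps (fun z => F (Trajectory S z)) ts S S'.
rewrite sts => H; rewrite /bridge -H sum_evolution -sumwN -sumwD.
pose g J : R := eps ^+ #|J|; pose g1 J : R := if single J then g J else 0.
have g_ge0 J : 0 <= g J by exact/exprn_ge0/ltW.
have eg Js : eps ^+ (\sum_(J <- Js) #|J|) = \prod_(J <- Js) g J by rewrite /g prodrXr.
have g1E Js : \prod_(J <- Js) g1 J = if all single Js then \prod_(J <- Js) g J else 0.
  elim: Js => [|J Js IHJs]; first by rewrite !big_nil.
  by rewrite !big_cons /= IHJs /g1; case: (single J); rewrite ?mul0r //=; case: ifP; rewrite ?mulr0.
have sg1 : \sum_J g1 J = 1 + L%:R * eps.
  rewrite sum_card_le1 // => [|J J1]; last by rewrite /g1 /single leqNgt J1.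
  rewrite /g1 /single cards0 /g cards0 expr0; congr (_ + _).
  under eq_bigr do rewrite cards1 expr1.
  by rewrite sumr_const card_ord mulr_natl.
have sg : \sum_J g J <= 1 + (L%:R * eps + (2 ^ L)%:R * eps ^+ 2).
  rewrite addrA -sg1 -lerBlDl -sumrB.
  apply: (@le_trans _ _ (\sum_(J : T) eps ^+ 2)).
    apply: ler_sum => J _; rewrite /g1; case: ifPn => sJ; first by rewrite subrr exprn_ge0 // ltW.
    rewrite subr0 /g; apply: ler_wiXn2l => //; first exact: ltW.
    by rewrite ltnNge.
  rewrite sumr_const.
  have -> : #|xpredT : pred T| = (2 ^ L)%N.
    rewrite -[L in RHS]card_ord -[#|'I_L|]cardsT -card_powerset; apply: eq_card => J.
    by rewrite !inE; apply/esym/fintype.subsetP => k _; rewrite inE.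
  by rewrite mulr_natl.
apply: (@le_trans _ _ (sumw M (fun Js => C * (\prod_(J <- Js) g J - \prod_(J <- Js) g1 J)))).
  rewrite !sumw_tuple (le_trans (ler_norm_sum _ _ _)) // ler_sum // => Js _.
  rewrite g1E; have P0 : 0 <= \prod_(J <- Js) g J by exact: prodr_ge0.
  case: (boolP (all single Js)) => aJ /=; first by rewrite /ts !subrr mulr0 normr0.
  rewrite !subr0; case: ifP => _; last by rewrite normr0 mulr_ge0.
  by rewrite eg normrM ger0_norm // mulrC ler_wpM2r.
rewrite sumwZ ler_wpM2l //.
have -> : sumw M (fun Js => \prod_(J <- Js) g J - \prod_(J <- Js) g1 J) =
    (\sum_J g J) ^+ M - (\sum_J g1 J) ^+ M by rewrite sumwD sumwN !sumw_prod.
rewrite sg1 lerD2r; apply: lerXn2r => //; rewrite nnegrE; first exact: sumr_ge0.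
by rewrite !addr_ge0 ?mulr_ge0 ?exprn_ge0 // ltW.
Qed.

Variable k0 : 'I_L.

(** Both powers in the bound of [evolution_msum_le] tend to exp (L tau), so only the sums over
    single jumps survive, to which [msum_cvg] applies. *)
Lemma evolution_sum_cvg F C (D : seq R) (tau : R) (eps : nat -> R) (M : nat -> nat) S S' :
  0 < tau -> (forall i, 0 < eps i) -> eps i @[i --> \oo] --> 0 ->
  eps i * (M i)%:R @[i --> \oo] --> tau ->
  (forall w, `|F w| <= C) -> cont_off D (bridge S S' F) -> mark_measurable k0 (bridge S S' F) ->
  \sum_(c : configuration L (M i) | evolution S S' c)
     weight (eps i) c * F (evolution_trajectory tau (eps i) c) @[i --> \oo] -->
  mlim k0 (- (tau / 2)) tau (bridge S S' F).
Proof.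
move=> tau0 e0 ec Mc FC Fc Fm.
have Mc' : (M i)%:R * eps i @[i --> \oo] --> tau by under eq_fun do rewrite mulrC.
have cc : (fun=> - (tau / 2)) @ \oo --> - (tau / 2) by exact: cvg_cst.
have [_ h1] := msum_cvg tau0 (bridge_le S S' FC) Fc Fm e0 ec Mc cc.
have Lc (c : R) : (M i)%:R * (c * eps i) @[i --> \oo] --> c * tau.
  by under eq_fun do rewrite mulrCA; exact: cvgMr.
have p1 : (1 + L%:R * eps i) ^+ M i @[i --> \oo] --> expR (L%:R * tau).
  apply: cvg_exp1x => //.
  - by move=> i; rewrite mulr_ge0 // ltW.
  - by rewrite -[X in _ --> X](mulr0 L%:R); exact: cvgMr.
have p2 : (1 + (L%:R * eps i + (2 ^ L)%:R * eps i ^+ 2)) ^+ M i @[i --> \oo] --> expR (L%:R * tau).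
  apply: (cvg_exp1x (x_ := fun i => L%:R * eps i + (2 ^ L)%:R * eps i ^+ 2)).
  - by move=> i; rewrite addr_ge0 ?mulr_ge0 ?exprn_ge0 // ltW.
  - rewrite -[X in _ --> X]addr0; apply: cvgD.
      by rewrite -[X in _ --> X](mulr0 L%:R); exact: cvgMr.
    rewrite -[X in _ --> X](mulr0 (2 ^ L)%:R); apply: cvgMr.
    by rewrite -[X in _ --> X](mulr0 0); under eq_fun do rewrite expr2; exact: cvgM.
  - rewrite -[X in _ --> X]addr0; under eq_fun do rewrite mulrDr; apply: cvgD; first exact: Lc.
    rewrite -[X in _ --> X](mulr0 ((2 ^ L)%:R * tau)).
    rewrite (_ : (fun i => _) = (fun i => (M i)%:R * ((2 ^ L)%:R * eps i) * eps i)).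
      exact: (cvgM (Lc (2 ^ L)%:R) ec).
    by apply/funext => i; rewrite expr2 !mulrA.
have err : C * ((1 + (L%:R * eps i + (2 ^ L)%:R * eps i ^+ 2)) ^+ M i - (1 + L%:R * eps i) ^+ M i)
    @[i --> \oo] --> 0.
  have E : C * (expR (L%:R * tau) - expR (L%:R * tau)) = 0 by rewrite subrr mulr0.
  by rewrite -[X in _ --> X]E; apply: cvgMr; exact: cvgB.
pose sig i := \sum_(c : configuration L (M i) | evolution S S' c)
     weight (eps i) c * F (evolution_trajectory tau (eps i) c).
have d0 : sig i - msum (eps i) [seq - (tau / 2) + eps i * j%:R | j <- iota 0 (M i)] (bridge S S' F)
    @[i --> \oo] --> 0.
  have c0 : (fun=> 0 : R) @ \oo --> (0 : R) by exact: cvg_cst.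
  apply: norm_cvg0; apply: (squeeze_cvgr _ c0 err); near=> i.
  rewrite normr_ge0 /=; apply: evolution_msum_le => //.
  by near: i; apply: (cvgr_le _ ec).
rewrite -[X in _ --> X]add0r (_ : (fun i => _) = (fun i => (sig i - msum (eps i)
  [seq - (tau / 2) + eps i * j%:R | j <- iota 0 (M i)] (bridge S S' F)) +
  msum (eps i) [seq - (tau / 2) + eps i * j%:R | j <- iota 0 (M i)] (bridge S S' F))).
  exact: cvgD.
by apply/funext => i; rewrite subrK.
Unshelve. all: by end_near.
Qed.

Lemma evolution_mean_cvg (f : traj -> R) (a b tau : R) (M : R -> nat) S S' :
  0 < tau -> continuous f -> (exists C : R, forall w, `|f w| <= C) ->
  eps * (M eps)%:R @[eps --> 0^'+] --> tau ->
  mlim k0 (- (tau / 2)) tau (bridge S S' (fun=> 1)) != 0 ->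
  evolution_mean eps S S' (fun c : configuration L (M eps) =>
     f (window a b (evolution_trajectory tau eps c))) @[eps --> 0^'+] -->
  mlim k0 (- (tau / 2)) tau (bridge S S' (fun w => f (window a b w))) /
  mlim k0 (- (tau / 2)) tau (bridge S S' (fun=> 1)).
Proof.
move=> tau0 cf [C fC] Mc Z0; apply/cvg_at_rightP => eps [e0 ec].
have Mc' : eps i * (M (eps i))%:R @[i --> \oo] --> tau.
  by move/cvg_at_rightP : Mc => /(_ eps (conj e0 ec)).
have h1 := evolution_sum_cvg tau0 e0 ec Mc' (fun w => fC (window a b w))
  (@cont_off_bridge_window _ _ S S' f a b cf) (mark_measurable_bridge k0 S S' (@measurable_fun_window R L f a b cf)).
have h2 := evolution_sum_cvg tau0 e0 ec Mc' (@norm1_le1 _ _) (@cont_off_bridge1 _ _ S S')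
  (@mark_measurable_bridge1 _ _ k0 S S').
rewrite /evolution_mean; refine (cvgM h1 _); refine (cvgV Z0 _).
move: h2; suff -> : (fun i => \sum_(c : configuration L (M (eps i)) | evolution S S' c)
    weight (eps i) c * 1) = (fun i => \sum_(c : configuration L (M (eps i)) | evolution S S' c)
    weight (eps i) c) by [].
by apply/funext => i; apply: eq_bigr => c _; rewrite mulr1.
Qed.

End evolution_limit.

Lemma seq_cvg_unique (R : realType) (u : nat -> R) (x y : R) :
  u @ \oo --> x -> u @ \oo --> y -> x = y.
Proof. exact: cvg_unique. Qed.

Lemma seq_cvg_ge (R : realType) (u : nat -> R) (x y : R) :
  u @ \oo --> y -> (forall i, x <= u i) -> x <= y.
Proof.
move=> uy xu; have c : (fun=> x) @ \oo --> x by exact: cvg_cst.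
by apply: (ler_cvg_to c uy); exact: nearW.
Qed.

(** * The limit of long time *)

Section propagator.
Context {R : realType} {L : nat}.
Hypothesis L_gt1 : (1 < L)%N.
Variable k0 : 'I_L.
Local Notation T := {set 'I_L}.
Local Notation traj := (trajectory R L).
Implicit Types (S U V : T) (e s t : R) (F : traj -> R).

(** The entry (S, S') of the matrix (1 + e A) ^ n, where A is the transition matrix of the graph. *)
Fixpoint walk e n S S' : R :=
  if n is n'.+1 then walk e n' S S' + e * \sum_(k | free S k) walk e n' (hop S k) S'
  else (S == S')%:R.

Lemma msum_bridge1 e ts S S' : msum e ts (bridge S S' (fun=> 1)) = walk e (size ts) S S'.
Proof.
elim: ts S => [|t ts IHts] S /=; first by rewrite /bridge /hole_path /=; case: eqP.
rewrite IHts; congr (_ + _ * _); rewrite [RHS]big_mkcond; apply: eq_bigr => k _.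
case: ifPn => fk; first by rewrite -IHts; apply: eq_msum => s _; rewrite /bridge /hole_path /= fk.
rewrite (eq_msum _ (H' := fun=> 0 * 0)) => [|s _]; first by rewrite msumZ mul0r.
by rewrite /bridge /hole_path /= (negPf fk) mul0r.
Qed.

Lemma walk_cat e m n S S' : walk e (m + n) S S' = \sum_U walk e m S U * walk e n U S'.
Proof.
elim: m S => [|m IHm] S.
  rewrite add0n (bigD1 S) //= eqxx mul1r big1 ?addr0 // => U /negPf.
  by rewrite eq_sym => ->; rewrite mul0r.
rewrite addSn /= IHm; under eq_bigr do rewrite IHm.
under [RHS]eq_bigr do rewrite mulrDl.
rewrite big_split /=; congr (_ + _); rewrite exchange_big mulr_sumr /=; apply: eq_bigr => U _.
by rewrite -mulr_suml mulrA.
Qed.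

Lemma walk1 e S S' : walk e 1 S S' = (S == S')%:R + e * (step S S')%:R.
Proof.
rewrite /=; congr (_ + _ * _); rewrite -(sum_step S (fun U => (U == S')%:R : R)).
rewrite big_mkcond (bigD1 S') //= eqxx big1 ?addr0; first by case: (step S S').
by move=> U /negPf ->; case: ifP.
Qed.

Lemma walk_psi_r e n S : \sum_S' walk e n S S' * psi S' = (1 + e * lam R L #|S|) ^+ n * psi S.
Proof.
elim: n S => [|n IHn] S /=.
  rewrite (bigD1 S) //= eqxx expr0 !mul1r big1 ?addr0 // => U /negPf.
  by rewrite eq_sym => ->; rewrite mul0r.
under eq_bigr do rewrite mulrDl.
rewrite big_split /= IHn exprS -mulrA mulrDl mul1r; congr (_ + _).
under eq_bigr do rewrite -mulrA mulr_suml.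
rewrite -mulr_sumr -mulrA exchange_big /=; congr (_ * _).
rewrite mulrCA -psi_right // sum_step mulr_sumr; apply: eq_bigr => k fk.
by rewrite IHn card_hop.
Qed.

Lemma walk_psi_l e n S' : \sum_S psi S * walk e n S S' = (1 + e * lam R L #|S'|) ^+ n * psi S'.
Proof.
elim: n S' => [|n IHn] S'.
  rewrite (bigD1 S') //= eqxx expr0 mulr1 mul1r big1 ?addr0 // => U /negPf ->.
  by rewrite mulr0.
under eq_bigr do rewrite -addn1 walk_cat mulr_sumr.
rewrite exchange_big /=.
have E U : \sum_S psi S * (walk e n S U * walk e 1 U S') =
    (1 + e * lam R L #|U|) ^+ n * psi U * ((U == S')%:R + e * (step U S')%:R).
  by rewrite -walk1 -IHn mulr_suml; apply: eq_bigr => S _; rewrite mulrA.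
under eq_bigr do rewrite E mulrDr.
rewrite big_split /= exprSr -mulrA mulrDl mul1r mulrDr; congr (_ + _).
  rewrite (bigD1 S') //= eqxx mulr1 big1 ?addr0 // => U /negPf ->.
  by rewrite mulr0.
rewrite -mulrA -psi_left // !mulr_sumr [RHS]big_mkcond; apply: eq_bigr => U _.
by case: ifP => [/card_step ->|_]; rewrite ?mulr0 // mulr1 mulrAC -!mulrA.
Qed.

Lemma walk_ge0 e n S S' : 0 <= e -> 0 <= walk e n S S'.
Proof.
move=> e0; elim: n S => [|n IHn] S /=; first exact: ler0n.
by rewrite addr_ge0 // mulr_ge0 // sumr_ge0 // => k _.
Qed.

Lemma walk_diag e n S : 0 <= e -> 1 <= walk e n S S.
Proof.
move=> e0; elim: n => [|n IHn] /=; first by rewrite eqxx.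
by rewrite (le_trans IHn) // lerDl mulr_ge0 // sumr_ge0 // => k _; exact: walk_ge0.
Qed.

Lemma walk_step e n S S' : 0 <= e -> step S S' -> e * n%:R <= walk e n S S'.
Proof.
move=> e0 /stepP[k fk ->]; elim: n => [|n IHn]; first by rewrite mulr0; exact: walk_ge0.
rewrite /= -natr1 mulrDr mulr1 lerD // ler_peMr // (bigD1 k) //=.
apply: (le_trans (y := walk e n (hop S k) (hop S k))); first exact: walk_diag.
by rewrite lerDl sumr_ge0 // => *; exact: walk_ge0.
Qed.

Lemma walk_card e n S S' : #|S| != #|S'| -> walk e n S S' = 0.
Proof.
elim: n S => [|n IHn] S SS' /=; first by case: (eqVneq S S') SS' => [->|//]; rewrite eqxx.
rewrite IHn // add0r big1 ?mulr0 // => k fk; apply: IHn.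
by rewrite card_hop.
Qed.

Definition prop t S S' : R := mlim k0 0 t (bridge S S' (fun=> 1)).

Section limits.
Variables (e_ : nat -> R) (M : nat -> nat) (t : R).
Hypothesis t_gt0 : 0 < t.
Hypothesis e_gt0 : forall i, 0 < e_ i.
Hypothesis e_cvg : e_ i @[i --> \oo] --> 0.
Hypothesis M_cvg : e_ i * (M i)%:R @[i --> \oo] --> t.

Lemma walk_cvg S S' : walk (e_ i) (M i) S S' @[i --> \oo] --> prop t S S'.
Proof.
have c0 : (fun=> 0 : R) @ \oo --> (0 : R) by exact: cvg_cst.
have [_] := msum_cvg t_gt0 (bridge_le S S' (@norm1_le1 R L)) (@cont_off_bridge1 R L S S')
  (@mark_measurable_bridge1 R L k0 S S') e_gt0 e_cvg M_cvg c0.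
by under eq_fun do rewrite msum_bridge1 size_map size_iota.
Qed.

(** The constant functional does not see the values of the times, hence not the origin of the
    grid. *)
Lemma mlim_bridge1 c S S' : mlim k0 c t (bridge S S' (fun=> 1)) = prop t S S'.
Proof.
have c0 : (fun=> c : R) @ \oo --> (c : R) by exact: cvg_cst.
have [_ h] := msum_cvg t_gt0 (bridge_le S S' (@norm1_le1 R L)) (@cont_off_bridge1 R L S S')
  (@mark_measurable_bridge1 R L k0 S S') e_gt0 e_cvg M_cvg c0.
apply: (seq_cvg_unique h).
rewrite (_ : (fun i => _) = (fun i => walk (e_ i) (M i) S S')); first exact: walk_cvg.
by apply/funext => i; rewrite msum_bridge1 size_map size_iota.
Qed.

Lemma expR_lam_cvg (l : R) : 0 <= l -> (1 + e_ i * l) ^+ M i @[i --> \oo] --> expR (l * t).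
Proof.
move=> l0; apply: cvg_exp1x; first by move=> i; rewrite mulr_ge0 // ltW.
  by rewrite -[X in _ --> X](mul0r l); apply: cvgMl.
under eq_fun do rewrite mulrA [(M _)%:R * _]mulrC.
by rewrite mulrC; apply: cvgMl.
Qed.

End limits.

Definition mesh (i : nat) : R := i.+1%:R^-1.
(** Less than one mesh is lost in the integer part. For two durations the sizes are added, not
    recomputed, so that the grid sums compose exactly by [walk_cat] in the proof of [propD]. *)
Definition mesh_size t (i : nat) : nat := Num.truncn (t * i.+1%:R).

Lemma mesh_gt0 i : 0 < mesh i. Proof. by rewrite invr_gt0. Qed.

Lemma mesh_cvg : mesh i @[i --> \oo] --> 0. Proof. exact: cvg_harmonic. Qed.

Lemma mesh_size_cvg t : 0 <= t -> mesh i * (mesh_size t i)%:R @[i --> \oo] --> t.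
Proof.
move=> t0.
have l : t - mesh i @[i --> \oo] --> t.
  by rewrite -[X in _ --> X]subr0; apply: cvgB; [exact: cvg_cst|exact: mesh_cvg].
have u : (fun=> t) @ \oo --> t by exact: cvg_cst.
apply: (squeeze_cvgr _ l u); apply: nearW => i; rewrite /mesh /mesh_size.
have i0 : 0 < i.+1%:R :> R by [].
have /andP[h1 h2] := truncn_itv (mulr_ge0 t0 (ltW i0)).
rewrite mulrC ler_pdivrMr // h1 andbT ler_pdivlMr // mulrBl mulVf ?lt0r_neq0 //.
by rewrite lerBlDr natr1 ltW.
Qed.

Lemma mesh_sizeD_cvg s t : 0 <= s -> 0 <= t ->
  mesh i * (mesh_size s i + mesh_size t i)%:R @[i --> \oo] --> s + t.
Proof.
move=> s0 t0; under eq_fun do rewrite natrD mulrDr.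
by apply: cvgD; exact: mesh_size_cvg.
Qed.

Lemma mesh_walk_cvg t S S' : 0 < t -> walk (mesh i) (mesh_size t i) S S' @[i --> \oo] --> prop t S S'.
Proof. by move=> t0; apply: walk_cvg => //; [exact: mesh_gt0|exact: mesh_cvg|exact/mesh_size_cvg/ltW]. Qed.

Lemma propD s t S S' : 0 < s -> 0 < t -> prop (s + t) S S' = \sum_U prop s S U * prop t U S'.
Proof.
move=> s0 t0.
have h := @walk_cvg mesh (fun i => mesh_size s i + mesh_size t i)%N (s + t) (addr_gt0 s0 t0)
  mesh_gt0 mesh_cvg (mesh_sizeD_cvg (ltW s0) (ltW t0)) S S'.
apply/esym; apply: (seq_cvg_unique _ h); under eq_fun do rewrite walk_cat.
by apply: cvg_big_sum => U _; apply: cvgM; exact: mesh_walk_cvg.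
Qed.

Lemma prop_ge0 t S S' : 0 < t -> 0 <= prop t S S'.
Proof.
move=> t0; apply: (seq_cvg_ge (@mesh_walk_cvg t S S' t0)) => i.
exact/walk_ge0/ltW/mesh_gt0.
Qed.

Lemma prop_diag t S : 0 < t -> 1 <= prop t S S.
Proof.
move=> t0; apply: (seq_cvg_ge (@mesh_walk_cvg t S S t0)) => i.
exact/walk_diag/ltW/mesh_gt0.
Qed.

Lemma prop_step t S S' : 0 < t -> step S S' -> t <= prop t S S'.
Proof.
move=> t0 SS'; apply: (ler_cvg_to (mesh_size_cvg (ltW t0)) (@mesh_walk_cvg t S S' t0)); apply: nearW => i.
by apply: walk_step => //; exact/ltW/mesh_gt0.
Qed.

Lemma prop_card t S S' : 0 < t -> #|S| != #|S'| -> prop t S S' = 0.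
Proof.
move=> t0 SS'; apply: (seq_cvg_unique (@mesh_walk_cvg t S S' t0)).
by under eq_fun do rewrite walk_card //; exact: cvg_cst.
Qed.

(** Along a path of the graph, half of the remaining time is given to the next step and half to the
    rest of the path; [prop_step] and [prop_diag] bound the factors from below. *)
Lemma prop_gt0 t S S' : 0 < t -> #|S| = #|S'| -> 0 < prop t S S'.
Proof.
move=> t0 /(connect_step L_gt1 R)/connectP[p pp ->]; elim: p S t t0 pp => [|U p IHp] S t t0 /=.
  by move=> _; exact: lt_le_trans (prop_diag S t0).
move=> /andP[SU pp]; have t2 : 0 < t / 2 by rewrite divr_gt0.
rewrite [t]splitr propD // (bigD1 U) //= ltr_wpDr //.
  by apply: sumr_ge0 => V _; rewrite mulr_ge0 // prop_ge0.
exact: mulr_gt0 (lt_le_trans t2 (prop_step t2 SU)) (IHp U _ t2 pp).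
Qed.

Section spectral.
Variable N : nat.
Hypothesis N_range : (0 < N < L)%N.
Local Notation l := (lam R L N).
Local Notation nrm := (@psi_norm R L N).
Let l_ge0 : 0 <= l. Proof. exact/ltW/lam_gt0. Qed.
Let nrm_gt0 : 0 < nrm. Proof. exact: psi_norm_gt0. Qed.
Let nrm_neq0 : nrm != 0. Proof. exact: lt0r_neq0. Qed.

Let eprop t S S' : R := expR (- (l * t)) * prop t S S'.

Let eprop_ge0 t S S' : 0 < t -> 0 <= eprop t S S'.
Proof. by move=> t0; rewrite mulr_ge0 ?expR_ge0 // prop_ge0. Qed.

Let eprop_psi_r t S : 0 < t -> #|S| = N -> \sum_U eprop t S U * psi U = psi S.
Proof.
move=> t0 SN; under eq_bigr do rewrite -mulrA.
rewrite -mulr_sumr; suff -> : \sum_U prop t S U * psi U = expR (l * t) * psi S.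
  by rewrite mulrA -expRD addNr expR0 mul1r.
have h : (1 + mesh i * l) ^+ mesh_size t i * psi S @[i --> \oo] --> expR (l * t) * psi S.
  apply: cvgMl; apply: expR_lam_cvg => //; [exact: mesh_gt0|exact: mesh_cvg|exact/mesh_size_cvg/ltW].
apply: (seq_cvg_unique _ h).
rewrite (_ : (fun i => _) = fun i => \sum_U walk (mesh i) (mesh_size t i) S U * psi U).
  by apply: cvg_big_sum => U _; apply: cvgMl; exact: mesh_walk_cvg.
by apply/funext => i; rewrite walk_psi_r SN.
Qed.

Let eprop_psi_l t S : 0 < t -> #|S| = N -> \sum_U psi U * eprop t U S = psi S.
Proof.
move=> t0 SN; under eq_bigr do rewrite mulrCA.
rewrite -mulr_sumr; suff -> : \sum_U psi U * prop t U S = expR (l * t) * psi S.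
  by rewrite mulrA -expRD addNr expR0 mul1r.
have h : (1 + mesh i * l) ^+ mesh_size t i * psi S @[i --> \oo] --> expR (l * t) * psi S.
  apply: cvgMl; apply: expR_lam_cvg => //; [exact: mesh_gt0|exact: mesh_cvg|exact/mesh_size_cvg/ltW].
apply: (seq_cvg_unique _ h).
rewrite (_ : (fun i => _) = fun i => \sum_U psi U * walk (mesh i) (mesh_size t i) U S).
  by apply: cvg_big_sum => U _; apply: cvgMr; exact: mesh_walk_cvg.
by apply/funext => i; rewrite walk_psi_l SN.
Qed.

Let epropD s t S S' : 0 < s -> 0 < t ->
  eprop (s + t) S S' = \sum_U eprop s S U * eprop t U S'.
Proof.
move=> s0 t0; rewrite /eprop propD // mulrDr opprD expRD mulr_sumr; apply: eq_bigr => U _.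
by rewrite mulrACA.
Qed.

Let gap t S S' : R := eprop t S S' - psi S * psi S' / nrm.

Lemma finite_lower_bound (I : finType) (P : pred I) (f : I -> R) : (forall i, P i -> 0 < f i) ->
  exists2 d, 0 < d & forall i, P i -> d <= f i.
Proof.
(* The inverse of 1 plus the sum of the inverses is a lower bound, with no need for a minimum over a
   possibly empty set. *)
move=> f0; pose A := 1 + \sum_(i | P i) (f i)^-1.
have A0 : 0 < A by rewrite ltr_wpDr // sumr_ge0 // => i /f0 fi; rewrite invr_ge0 ltW.
exists A^-1 => [|i Pi]; first by rewrite invr_gt0.
rewrite -[f i]invrK lef_pV2 ?posrE ?invr_gt0 ?f0 // /A (bigD1 i) //= addrCA lerDl addr_ge0 //.
by apply: sumr_ge0 => j /andP[/f0 fj _]; rewrite invr_ge0 ltW.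
Qed.

Let sum_psi_sqr : \sum_(U : T | #|U| == N) psi U * psi U = nrm.
Proof. by apply: eq_bigr => U _; rewrite expr2. Qed.

Let epropN t S : 0 < t -> #|S| = N -> forall g : T -> R,
  \sum_(U : T | #|U| == N) eprop t S U * g U = \sum_U eprop t S U * g U.
Proof.
move=> t0 SN g; rewrite big_mkcond; apply: eq_bigr => U _; case: ifPn => // UN.
by rewrite /eprop prop_card ?mulr0 ?mul0r // SN eq_sym.
Qed.

Let epropNl t S : 0 < t -> #|S| = N -> forall g : T -> R,
  \sum_(U : T | #|U| == N) g U * eprop t U S = \sum_U g U * eprop t U S.
Proof.
move=> t0 SN g; rewrite big_mkcond; apply: eq_bigr => U _; case: ifPn => // UN.
by rewrite /eprop prop_card ?mulr0 // SN.
Qed.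

(* Doeblin: after time 1 the normalised kernel dominates a multiple of the
   projection on psi. *)
Let gap_contract : exists2 r, 0 <= r < 1 & forall S' B t, #|S'| = N -> 0 < t ->
  (forall S, #|S| = N -> `|gap t S S'| <= B * psi S) ->
  forall S, #|S| = N -> `|gap (1 + t) S S'| <= r * B * psi S.
Proof.
have [d0 d0_gt0 d0P] : exists2 d, 0 < d & forall p : T * T, (#|p.1| == N) && (#|p.2| == N) ->
    d <= eprop 1 p.1 p.2 / (psi p.1 * psi p.2).
  apply: finite_lower_bound => -[S U] /= /andP[/eqP SN /eqP UN].
  by rewrite divr_gt0 ?mulr_gt0 ?expR_gt0 ?psi_gt0 // prop_gt0 // SN.
(* The minimum with [nrm^-1] ensures d * nrm <= 1, so that the contraction factor 1 - d * nrm is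
   nonnegative. *)
pose d := Num.min d0 nrm^-1.
have d_gt0 : 0 < d by rewrite lt_min d0_gt0 invr_gt0.
have dnrm : d * nrm <= 1 by rewrite -ler_pdivlMr // div1r ge_min lexx orbT.
have dP S U : #|S| = N -> #|U| = N -> d * (psi S * psi U) <= eprop 1 S U.
  move=> SN UN; rewrite -ler_pdivlMr ?mulr_gt0 ?psi_gt0 //.
  by rewrite (le_trans _ (d0P (S, U) _)) ?ge_min ?lexx //= SN UN eqxx.
exists (1 - d * nrm); first by rewrite subr_ge0 dnrm /= gtrDl oppr_lt0 mulr_gt0.
move=> S' B t S'N t0 gB S SN.
(* The gap is orthogonal to psi, so subtracting d psi S psi U from the kernel does not change its
   action on the gap. What is left is a nonnegative kernel that multiplies psi by 1 - d * nrm. *)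
have gap0 : \sum_(U : T | #|U| == N) psi U * gap t U S' = 0.
  rewrite /gap; under eq_bigr do rewrite mulrBr.
  rewrite sumrB epropNl // eprop_psi_l //.
  under [X in _ - X]eq_bigr do rewrite !mulrA.
  by rewrite -!mulr_suml sum_psi_sqr mulrAC divff // mul1r subrr.
have -> : gap (1 + t) S S' =
    \sum_(U : T | #|U| == N) (eprop 1 S U - d * (psi S * psi U)) * gap t U S'.
  under eq_bigr do rewrite mulrBl.
  rewrite sumrB [X in _ - X](_ : _ = d * psi S * \sum_(U : T | #|U| == N) psi U * gap t U S'); last first.
    by rewrite mulr_sumr; apply: eq_bigr => U _; rewrite !mulrA.
  rewrite gap0 mulr0 subr0 /gap; under eq_bigr do rewrite mulrBr.
  rewrite sumrB epropN // -epropD //; congr (_ - _).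
  under eq_bigr do rewrite !mulrA.
  by rewrite -!mulr_suml epropN // eprop_psi_r.
rewrite (le_trans (ler_norm_sum _ _ _)) //.
apply: (@le_trans _ _ (\sum_(U : T | #|U| == N) (eprop 1 S U - d * (psi S * psi U)) * (B * psi U))).
  apply: ler_sum => U /eqP UN; rewrite normrM ger0_norm ?subr_ge0 ?dP //.
  by rewrite ler_wpM2l ?subr_ge0 ?dP // gB.
rewrite (eq_bigr (fun U => B * (eprop 1 S U * psi U) - B * d * psi S * (psi U * psi U))); last first.
  by move=> U _; ring.
rewrite sumrB -!mulr_sumr sum_psi_sqr epropN // eprop_psi_r //.
by rewrite le_eqVlt; apply/orP; left; apply/eqP; ring.
Qed.

(** Each unit of time contracts the gap by [r], starting from a bound valid at all positive times; a
    real t > n is n plus a positive remainder, so no continuity in t is needed. *)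
Lemma eprop_cvg S S' : #|S| = N -> #|S'| = N ->
  expR (- (l * t)) * prop t S S' @[t --> +oo] --> psi S * psi S' / nrm.
Proof.
move=> SN S'N; have [r /andP[r0 r1] rP] := gap_contract.
(* The first summand comes from eprop t S S' psi S' <= psi S, one term of the identity
   [eprop_psi_r]; the second bounds the rank-one part. *)
pose B : R := (psi S')^-1 + psi S' / nrm.
have B0 : forall t, 0 < t -> forall S, #|S| = N -> `|gap t S S'| <= B * psi S.
  move=> t t0 U UN; rewrite (le_trans (ler_normB _ _)) // mulrDl; apply: lerD.
    rewrite ger0_norm ?eprop_ge0 // mulrC ler_pdivlMr ?psi_gt0 // -[leRHS](eprop_psi_r t0 UN).
    rewrite (bigD1 S') //= lerDl sumr_ge0 // => V _.
    by rewrite mulr_ge0 ?eprop_ge0 // ltW // psi_gt0.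
  have p0 V : 0 <= psi V :> R by exact/ltW/psi_gt0.
  by rewrite -mulrA mulrC ger0_norm //; exact: mulr_ge0 (divr_ge0 (p0 _) (ltW nrm_gt0)) (p0 _).
have Bn n : forall t, 0 < t -> forall S, #|S| = N -> `|gap (n%:R + t) S S'| <= r ^+ n * B * psi S.
  elim: n => [|n IHn] t t0 U UN; first by rewrite add0r expr0 mul1r; exact: B0.
  rewrite -nat1r -addrA exprS -[r * _ * _]mulrA.
  by apply: rP => //; [rewrite ltr_wpDl|exact: IHn].
apply/cvgrPdist_lt => e e0.
have rc : r ^+ n * B * psi S @[n --> \oo] --> 0.
  rewrite -[X in _ --> X](mul0r (B * psi S)); under eq_fun do rewrite -mulrA.
  by apply: cvgMl; apply: cvg_expr; rewrite ger0_norm.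
have [n _ /(_ n (leqnn n)) /=] := (cvgrPdist_lt _ _).1 rc e e0.
rewrite sub0r normrN => ne; near=> t.
have nt : n%:R < t by near: t; exact: nbhs_pinfty_gt.
rewrite distrC (le_lt_trans _ ne) // (le_trans _ (ler_norm _)) //.
have := Bn n (t - n%:R); rewrite subr_gt0 addrC subrK; exact.
Unshelve. all: by end_near.
Qed.

End spectral.

End propagator.

(** * Cutting at the ends of the window *)

Section window_factorization.
Context {R : realType} {L : nat}.
Hypothesis L_gt1 : (1 < L)%N.
Variable k0 : 'I_L.
Local Notation T := {set 'I_L}.
Local Notation traj := (trajectory R L).
Implicit Types (S U V : T) (e t : R) (F : traj -> R).

Lemma legal_cat S (ks1 ks2 : seq 'I_L) :
  legal S (ks1 ++ ks2) = legal S ks1 && legal (foldl (@hop L) S ks1) ks2.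
Proof. by elim: ks1 S => //= k ks1 IH S; rewrite IH andbA. Qed.

Lemma hole_events_cat S (e1 e2 : seq ('I_L * R)) :
  hole_events S (e1 ++ e2) = hole_events S e1 ++ hole_events (foldl (@hop L) S (map fst e1)) e2.
Proof. by elim: e1 S => //= x e1 IH S; rewrite IH. Qed.

Lemma last_hole_events S (e1 : seq ('I_L * R)) :
  last S [seq x.2.2 | x <- hole_events S e1] = foldl (@hop L) S (map fst e1).
Proof. by elim: e1 S => //= x e1 IH S; rewrite IH. Qed.

Lemma hole_events_all S (e1 : seq ('I_L * R)) (P : pred R) :
  all (fun x => P x.1) (hole_events S e1) = all P (map snd e1).
Proof. by elim: e1 S => //= x e1 IH S; rewrite IH. Qed.

Lemma window_hole_events S (a b : R) (s1 s2 s3 : seq ('I_L * R)) :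
  {in map snd s1, forall t, t < a} -> {in map snd s2, forall t, a <= t <= b} ->
  {in map snd s3, forall t, b < t} -> a <= b ->
  window a b (Trajectory S (hole_events S (s1 ++ (s2 ++ s3)))) =
  let U := foldl (@hop L) S (map fst s1) in Trajectory U (hole_events U s2).
Proof.
move=> h1 h2 h3 ab; rewrite /window /= !hole_events_cat !filter_cat.
set U := foldl _ S _; set V := foldl _ U _.
have f1 (e : seq ('I_L * R)) S0 (P : pred R) : {in map snd e, forall t, P t} ->
    [seq x <- hole_events S0 e | P x.1] = hole_events S0 e.
  move=> H; apply/all_filterP; rewrite (hole_events_all S0 e P); exact/allP.
have f0 (e : seq ('I_L * R)) S0 (P : pred R) : {in map snd e, forall t, ~~ P t} ->
    [seq x <- hole_events S0 e | P x.1] = [::].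
  move=> H; rewrite (eq_filter (a2 := predC (fun x => ~~ P x.1))) => [|x]; last by rewrite /= negbK.
  apply/eqP; rewrite -[_ == _]negbK -has_filter -all_predC.
  rewrite (eq_all (a2 := fun x => ~~ P x.1)) ?(hole_events_all S0 e (fun t => ~~ P t)); last first.
    by move=> x; rewrite /= negbK.
  by rewrite (introT allP H).
rewrite (f1 s1 S (fun t => t < a)) // (f0 s2 U (fun t => t < a)); last first.
  by move=> t /h2 /andP[at_ _]; rewrite -leNgt.
rewrite (f0 s3 V (fun t => t < a)); last first.
  by move=> t /h3 bt; rewrite -leNgt (le_trans ab) // ltW.
rewrite (f0 s1 S (fun t => a <= t <= b)); last by move=> t /h1 ta; rewrite leNgt ta.
rewrite (f1 s2 U (fun t => a <= t <= b)) // (f0 s3 V (fun t => a <= t <= b)); last first.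
  by move=> t /h3 bt; rewrite [t <= b]leNgt bt andbF.
by rewrite !cats0 /= last_hole_events.
Qed.

(** Only one pair (U, V) contributes, namely the states reached when the window opens and when it
    closes. The double sum serves to separate the three stretches of time, each with its own
    functional. *)
Lemma bridge_window S S' F (a b : R) (s1 s2 s3 : seq ('I_L * R)) :
  {in map snd s1, forall t, t < a} -> {in map snd s2, forall t, a <= t <= b} ->
  {in map snd s3, forall t, b < t} -> a <= b ->
  bridge S S' (fun w => F (window a b w)) (s1 ++ (s2 ++ s3)) =
  \sum_U \sum_V bridge S U (fun=> 1) s1 * (bridge V S' (fun=> 1) s3 * bridge U V F s2).
Proof.
move=> h1 h2 h3 ab; set U0 := foldl (@hop L) S (map fst s1).
set V0 := foldl (@hop L) U0 (map fst s2).
rewrite (bigD1 U0) //= [X in _ + X]big1 ?addr0 => [|U /negPf UU0]; last first.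
  by rewrite big1 // => V _; rewrite {1}/bridge /hole_path eq_sym UU0 andbF mul0r.
rewrite (bigD1 V0) //= [X in _ + X]big1 ?addr0 => [|V /negPf VV0]; last first.
  by rewrite {3}/bridge /hole_path eq_sym VV0 andbF !mulr0.
rewrite /bridge /hole_path !map_cat !legal_cat !foldl_cat -/U0 -/V0 !eqxx !andbT.
rewrite window_hole_events //= -/U0.
by case: (legal S _); case: (legal U0 _); case: (legal V0 _);
  rewrite /= ?mul0r ?mulr0 ?mul1r //; case: (_ == _); rewrite ?mul1r ?mul0r.
Qed.

Variables (F : traj -> R) (C a b : R).
Hypothesis ab : a < b.
Hypothesis F_le : forall w, `|F w| <= C.
Hypothesis F_cont : continuous F.

Let F_meas : measurable_fun setT (F : borel_trajectory R L -> R).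
Proof. exact: continuous_measurable_trajectory. Qed.

Let kern U V : R := mlim k0 a (b - a) (bridge U V F).

Lemma mlim_window t1 t3 S S' : 0 < t1 -> 0 < t3 ->
  mlim k0 (a - t1) (t1 + (b - a) + t3) (bridge S S' (fun w => F (window a b w))) =
  \sum_U \sum_V prop k0 t1 S U * (prop k0 t3 V S' * kern U V).
Proof.
move=> t1_gt0 t3_gt0; pose t2 := b - a; have t2_gt0 : 0 < t2 by rewrite subr_gt0.
(* The grid, started at [c i], passes exactly through a. The middle stretch has one point more than
   [mesh_size t2], because both a and the last grid point up to b belong to the closed window. *)
pose e i : R := mesh i; pose M1 := mesh_size t1; pose M2 i := (mesh_size t2 i).+1.
pose M3 := mesh_size t3; pose c i := a - e i * (M1 i)%:R.
have M2c : e i * (M2 i)%:R @[i --> \oo] --> t2.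
  rewrite -[X in _ --> X]addr0; under eq_fun do rewrite -natr1 mulrDr mulr1.
  by apply: cvgD; [exact/mesh_size_cvg/ltW|exact: mesh_cvg].
have M1c : e i * (M1 i)%:R @[i --> \oo] --> t1 by exact/mesh_size_cvg/ltW.
have M3c : e i * (M3 i)%:R @[i --> \oo] --> t3 by exact/mesh_size_cvg/ltW.
have Mc : e i * (M1 i + M2 i + M3 i)%:R @[i --> \oo] --> t1 + t2 + t3.
  by under eq_fun do rewrite !natrD !mulrDr; apply: cvgD => //; apply: cvgD.
have cc : c i @[i --> \oo] --> a - t1 by apply: cvgB => //; exact: cvg_cst.
have e0 i : 0 < e i by exact: mesh_gt0.
have ec : e i @[i --> \oo] --> 0 by exact: mesh_cvg.
have tgt0 : 0 < t1 + t2 + t3 by exact: addr_gt0 (addr_gt0 t1_gt0 t2_gt0) t3_gt0.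
have [_ h] := msum_cvg tgt0 (bridge_le S S' (fun w => F_le (window a b w)))
  (@cont_off_bridge_window _ _ S S' F a b F_cont)
  (mark_measurable_bridge k0 S S' (@measurable_fun_window R L F a b F_cont)) e0 ec Mc cc.
apply: (seq_cvg_unique h).
have ac : (fun=> a : R) @ \oo --> (a : R) by exact: cvg_cst.
have hF U V := proj2 (msum_cvg t2_gt0 (bridge_le U V F_le) (@cont_off_bridge_continuous _ _ U V F F_cont)
  (mark_measurable_bridge k0 U V F_meas) e0 ec M2c ac).
rewrite (_ : (fun i => _) = fun i => \sum_U \sum_V walk (e i) (M1 i) S U *
   (walk (e i) (M3 i) V S' * msum (e i) [seq a + e i * j%:R | j <- iota 0 (M2 i)] (bridge U V F))).
  apply: cvg_big_sum => U _; apply: cvg_big_sum => V _.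
  by apply: cvgM; [exact: mesh_walk_cvg|apply: cvgM; [exact: mesh_walk_cvg|exact: hF]].
apply/funext => i.
pose ts1 := [seq c i + e i * j%:R | j <- iota 0 (M1 i)].
pose ts2 := [seq a + e i * j%:R | j <- iota 0 (M2 i)].
pose ts3 := [seq a + e i * (M2 i + j)%:R | j <- iota 0 (M3 i)].
have -> : [seq c i + e i * j%:R | j <- iota 0 (M1 i + M2 i + M3 i)] = ts1 ++ (ts2 ++ ts3).
  rewrite -addnA !iotaD !map_cat add0n; congr (_ ++ (_ ++ _)).
    rewrite -[M1 i in LHS]addn0 iotaDl -map_comp; apply: eq_map => j /=.
    by rewrite /c natrD mulrDr addrA subrK.
  rewrite -[(M1 i + M2 i)%N]addn0 iotaDl -map_comp; apply: eq_map => j /=.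
  by rewrite /c -addnA natrD mulrDr addrA subrK.
have i0 : 0 < i.+1%:R :> R by [].
have ts1a : {in ts1, forall t, t < a}.
  move=> x /mapP[j jM ->]; move: jM; rewrite mem_iota add0n => /andP[_ jM].
  rewrite /c -addrA gtrDl -mulrN -mulrDr pmulr_rlt0 // addrC subr_lt0 ltr_nat.
  exact: jM.
have ts2ab : {in ts2, forall t, a <= t <= b}.
  move=> x /mapP[j jM ->]; move: jM; rewrite mem_iota add0n => /andP[_ jM].
  rewrite lerDl mulr_ge0 ?(ltW (e0 i)) //= -lerBrDl mulrC ler_pdivrMr //.
  have /andP[h1 _] := truncn_itv (mulr_ge0 (ltW t2_gt0) (ltW i0)).
  by apply: le_trans h1; rewrite ler_nat.
have ts3b : {in ts3, forall t, b < t}.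
  move=> x /mapP[j _ ->]; rewrite -ltrBlDl mulrC ltr_pdivlMr //.
  by rewrite (lt_le_trans (truncnS_gt _)) // ler_nat /M2 /mesh_size leq_addr.
rewrite msum_cat.
transitivity (msum (e i) ts1 (fun s1 => \sum_U \sum_V bridge S U (fun=> 1) s1 *
    (walk (e i) (M3 i) V S' * msum (e i) ts2 (bridge U V F)))).
  apply: eq_msum => s1 s1t; rewrite msum_cat.
  transitivity (msum (e i) ts2 (fun s2 => \sum_U \sum_V bridge S U (fun=> 1) s1 *
    (walk (e i) (M3 i) V S' * bridge U V F s2))).
    apply: eq_msum => s2 s2t.
    transitivity (msum (e i) ts3 (fun s3 => \sum_U \sum_V (bridge S U (fun=> 1) s1 *
      bridge U V F s2) * bridge V S' (fun=> 1) s3)).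
      apply: eq_msum => s3 s3t; rewrite (bridge_window S S' F (a := a) (b := b)).
      - by apply: eq_bigr => U _; apply: eq_bigr => V _; rewrite -mulrA [X in _ = _ * X]mulrC.
      - by move=> t /s1t; exact: ts1a.
      - by move=> t /s2t; exact: ts2ab.
      - by move=> t /s3t; exact: ts3b.
      - exact: ltW.
    rewrite msum_sum; apply: eq_bigr => U _; rewrite msum_sum; apply: eq_bigr => V _.
    rewrite msumZ msum_bridge1 size_map size_iota -mulrA; congr (_ * _).
    exact: mulrC.
  rewrite msum_sum; apply: eq_bigr => U _; rewrite msum_sum; apply: eq_bigr => V _.
  by rewrite !msumZ.
rewrite msum_sum; apply: eq_bigr => U _; rewrite msum_sum; apply: eq_bigr => V _.
transitivity (msum (e i) ts1 (fun s => (walk (e i) (M3 i) V S' * msum (e i) ts2 (bridge U V F)) *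
   bridge S U (fun=> 1) s)); first by apply: eq_msum => s _; rewrite mulrC.
by rewrite msumZ msum_bridge1 size_map size_iota mulrC.
Qed.

Variable N : nat.
Hypothesis N_range : (0 < N < L)%N.
Local Notation l := (lam R L N).
Local Notation nrm := (@psi_norm R L N).

(** Numerator and denominator are multiplied by exp (- lam tau), which is shared in the numerator
    among the durations tau / 2 + a, b - a and tau / 2 - b. The factors psi S and psi S' of the
    boundary states cancel in the limit. *)
Lemma window_limit S S' : #|S| = N -> #|S'| = N ->
  mlim k0 (- (tau / 2)) tau (bridge S S' (fun w => F (window a b w))) /
  mlim k0 (- (tau / 2)) tau (bridge S S' (fun=> 1)) @[tau --> +oo] -->
  \sum_(U : T | #|U| == N) \sum_(V : T | #|V| == N)
    psi U * psi V / nrm * (expR (- (l * (b - a))) * kern U V).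
Proof.
move=> SN S'N.
have nrm0 : nrm != 0 by exact/lt0r_neq0/psi_norm_gt0.
have p0 U : psi U != 0 :> R by exact/lt0r_neq0/psi_gt0.
have ep (r : R) (U V : T) : #|U| = N -> #|V| = N ->
    expR (- (l * (tau / 2 + r))) * prop k0 (tau / 2 + r) U V @[tau --> +oo] --> psi U * psi V / nrm.
  move=> UN VN; have h : expR (- (l * t)) * prop k0 t U V @[t --> +oo] --> (psi U * psi V / nrm : R).
    exact: (eprop_cvg L_gt1 k0 N_range UN VN).
  suff g : tau / 2 + r @[tau --> +oo] --> +oo by exact: (cvg_comp _ _ g h).
  apply/cvgryPge => A; near=> tau.
  rewrite -lerBlDr ler_pdivlMr //; near: tau; apply: nbhs_pinfty_ge; exact: num_real.
pose rat_ tau := (\sum_(U : T | #|U| == N) \sum_(V : T | #|V| == N)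
    (expR (- (l * (tau / 2 + a))) * prop k0 (tau / 2 + a) S U) *
    ((expR (- (l * (tau / 2 - b))) * prop k0 (tau / 2 - b) V S') *
      (expR (- (l * (b - a))) * kern U V))) /
    (expR (- (l * tau)) * prop k0 tau S S').
have E0 : psi S * psi S' / nrm != 0 :> R by rewrite mulf_neq0 ?mulf_neq0 ?invr_eq0.
have h : rat_ tau @[tau --> +oo] --> (\sum_(U : T | #|U| == N) \sum_(V : T | #|V| == N)
    (psi S * psi U / nrm) * ((psi V * psi S' / nrm) * (expR (- (l * (b - a))) * kern U V))) /
    (psi S * psi S' / nrm).
  apply: cvgM; last by apply: cvgV => //; exact: (eprop_cvg L_gt1 k0 N_range SN S'N).
  apply: cvg_big_sum => U /eqP UN; apply: cvg_big_sum => V /eqP VN.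
  by apply: cvgM; [exact: ep|apply: cvgMl; exact: ep].
rewrite [X in _ --> X](_ : _ = (\sum_(U : T | #|U| == N) \sum_(V : T | #|V| == N)
    (psi S * psi U / nrm) * ((psi V * psi S' / nrm) * (expR (- (l * (b - a))) * kern U V))) /
    (psi S * psi S' / nrm)); last first.
  rewrite mulr_suml; apply: eq_bigr => U _; rewrite mulr_suml; apply: eq_bigr => V _.
  by field; rewrite nrm0 !p0.
apply: cvg_trans h; apply: near_eq_cvg; near=> tau.
have t1 : 0 < tau / 2 + a.
  rewrite -ltrBlDr sub0r ltr_pdivlMr //; near: tau; apply: nbhs_pinfty_gt; exact: num_real.
have t3 : 0 < tau / 2 - b.
  rewrite subr_gt0 ltr_pdivlMr //; near: tau; apply: nbhs_pinfty_gt; exact: num_real.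
have tau0 : 0 < tau by near: tau; apply: nbhs_pinfty_gt; exact: num_real.
have eqt : tau / 2 + a + (b - a) + (tau / 2 - b) = tau by field.
have eqc : a - (tau / 2 + a) = - (tau / 2) by field.
have := @mlim_window _ _ S S' t1 t3; rewrite eqt eqc => ->.
have mc : mesh i * (mesh_size tau i)%:R @[i --> \oo] --> tau by exact/mesh_size_cvg/ltW.
rewrite (mlim_bridge1 k0 tau0 (@mesh_gt0 R) (@mesh_cvg R) mc) /rat_.
have eprod : expR (- (l * tau)) = expR (- (l * (tau / 2 + a))) *
   (expR (- (l * (tau / 2 - b))) * expR (- (l * (b - a)))).
  by rewrite -!expRD; congr expR; field.
have S0 : prop k0 tau S S' != 0 by apply/lt0r_neq0/prop_gt0 => //; rewrite SN.
have regroup (x p y q z k : R) : x * p * (y * q * (z * k)) = x * (y * z) * (p * (q * k)) by ring.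
have num : \sum_(U : T | #|U| == N) \sum_(V : T | #|V| == N)
    (expR (- (l * (tau / 2 + a))) * prop k0 (tau / 2 + a) S U) *
    ((expR (- (l * (tau / 2 - b))) * prop k0 (tau / 2 - b) V S') *
      (expR (- (l * (b - a))) * kern U V)) = expR (- (l * tau)) *
    \sum_U \sum_V prop k0 (tau / 2 + a) S U * (prop k0 (tau / 2 - b) V S' * kern U V).
  rewrite mulr_sumr big_mkcond; apply: eq_bigr => U _; case: ifPn => UN; last first.
    by rewrite big1 ?mulr0 // => V _; rewrite prop_card ?mul0r // SN eq_sym.
  rewrite mulr_sumr big_mkcond; apply: eq_bigr => V _; case: ifPn => VN; last first.
    by rewrite [prop k0 _ V S']prop_card ?mul0r ?mulr0 // S'N.
  by rewrite eprod; exact: regroup.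
by rewrite num -mulf_div divff ?mul1r // lt0r_neq0 // expR_gt0.
Unshelve. all: by end_near.
Qed.

End window_factorization.

(** * The coupled process *)

Section state_words.
Context {R : realType} {L : nat}.
Local Notation T := {set 'I_L}.
Local Notation traj := (trajectory R L).
Implicit Types (S U V : T).

(** The mark is written as in [limit_window], as a set computed from two successive states; for an
    allowed step it is the singleton of the hole left ([set_jump_at_hop]). *)
Fixpoint word_events U (ts : seq R) (w : seq T) : seq (R * (T * T)) :=
  match ts, w with
  | t :: ts', V :: w' => (t, ([set k | jump_at k U V]%SET, V)) :: word_events V ts' w'
  | _, _ => [::]
  end.

Lemma set_jump_at_hop U k : free U k -> [set k' | jump_at k' U (hop U k)]%SET = [set k]%SET.
Proof.
move=> fk; apply/setP => k'; rewrite !inE jump_atE.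
apply/andP/eqP => [[fk' /eqP]|->]; last by rewrite fk.
by move=> E; apply/esym/(hop_inj fk fk' E).
Qed.

(** Changes the order of choice: instead of deciding hole by hole along the grid, one chooses the
    occupied cells [bs], then a path of states of that length. Nothing is lost since two successive
    states determine the hole. *)
Lemma msum_words (e : R) ts U V (G : seq (R * (T * T)) -> R) :
  msum e ts (fun z => if hole_path U V (map fst z) then G (hole_events U z) else 0) =
  sumw (size ts) (fun bs => e ^+ count id bs * sumw (count id bs) (fun w =>
     if path (@step L) U w && (last U w == V) then G (word_events U (mask bs ts) w) else 0)).
Proof.
elim: ts U G => [|t ts IHts] U G /=; first by rewrite expr0 mul1r.
rewrite big_bool /= addrC; congr (_ + _).
  by rewrite IHts; apply: eq_sumw => bs _; rewrite add0n.
rewrite mulr_sumr.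
transitivity (sumw (size ts) (fun bs => \sum_S (if step U S then
    e * (e ^+ count id bs * sumw (count id bs) (fun w => if path (@step L) S w && (last S w == V)
      then G ((t, ([set k | jump_at k U S]%SET, S)) :: word_events S (mask bs ts) w) else 0)) else 0))).
  rewrite -sumw_exchange [RHS](eq_bigr (fun S => if step U S then sumw (size ts) (fun bs =>
    e * (e ^+ count id bs * sumw (count id bs) (fun w => if path (@step L) S w && (last S w == V)
      then G ((t, ([set k | jump_at k U S]%SET, S)) :: word_events S (mask bs ts) w) else 0))) else 0)).
    2: by move=> S _; case: ifP => // _; rewrite sumw_tuple big1.
  rewrite -big_mkcond sum_step [RHS]big_mkcond; apply: eq_bigr => k _.
  case: ifPn => fk; last first.
    rewrite (eq_msum _ (H' := fun=> 0 * 0)) => [|s _]; first by rewrite msumZ mul0r mulr0.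
    by rewrite /hole_path /= (negPf fk) mul0r.
  rewrite sumwZ; congr (_ * _).
  rewrite (eq_msum _ (H' := fun s => if hole_path (hop U k) V (map fst s) then
     G ((t, ([set k]%SET, hop U k)) :: hole_events (hop U k) s) else 0)); last first.
    by move=> s _; rewrite /hole_path /= fk.
  rewrite (IHts (hop U k) (fun z => G ((t, ([set k]%SET, hop U k)) :: z))).
  by rewrite set_jump_at_hop.
apply: eq_sumw => bs _; rewrite add1n add0n exprS mulr_sumr; apply: eq_bigr => S _.
case: ifPn => US; last first.
  by rewrite sumw_tuple big1 ?mulr0.
by rewrite mulrA; congr (_ * _); apply: eq_sumw => w _; rewrite /= US.
Qed.

Section parry_words.
Hypothesis L_gt1 : (1 < L)%N.
Variable N : nat.
Hypothesis N_range : (0 < N < L)%N.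
Local Notation l := (lam R L N).
Local Notation nrm := (@psi_norm R L N).

Definition word_trajectory (ts : seq R) (w : seq T) : traj :=
  let U := head finset.set0 w in Trajectory U (word_events U ts (behead w)).

Lemma card_path U w : path (@step L) U w -> #|last U w| = #|U|.
Proof. by elim: w U => //= V w IHw U /andP[/card_step UV /IHw ->]. Qed.

Lemma parry_msum (e : R) ts (F : traj -> R) :
  sumw (size ts) (fun bs => (l * e) ^+ count id bs * sumw (count id bs).+1 (fun w =>
    @parry R L N w * F (word_trajectory (mask bs ts) w))) =
  \sum_(U : T | #|U| == N) \sum_(V : T | #|V| == N) psi U * psi V / nrm * msum e ts (bridge U V F).
Proof.
have l0 : l != 0 by exact/lt0r_neq0/lam_gt0.
pose G bs U V : R := psi U * psi V / nrm * (e ^+ count id bs * sumw (count id bs) (fun w =>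
     if path (@step L) U w && (last U w == V) then F (Trajectory U (word_events U (mask bs ts) w)) else 0)).
transitivity (\sum_(U : T) \sum_(V : T) if (#|U| == N) && (#|V| == N) then sumw (size ts) (fun bs => G bs U V) else 0);
    last first.
  rewrite [RHS]big_mkcond; apply: eq_bigr => U _; case: ifPn => UN; last by rewrite big1.
  rewrite [RHS]big_mkcond; apply: eq_bigr => V _; case: (boolP (#|V| == N)) => //= VN.
  by rewrite /bridge (msum_words e ts U V (fun z => F (Trajectory U z))) -sumwZ.
transitivity (\sum_(U : T) sumw (size ts) (fun bs => \sum_(V : T) if (#|U| == N) && (#|V| == N) then G bs U V else 0));
    last first.
  apply: eq_bigr => U _; rewrite -sumw_exchange; apply: eq_bigr => V _.
  by case: ifP => // _; rewrite sumw_tuple big1.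
rewrite sumw_exchange; apply: eq_sumw => bs _; set n := count id bs.
rewrite [sumw _ _]/= mulr_sumr; apply: eq_bigr => U _.
rewrite -big_mkcond /=; case: (boolP (#|U| == N)) => UN; last first.
  rewrite big_pred0 ?sumw_tuple ?big1 ?mulr0 // => w _.
  by rewrite mul0r.
rewrite /G -/n -sumwZ.
pose g V w : R := e ^+ n * (if path (@step L) U w && (last U w == V)
  then F (Trajectory U (word_events U (mask bs ts) w)) else 0).
transitivity (sumw n (fun w => \sum_(V : T) if #|V| == N then psi U * psi V / nrm * g V w else 0)); last first.
  rewrite -sumw_exchange [RHS]big_mkcond; apply: eq_bigr => V _; case: (#|V| == N) => /=.
    by rewrite -!sumwZ.
  by rewrite sumw_tuple big1.
apply: eq_sumw => w wn; rewrite /= -big_mkcond /=.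
case: ifPn => pw; last first.
  by rewrite mul0r mulr0 big1 // => V _; rewrite /g (negPf pw) !mulr0.
rewrite (bigD1 (last U w)) /=; last by rewrite card_path.
rewrite big1 ?addr0 => [|V /andP[_ /negPf VU]]; last by rewrite /g eq_sym VU andbF !mulr0.
rewrite /g pw eqxx /= wn /word_trajectory /= exprMn.
field.
by rewrite expf_neq0 // andbT; exact/lt0r_neq0/psi_norm_gt0.
Qed.
End parry_words.
End state_words.

(** * Integrals modulo null sets *)

Section integral_extra.
Context {d} {T : measurableType d} {R : realType}.

Import HBNNSimple.

(** [f] and [g] are arbitrary functions, for which almost everywhere equality lemmas on measurable
    functions do not apply. The integral is a supremum over simple functions, and a simple function
    below [f] may be replaced by 0 on the null set. The application is to [limit_window], which is
    controlled only on good time sequences. *)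
Lemma integral_null_ext (mu : {measure set T -> \bar R}) (N : set T) (f g : T -> \bar R) :
  measurable N -> mu N = 0%E -> (forall x, ~ N x -> f x = g x) ->
  (\int[mu]_x f x = \int[mu]_x g x)%E.
Proof.
move=> mN N0 fg.
pose snn (u : T -> \bar R) := ereal_sup [set sintegral mu h |
  h in [set h : {nnsfun T >-> R} | forall x, ((h x)%:E <= u x)%E]].
have half (u v : T -> \bar R) : (forall x, 0 <= v x)%E -> (forall x, ~ N x -> u x = v x) ->
    (snn u <= snn v)%E.
  move=> v0 uv; apply: ge_ereal_sup => _ [h hu <-].
  pose h' := proj_nnsfun h (measurableC mN).
  have h'E x : h' x = if x \in ~` N then h x else 0.
    by have := congr1 (fun k => k x) (mrestrict h (measurableC mN)); rewrite /patch => <-.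
  have -> : sintegral mu h = sintegral mu h'.
    rewrite -!integralT_nnsfun; apply: ge0_ae_eq_integral => //.
    - exact/measurable_EFinP.
    - exact/measurable_EFinP.
    - by move=> x _; rewrite lee_fin.
    - by move=> x _; rewrite lee_fin.
    exists N; split => // x /= H; apply: contrapT => nN; apply: H => _.
    by congr EFin; have := h'E x; rewrite mem_set // => /esym.
  apply: ereal_sup_ubound; exists h' => // x; rewrite h'E.
  by case: ifPn => [/set_mem nN|_]; [rewrite -uv|exact: v0].
have eqs (u v : T -> \bar R) : (forall x, 0 <= u x)%E -> (forall x, 0 <= v x)%E ->
    (forall x, ~ N x -> u x = v x) -> snn u = snn v.
  by move=> u0 v0 uv; apply/eqP; rewrite eq_le !half // => x /uv.
rewrite /integral !patch_setT; congr (_ - _)%E; apply: eqs => x; rewrite ?funepos_ge0 ?funeneg_ge0 //.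
  by move=> nN; rewrite !funeposE fg.
by move=> nN; rewrite !funenegE fg.
Qed.

Lemma Rintegral_sum (P : probability T R) (I : Type) (r : seq I) (f : I -> T -> R) :
  (forall i, P.-integrable setT (EFin \o f i)) ->
  P.-integrable setT (EFin \o (fun x => \sum_(i <- r) f i x)) /\
  \int[P]_x (\sum_(i <- r) f i x) = \sum_(i <- r) \int[P]_x f i x.
Proof.
move=> fi; elim: r => [|i r [IH1 IH2]].
  under eq_fun do rewrite big_nil.
  split; first exact: finite_measure_integrable_cst.
  by rewrite big_nil Rintegral_cst // mul0r.
have E : (fun x => \sum_(z <- i :: r) f z x) = (fun x => f i x + \sum_(z <- r) f z x).
  by apply/funext => x; rewrite big_cons.
by rewrite E big_cons -IH2 -RintegralD //; split=> //; have := integrableD measurableT (fi i) IH1.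
Qed.

End integral_extra.

Section good_sequences.
Context {R : realType}.
Implicit Types (s : int -> R) (t : R) (i j : int).

(** The almost sure event of [poisson_process]. On it [clock] is given by its defining property;
    elsewhere it may take the default value of [xget]. *)
Definition good_times : set (int -> R) :=
  [set s | [/\ forall i, s i < s (i + 1), s 0 <= 0 < s 1 & forall r : R, exists i j, s i < r < s j]].

Lemma good_le s i (n : nat) : good_times s -> s i <= s (i + n%:Z).
Proof.
case=> sS _ _; elim: n => [|n IHn]; first by rewrite addr0.
by rewrite (le_trans IHn) // -addn1 PoszD addrA ltW.
Qed.

Lemma good_mono s i j : good_times s -> (s i < s j) = (i < j).
Proof.
move=> g; have lt (k k' : int) : k < k' -> s k < s k'.
  move=> kk'; have -> : k' = k + 1 + (absz (k' - k - 1)%R)%:Z by lia.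
  by case: (g) => sS _ _; apply: lt_le_trans (sS k) _; exact: good_le.
by case: (ltgtP i j) => [/lt //|/lt/ltW|->]; [rewrite leNgt => /negbTE|rewrite ltxx].
Qed.

Lemma good_clock_ex s t : good_times s -> exists i, s i <= t < s (i + 1).
Proof.
move=> g; have [_ _ /(_ t)[i [j /andP[it tj]]]] := g.
have ij : i < j by rewrite -(good_mono i j g) (lt_trans it).
have ex : exists n : nat, t < s (i + n%:Z + 1).
  by exists (absz (j - i - 1)%R); rewrite (_ : _ + _ + 1 = j) //; lia.
case: (ex_minnP ex) => n tn nmin; exists (i + n%:Z); rewrite tn andbT.
case: n tn nmin => [|n] tn nmin; first by rewrite addr0 ltW.
rewrite leNgt; apply/negP => tn'; suff : (n.+1 <= n)%N by rewrite ltnn.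
by apply: nmin; rewrite (_ : _ + 1 = i + n.+1%:Z) //; lia.
Qed.

Lemma good_clock s t : good_times s -> s (clock s t) <= t < s (clock s t + 1).
Proof. by move=> /good_clock_ex -/(_ t)/xgetPex-/(_ 0). Qed.

Lemma good_clock_eq s t i : good_times s -> s i <= t < s (i + 1) -> clock s t = i.
Proof.
move=> g /andP[it ti]; have /andP[ct tc] := good_clock t g.
have := le_lt_trans ct ti; have := le_lt_trans it tc; rewrite !good_mono //; lia.
Qed.

Lemma good_clock_le s t i : good_times s -> (s i <= t) = (i <= clock s t).
Proof.
move=> g; have /andP[ct tc] := good_clock t g.
apply/idP/idP => [it|ic].
  by have := le_lt_trans it tc; rewrite good_mono // ltzD1.
by apply: le_trans ct; rewrite leNgt good_mono // -leNgt.
Qed.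

Lemma measurable_good : measurable (good_times : set (Zseq (measurableTypeR R))).
Proof.
have mc i : measurable_fun setT (fun s : Zseq (measurableTypeR R) => s i : R).
  exact: measurable_fun_coord.
have mlt (f g : Zseq (measurableTypeR R) -> R) : measurable_fun setT f -> measurable_fun setT g ->
    measurable [set s | f s < g s].
  move=> mf mg; rewrite (_ : [set _ | _] = (fun s => f s < g s) @^-1` [set true]) //.
  by rewrite -[X in measurable X]setTI; apply: measurable_fun_ltr.
have mle (f g : Zseq (measurableTypeR R) -> R) : measurable_fun setT f -> measurable_fun setT g ->
    measurable [set s | f s <= g s].
  move=> mf mg; rewrite (_ : [set _ | _] = (fun s => f s <= g s) @^-1` [set true]) //.
  by rewrite -[X in measurable X]setTI; apply: measurable_fun_ler.
have -> : (good_times : set (Zseq (measurableTypeR R))) =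
    ~` (\bigcup_(i in setT) ~` [set s : Zseq (measurableTypeR R) | s i < s (i + 1)]) `&`
    ([set s : Zseq (measurableTypeR R) | s 0 <= 0] `&` [set s : Zseq (measurableTypeR R) | 0 < s 1]) `&`
    ~` (\bigcup_(n : nat) ~` (\bigcup_(p : int * int)
      ([set s : Zseq (measurableTypeR R) | s p.1 < - n%:R] `&` [set s : Zseq (measurableTypeR R) | n%:R < s p.2]))).
  apply/seteqP; split => s /=.
    case=> h1 /andP[h2 h3] h4; split; first split.
    - by case=> i _; apply; exact: h1.
    - by [].
    case=> n _; apply; have [i [_ /andP[i1 _]]] := h4 (- n%:R); have [_ [j /andP[_ j2]]] := h4 n%:R.
    by exists (i, j).
  case=> -[h1 [h2 h3]] h4; split; last 1 first.
  - move=> r; pose n := Num.truncn (`|r| + 1); have rn : `|r| < n%:R.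
      rewrite -(ltrD2r 1) natr1; exact: truncnS_gt.
    have : (\bigcup_(p : int * int)
      ([set s : Zseq (measurableTypeR R) | s p.1 < - n%:R] `&` [set s : Zseq (measurableTypeR R) | n%:R < s p.2])) s.
      by apply: contrapT => H; apply: h4; exists n.
    case=> -[i j] _ [/= i1 j2]; exists i, j.
    by move: rn; rewrite ltr_norml => /andP[r1 r2]; rewrite (lt_trans i1) ?(lt_trans _ j2).
  - by move=> i; apply: contrapT => H; apply: h1; exists i.
  - by rewrite h2 h3.
apply: measurableI; first apply: measurableI.
- by apply: measurableC; apply: measurable_bigcup_countType => i _; apply: measurableC; exact: mlt.
- by apply: measurableI; [exact: mle|exact: mlt].
apply: measurableC; apply: measurable_bigcup_countType => n _; apply: measurableC.
by apply: measurable_bigcup_countType => p _; apply: measurableI; exact: mlt.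
Qed.

End good_sequences.

(** * Cells of the window and Poisson occupation patterns *)

Section discretisation.
Context {R : realType}.
Variables a b : R.
Hypothesis ab : a < b.
Implicit Types (s : int -> R) (t : R) (m j : nat).

Definition cell_width m : R := (b - a) / m.+1%:R.
Definition cell_left m j : R := a + cell_width m * j%:R.
(** Cells are open on the left and closed on the right, like the intervals of [poisson_process]; the
    index is that of the first cell whose right end is not before t. *)
Definition cell_index m t : nat := find (fun j => t <= cell_left m j.+1) (iota 0 m.+1).
Definition cell_grid m : seq R := [seq cell_left m j | j <- iota 0 m.+1].

Lemma cell_width_gt0 m : 0 < cell_width m.
Proof. by rewrite divr_gt0 // subr_gt0. Qed.

Lemma cell_width_cvg : cell_width m @[m --> \oo] --> 0.
Proof. by rewrite -[X in _ --> X](mulr0 (b - a)); apply: cvgMr; exact: cvg_harmonic. Qed.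

Lemma cell_left0 m : cell_left m 0 = a. Proof. by rewrite /cell_left mulr0 addr0. Qed.

Lemma cell_left_max m : cell_left m m.+1 = b.
Proof. by rewrite /cell_left /cell_width divfK ?pnatr_eq0 // addrC subrK. Qed.

Lemma cell_leftS m j : cell_left m j.+1 = cell_left m j + cell_width m.
Proof. by rewrite /cell_left -natr1 mulrDr mulr1 addrA. Qed.

Lemma cell_left_le m j j' : (cell_left m j <= cell_left m j') = (j <= j')%N.
Proof. by rewrite lerD2l ler_pM2l ?cell_width_gt0 // ler_nat. Qed.

Lemma cell_uniq m j j' t : cell_left m j < t <= cell_left m j.+1 ->
  cell_left m j' < t <= cell_left m j'.+1 -> j = j'.
Proof.
have le i i' : cell_left m i < t -> t <= cell_left m i'.+1 -> (i <= i')%N.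
  move=> h1 h2; rewrite leqNgt; apply/negP; rewrite -(cell_left_le m) => h.
  by have := lt_le_trans (le_lt_trans h h1) h2; rewrite ltxx.
by move=> /andP[h1 h2] /andP[h3 h4]; apply/eqP; rewrite eqn_leq !le.
Qed.

Lemma cell_indexP m t : a < t <= b ->
  (cell_index m t < m.+1)%N /\ cell_left m (cell_index m t) < t <= cell_left m (cell_index m t).+1.
Proof.
move=> /andP[at_ tb].
have hs : has (fun j => t <= cell_left m j.+1) (iota 0 m.+1).
  by apply/hasP; exists m; rewrite ?mem_iota ?cell_left_max //= add0n ltnS.
have im : (cell_index m t < m.+1)%N by move: hs; rewrite has_find size_iota.
split=> //; apply/andP; split; last by have := nth_find 0%N hs; rewrite nth_iota.
case E : (cell_index m t) im => [|i] im; first by rewrite cell_left0.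
have := @before_find _ 0%N (fun j => t <= cell_left m j.+1) (iota 0 m.+1) i.
rewrite -/(cell_index m t) E ltnS leqnn => /(_ isT); rewrite nth_iota ?add0n; last exact: ltnW.
by move/negbT; rewrite -ltNge.
Qed.

Lemma cell_index_uniq m j t : (j < m.+1)%N -> cell_left m j < t <= cell_left m j.+1 ->
  a < t <= b /\ cell_index m t = j.
Proof.
move=> jm tj; have tab : a < t <= b.
  case/andP: tj => t1 t2; rewrite -(cell_left0 m) -(cell_left_max m).
  by rewrite (le_lt_trans _ t1) ?cell_left_le // (le_trans t2) // cell_left_le.
by split=> //; have [_ h] := cell_indexP m tab; exact: cell_uniq h tj.
Qed.

(** The bits are read as cardinalities: exactly one point in a cell marked [true], none in the
    others. A sequence with two points in one cell fits no pattern. *)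
Definition occupied m (bs : seq bool) : set (int -> R) :=
  [set s | forall k : 'I_m.+1,
    ([set i | (cell_left m k < s i <= cell_left m k.+1)%R] #= `I_(nth false bs k))%card].

Lemma occupied_uniq m (bs bs' : seq bool) s : size bs = m.+1 -> size bs' = m.+1 ->
  occupied m bs s -> occupied m bs' s -> bs = bs'.
Proof.
move=> sb sb' h h'; apply: (@eq_from_nth _ false); first by rewrite sb'.
move=> k; rewrite sb => km; have h1 := h (Ordinal km); have h2 := h' (Ordinal km).
have := card_eq_trans (card_esym h1) h2; move/card_eq_II => /=.
by case: (nth false bs k); case: (nth false bs' k).
Qed.

Lemma measurable_occupied m (bs : seq bool) :
  measurable (occupied m bs : set (Zseq (measurableTypeR R))).
Proof.
pose I (k : 'I_m.+1) (i : int) : set (Zseq (measurableTypeR R)) :=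
  [set s | cell_left m k < s i <= cell_left m k.+1].
have mI k i : measurable (I k i).
  have := @measurable_coord _ (measurableTypeR R) i `]cell_left m k, cell_left m k.+1]%classic.
  rewrite (_ : [set X | _] = I k i); first by apply; exact: measurable_itv.
  by apply/seteqP; split => s; rewrite /I /= in_itv.
have card1 (A : set int) (v : bool) : (A #= `I_v)%card <->
    if v then exists i, A = [set i] else A = set0.
  case: v => /=; last by rewrite II0 card_eq0; split => /eqP.
  split=> [A1|[i ->]]; last exact: card_set1.
  have [f [fA fI fS]] := elimT card_set_bijP A1.
  have [//|i Ai fi] := fS 0%N; exists i; apply/seteqP; split => j /=; last by move=> ->.
  move=> Aj; apply: fI; rewrite ?inE //; have := fA _ Aj; rewrite /= ltnS leqn0 => /eqP ->.
  by rewrite fi.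
have -> : (occupied m bs : set (Zseq (measurableTypeR R))) = \bigcap_(k in [set: 'I_m.+1])
   (if nth false bs k then \bigcup_(i in [set: int]) (I k i `&` ~` (\bigcup_(j in [set j | j != i]) I k j))
    else ~` (\bigcup_(i in [set: int]) I k i)).
  suff E (k : 'I_m.+1) s : ([set i | (cell_left m k < s i <= cell_left m k.+1)%R] #= `I_(nth false bs k))%card <->
     (if nth false bs k then \bigcup_(i in [set: int]) (I k i `&` ~` (\bigcup_(j in [set j | j != i]) I k j))
    else ~` (\bigcup_(i in [set: int]) I k i)) s.
    by apply/seteqP; split => s /= H k; [move=> _; apply/E/H|apply/E; exact: (H k Logic.I)].
  apply: (iff_trans (card1 _ _)); case: (nth false bs k); split => /=.
  - case=> i Ai; exists i => //; split; first by have E : [set i] i by []; move: E; rewrite -Ai.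
    case=> j /= ji Ij; have E : [set i] j by rewrite -Ai.
    by move: ji; rewrite E eqxx.
  - case=> i _ [Ii nI]; exists i; apply/seteqP; split => j /=; last by move=> ->.
    by move=> Ij; apply/eqP; apply: contraT => ji; exfalso; apply: nI; exists j.
  - by move=> A0 [i _ Ii]; have : [set i | (cell_left m k < s i <= cell_left m k.+1)%R] i by []; rewrite A0.
  - by move=> nI; apply/seteqP; split => // i /= Ii; apply: nI; exists i.
apply: fin_bigcap_measurable => [|k _]; first exact: finite_finset.
case: (nth false bs k).
  apply: measurable_bigcup_countType => i _; apply: measurableI => //.
  by apply: measurableC; apply: measurable_bigcup_countType.
by apply: measurableC; apply: measurable_bigcup_countType.
Qed.

Lemma count_nth (bs : seq bool) : \sum_(k < size bs) (nth false bs k : nat) = count id bs.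
Proof. by elim: bs => [|b0 bs IH] /=; rewrite ?big_ord0 // big_ord_recl /= IH. Qed.

Lemma poisson_occupied (l : R) (P : probability (Zseq (measurableTypeR R)) R) m (bs : seq bool) :
  0 < l -> poisson_process l P -> size bs = m.+1 ->
  P (occupied m bs) = (expR (- (l * (b - a))) * (l * cell_width m) ^+ count id bs)%:E.
Proof.
move=> l0 [_ HP] sb.
have r0 : 0 < l * cell_width m by rewrite mulr_gt0 // cell_width_gt0.
rewrite /occupied (HP m.+1 (fun k => cell_left m k) (fun k => cell_left m k.+1) (fun k => nth false bs k : nat)).
- congr EFin; rewrite (eq_bigr (fun k : 'I_m.+1 => (l * cell_width m) ^+ (nth false bs k : nat) *
    expR (- (l * cell_width m)))) => [|k _]; last first.
    rewrite cell_leftS addrAC subrr add0r /poisson_pmf r0.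
    by case: (nth false bs k); rewrite ?expr0 ?fact0 ?divr1.
  rewrite big_split /= prodrXr prodr_const card_ord mulrC; congr (_ * _ ^+ _).
    rewrite -expRM_natl; congr expR; rewrite /cell_width; field.
    by rewrite nat1r pnatr_eq0.
  by rewrite -count_nth sb.
- by move=> k; rewrite cell_leftS ltrDl cell_width_gt0.
apply/trivIsetP => i j _ _ ij; apply/seteqP; split => // t [/=]; rewrite !in_itv /= => ti tj.
by move/negP: ij; apply; apply/eqP/val_inj/(cell_uniq ti tj).
Qed.

(** Cells narrower than every gap between points of ]a, b] contain at most one of them. The bits
    mark the cells that are hit, and the increasing order of the cells makes [mask] return the left
    ends in the order of the points. *)
Lemma discretise_points m s (d : R) : good_times s -> cell_width m < d ->
  let k := clock s a in let K := absz (clock s b - k)%R in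
  let pt n := s (k + 1 + Posz n) in
  (forall n n', (n < n' < K)%N -> d <= pt n' - pt n) ->
  exists2 bs : seq bool, size bs = m.+1 & [/\ occupied m bs s, count id bs = K &
    mask bs (cell_grid m) = [seq cell_left m (cell_index m (pt n)) | n <- iota 0 K]].
Proof.
move=> g wd k K pt gap.
have kb : k <= clock s b.
  rewrite -(good_clock_le b k g); have /andP[ka _] := good_clock a g.
  exact: le_trans ka (ltW ab).
have inab i : (a < s i <= b) = (k + 1 <= i <= clock s b).
  by rewrite good_clock_le // ltNge good_clock_le // -/k -ltNge lezD1.
have ptab n : (n < K)%N -> a < pt n <= b by move=> nK; rewrite inab; apply/andP; split; rewrite /K in nK; lia.
pose js := [seq cell_index m (pt n) | n <- iota 0 K].
have js_lt n n' : (n < n' < K)%N -> (cell_index m (pt n) < cell_index m (pt n'))%N.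
  move=> nn'; have /andP[n1 n2] := nn'.
  have [_ /andP[h1 h2]] := cell_indexP m (ptab n (ltn_trans n1 n2)).
  have [_ /andP[h3 h4]] := cell_indexP m (ptab n' n2).
  have dn := gap n n' nn'; rewrite ltnNge; apply/negP; rewrite -(cell_left_le m) => h.
  move: h4; rewrite cell_leftS => h4; have w0 := cell_width_gt0 m.
  by lra.
have js_inj n n' : (n < K)%N -> (n' < K)%N -> cell_index m (pt n) = cell_index m (pt n') -> n = n'.
  move=> nK n'K E; case: (ltngtP n n') => // nn'.
    by have := @js_lt n n'; rewrite nn' n'K E ltnn => /(_ isT).
  by have := @js_lt n' n; rewrite nn' nK E ltnn => /(_ isT).
pose bs := [seq j \in js | j <- iota 0 m.+1].
have jsm j : j \in js -> (j < m.+1)%N.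
  by move=> /mapP[n]; rewrite mem_iota add0n => /andP[_ /ptab h] ->; have [] := cell_indexP m h.
have filt : [seq j <- iota 0 m.+1 | j \in js] = js.
  apply: (irr_sorted_eq ltn_trans ltnn); first by apply: sorted_filter; [exact: ltn_trans|exact: iota_ltn_sorted].
    apply/(sortedP 0%N) => n; rewrite size_map size_iota => nK.
    by rewrite !(nth_map 0%N) ?size_iota ?nth_iota ?js_lt ?add0n ?ltnSn //; exact: ltnW.
  by move=> j; rewrite mem_filter mem_iota add0n /=; case: (boolP (j \in js)) => // /jsm.
exists bs; first by rewrite size_map size_iota.
split.
- move=> [j jm] /=; rewrite (nth_map 0%N) ?size_iota // nth_iota // add0n.
  have cellP i : (cell_left m j < s i <= cell_left m j.+1) ->
      exists2 n, (n < K)%N & i = k + 1 + Posz n /\ cell_index m (pt n) = j.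
    move=> ij; have [] := cell_index_uniq jm ij; rewrite inab => /andP[i1 i2] E.
    exists (absz (i - (k + 1))%R); first by rewrite /K; lia.
    have ii : i = k + 1 + Posz (absz (i - (k + 1))%R) by lia.
    by split=> //; rewrite /pt -ii.
  case: (boolP (j \in js)) => [/mapP[n]|jn].
    rewrite mem_iota add0n => /andP[_ nK] jE.
    rewrite (_ : [set i | _] = [set k + 1 + Posz n]); first exact: card_set1.
    apply/seteqP; split => i /=; last first.
      by move=> ->; rewrite jE; have [] := cell_indexP m (ptab n nK).
    by move=> /cellP[n' n'K [-> E]]; rewrite (js_inj n' n n'K nK) // E.
  rewrite (_ : [set i | _] = set0) ?II0 //.
  apply/seteqP; split => // i /= /cellP[n nK [_ E]].
  by move/negP: jn; apply; apply/mapP; exists n; rewrite ?mem_iota.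
- by rewrite /bs count_map -size_filter filt size_map size_iota.
by rewrite /bs /cell_grid -map_mask -filter_mask filt -map_comp.
Qed.

End discretisation.

Lemma int_window (k c : int) (n : nat) : k <= c -> (n < absz (c - k)%R)%N ->
  (k < k + 1 + Posz n) && (k + 1 + Posz n <= c).
Proof. by move=> kc nK; apply/andP; split; lia. Qed.

Section coupled_process.
Context {R : realType} {L N : nat}.
Hypothesis L_gt1 : (1 < L)%N.
Hypothesis N_range : (0 < N < L)%N.
Variable k0 : 'I_L.
Local Notation T := {set 'I_L}.
Local Notation traj := (trajectory R L).
Local Notation Xs := (Zseq T).
Local Notation Ss := (Zseq (measurableTypeR R)).
Local Notation l := (lam R L N).
Local Notation parry := (@parry R L N).
Variables (mu : probability Xs R) (P : probability Ss R).
Hypothesis muE : forall i w, mu (word_cyl i w) = (parry w)%:E.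
Hypothesis HP : poisson_process l P.
Variables (a b : R) (F : traj -> R) (C : R).
Hypothesis ab : a < b.
Hypothesis F_le : forall w, `|F w| <= C.
Hypothesis F_cont : continuous F.

Let l_gt0 : 0 < l. Proof. exact: lam_gt0. Qed.
Let C_ge0 : 0 <= C. Proof. exact: le_trans (F_le point). Qed.

(** On a piece the occupied cells and the successive states from time a on are fixed, so the
    discretised trajectory is constant. The word is read from the random index [clock x.2 a], which
    is harmless because the law of X is stationary and independent of the clock. *)
Let piece m bs w : set (Xs * Ss) :=
  [set x | [/\ good_times x.2, occupied a b m bs x.2 & word_cyl (clock x.2 a) w x.1]].

Let measurable_piece m bs w : measurable (piece m bs w).
Proof.
rewrite (_ : piece m bs w = \bigcup_(i in [set: int]) (word_cyl i w `*`
   ((good_times : set Ss) `&` (occupied a b m bs : set Ss) `&` ([set s | s i <= a] `&` [set s | a < s (i + 1)])))).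
  apply: measurable_bigcup_countType => i _; apply: measurableX; first exact: measurable_word_cyl.
  apply: measurableI; first by apply: measurableI; [exact: measurable_good|exact: measurable_occupied].
  apply: measurableI.
    have := @measurable_coord _ (measurableTypeR R) i `]-oo, a]%classic (measurable_itv _).
    by rewrite (_ : [set X | _] = [set s | s i <= a]) //; apply/seteqP; split => s; rewrite /= in_itv.
  have := @measurable_coord _ (measurableTypeR R) (i + 1) `]a, +oo[%classic (measurable_itv _).
  by rewrite (_ : [set X | _] = [set s | a < s (i + 1)]) //; apply/seteqP; split => s; rewrite /= in_itv /= andbT.
apply/seteqP; split => -[X s]; rewrite /piece /=.
  case=> g o c; exists (clock s a) => //; split=> //=; split=> //.
  by have /andP[] := good_clock a g.
case=> i _ [/= c [[g o] [i1 i2]]]; split=> //.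
by rewrite (good_clock_eq (i := i) g) // i1.
Qed.

Let piece_law m bs w : size bs = m.+1 ->
  fine ((mu \x P)%E (piece m bs w)) =
  parry w * (expR (- (l * (b - a))) * (l * cell_width a b m) ^+ count id bs).
Proof.
move=> sb.
(* The iterated integral is taken with s fixed first: the section in X is then a cylinder at the
   index [clock s a], of a mass that does not depend on this index. *)
have -> : (mu \x P)%E (piece m bs w) = (mu \x^ P)%E (piece m bs w).
  apply: (product_measure_unique (m' := (mu \x^ P)%E)) => // A B mA mB.
  exact: product_measure2E.
have mgo : measurable ((good_times : set Ss) `&` (occupied a b m bs : set Ss)).
  by apply: measurableI; [exact: measurable_good|exact: measurable_occupied].
have P1 : P (good_times : set Ss) = 1%E by case: HP.
have Pgo : P ((good_times : set Ss) `&` (occupied a b m bs : set Ss)) =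
    (expR (- (l * (b - a))) * (l * cell_width a b m) ^+ count id bs)%:E.
  have mo : measurable (occupied a b m bs : set Ss) by exact: measurable_occupied.
  rewrite (probability_setI_full measurable_good mo P1).
  exact: poisson_occupied.
rewrite /product_measure2.
rewrite (_ : (fun x => _) = fun s => ((parry w)%:E *
   (\1_((good_times : set Ss) `&` (occupied a b m bs : set Ss)) s)%:E)%E); last first.
  apply/funext => s /=; rewrite indicE.
  case: (boolP (s \in _)) => [/set_mem[g o]|ns].
    rewrite mule1 -(muE (clock s a)); congr (mu _); apply/seteqP; split => X; rewrite /ysection /= inE /piece /=.
      by case.
    by [].
  rewrite mule0 (_ : ysection _ _ = set0) ?measure0 //.
  apply/seteqP; split => // X; rewrite /ysection /= inE /piece /= => -[g o _].
  by move/negP: ns; apply; exact: mem_set.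
rewrite ge0_integralZl //; last 2 first.
- by apply/measurable_EFinP; exact: measurable_indic.
- by rewrite lee_fin -lee_fin -(muE 0).
rewrite integral_indic // setIT.
transitivity (fine ((parry w)%:E * (expR (- (l * (b - a))) * (l * cell_width a b m) ^+ count id bs)%:E)%E) => //.
congr (fine (_ * _)%E); exact: Pgo.
Qed.

(* F evaluated on the trajectory with the jumps of x in ]a, b] moved to the left
   ends of their cells, and 0 when two of them share a cell. *)
Let g m (x : Xs * Ss) : R :=
  \sum_(bs : m.+1.-tuple bool) \sum_(w : (count id bs).+1.-tuple T)
     F (word_trajectory (mask bs (cell_grid a b m)) w) * \1_(piece m bs w) x.

Let integrable_term m bs w (v : R) :
  (mu \x P)%E.-integrable setT (EFin \o (fun x => v * \1_(piece m bs w) x)).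
Proof.
apply: (@integrable_bounded _ _ _ (mu \x P)%E _ `|v|).
  by apply: measurable_funM => //; exact: measurable_indic.
by move=> x; rewrite normrM ler_piMr // indicE; case: (_ \in _); rewrite ?normr1 ?normr0.
Qed.

Let Rintegral_g m : \int[(mu \x P)%E]_x g m x = expR (- (l * (b - a))) *
  \sum_(U : T | #|U| == N) \sum_(V : T | #|V| == N) psi U * psi V / @psi_norm R L N *
     msum (cell_width a b m) (cell_grid a b m) (bridge U V F).
Proof.
pose inner bs x : R := \sum_(w <- enum {: (count id bs).+1.-tuple T})
   F (word_trajectory (mask bs (cell_grid a b m)) w) * \1_(piece m bs w) x.
have innerE bs := @Rintegral_sum _ _ R (mu \x P)%E _ (enum {: (count id bs).+1.-tuple T})
  (fun w x => F (word_trajectory (mask bs (cell_grid a b m)) w) * \1_(piece m bs w) x)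
  (fun w => integrable_term m bs w _).
have [_ E] := @Rintegral_sum _ _ R (mu \x P)%E _ (enum {: m.+1.-tuple bool}) inner
  (fun bs => proj1 (innerE bs)).
have gE : g m = fun x => \sum_(bs <- enum {: m.+1.-tuple bool}) inner bs x.
  by apply/funext => x; rewrite /g big_enum; apply: eq_bigr => bs _; rewrite /inner big_enum.
rewrite gE E -parry_msum // size_map size_iota sumw_tuple mulr_sumr big_enum.
apply: eq_big => // bs _; rewrite /inner (proj2 (innerE bs)) sumw_tuple !mulr_sumr big_enum.
apply: eq_big => // w _.
rewrite RintegralZl //; last first.
  have := integrable_term m bs w 1; under [X in _ \o X]eq_fun do rewrite mul1r; exact.
rewrite /Rintegral integral_indic // setIT piece_law ?size_tuple //.
by ring.
Qed.

Let g_piece m (bs : m.+1.-tuple bool) (w : (count id bs).+1.-tuple T) x : piece m bs w x ->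
  g m x = F (word_trajectory (mask bs (cell_grid a b m)) w).
Proof.
move=> xB; have [gx ox wx] := xB.
rewrite /g (bigD1 bs) //= [X in _ + X]big1 ?addr0 => [|bs' bb']; last first.
  rewrite big1 // => w' _; rewrite indicE memNset ?mulr0 // => -[_ ox' _].
  move/eqP: bb'; apply; apply: val_inj.
  by apply: (occupied_uniq _ _ ox' ox); rewrite size_tuple.
rewrite (bigD1 w) //= [X in _ + X]big1 ?addr0 => [|w' ww'].
  by rewrite indicE mem_set // mulr1.
rewrite indicE memNset ?mulr0 // => -[_ _ wx'].
move/eqP: ww'; apply; apply: val_inj => /=.
by move: wx wx'; rewrite /word_cyl /= !size_tuple => -> ->.
Qed.

Let g_le m x : `|g m x| <= C.
Proof.
case: (pselect (exists (bs : m.+1.-tuple bool) (w : (count id bs).+1.-tuple T), piece m bs w x)).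
  by case=> bs [w /g_piece ->].
move=> nx; rewrite /g big1 ?normr0 // => bs _; rewrite big1 // => w _.
by rewrite indicE memNset ?mulr0 // => xB; apply: nx; exists bs, w.
Qed.

Let g_bad m x : ~ good_times x.2 -> g m x = 0.
Proof.
move=> ng; rewrite /g big1 // => bs _; rewrite big1 // => w _.
by rewrite indicE memNset ?mulr0 // => -[].
Qed.

Let g_meas m : measurable_fun setT (g m).
Proof.
apply: measurable_sum => bs; apply: measurable_sum => w.
by apply: measurable_funM => //; exact: measurable_indic.
Qed.

Lemma word_events_map (X : int -> T) (k : int) (h : nat -> R) n0 K :
  word_events (X (k + Posz n0)) [seq h n | n <- iota n0 K] [seq X (k + 1 + Posz n) | n <- iota n0 K] =
  [seq (h n, ([set j | jump_at j (X (k + 1 + Posz n - 1)) (X (k + 1 + Posz n))]%SET, X (k + 1 + Posz n)))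
     | n <- iota n0 K].
Proof.
elim: K n0 => [|K IHK] n0 //=.
have E1 : k + 1 + Posz n0 = k + Posz n0.+1 by lia.
have E2 : k + 1 + Posz n0 - 1 = k + Posz n0 by lia.
by rewrite E2 [in word_events (X _)]E1 IHK.
Qed.

(** For large m the points of s in ]a, b] lie in distinct cells, so [g m (X, s)] is [F] at the limit
    trajectory with its jump times rounded; the rounded times converge while the states stay the
    same. *)
Let g_cvg X s : good_times s -> g m (X, s) @[m --> \oo] --> F (limit_window a b X s).
Proof.
move=> gs; pose k := clock s a; pose K := absz (clock s b - k)%R; pose pt n := s (k + 1 + Posz n).
have kb : k <= clock s b.
  rewrite -(good_clock_le b k gs); have /andP[ka _] := good_clock a gs.
  exact: le_trans ka (ltW ab).
have ptab n : (n < K)%N -> a < pt n <= b.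
  move=> nK; rewrite /pt good_clock_le // ltNge good_clock_le // -/k -ltNge.
  exact: int_window kb nK.
pose ev (h : nat -> R) : seq (R * (T * T)) :=
  [seq (h n, ([set j | jump_at j (X (k + 1 + Posz n - 1)) (X (k + 1 + Posz n))]%SET, X (k + 1 + Posz n)))
     | n <- iota 0 K].
pose rd m n := cell_left a b m (cell_index a b m (pt n)).
have rd_cvg n : (n < K)%N -> rd m n @[m --> \oo] --> pt n.
  move=> nK; have u : (fun=> pt n) @ \oo --> pt n by exact: cvg_cst.
  have lc : pt n - cell_width a b m @[m --> \oo] --> pt n.
    by rewrite -[X in _ --> X]subr0; apply: cvgB => //; exact: cell_width_cvg.
  apply: (squeeze_cvgr _ lc u); apply: nearW => m.
  have [_ /andP[h1 h2]] := cell_indexP m (ptab n nK).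
  by rewrite (ltW h1) andbT lerBlDr -cell_leftS.
have wE : limit_window a b X s = Trajectory (X k) (ev pt) by [].
have c1 : F (Trajectory (X k) (ev (rd m))) @[m --> \oo] --> F (limit_window a b X s).
  have tE h : times (Trajectory (X k) (ev h)) = [seq h n | n <- iota 0 K].
    by rewrite /times /= /ev -map_comp.
  rewrite wE; apply: cvg_trajectory => //.
    by apply: nearW => m; split => //; rewrite /marks /= /ev -!map_comp.
  move=> j; rewrite tE; under eq_fun do rewrite tE.
  case: (ltnP j K) => jK.
    rewrite (nth_map 0%N) ?size_iota // nth_iota // add0n.
    by under eq_fun do rewrite (nth_map 0%N) ?size_iota // nth_iota // add0n; exact: rd_cvg.
  rewrite nth_default ?size_map ?size_iota //.
  by under eq_fun do rewrite nth_default ?size_map ?size_iota //; exact: cvg_cst.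
(* The gaps that follow the K points of ]a, b] are finite in number; once the cells are narrower
   than all of them, [discretise_points] applies. *)
have [d d0 dP] : exists2 d : R, 0 < d & forall n : 'I_K, true -> d <= pt n.+1 - pt n.
  apply: finite_lower_bound => n _; by rewrite subr_gt0 /pt good_mono // ltrD2l ltz_nat.
apply: cvg_trans c1; apply: near_eq_cvg; near=> m.
have wd : cell_width a b m < d.
  by near: m; apply: (cvgr_lt _ (cell_width_cvg a b)).
have [|bs sb [ob cb mb]] := discretise_points ab gs wd.
  move=> n n' /andP[nn' n'K]; have nK : (n < K)%N by exact: ltn_trans n'K.
  apply: le_trans (dP (Ordinal nK) isT) _; rewrite lerD2r /= leNgt good_mono // -leNgt.
  by rewrite lerD2l lez_nat.
pose w := [seq X (k + Posz n) | n <- iota 0 K.+1].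
have sw : size w == (count id bs).+1 by rewrite size_map size_iota cb.
have sb' : size bs == m.+1 by rewrite sb.
have := @g_piece m (Tuple sb') (Tuple sw) (X, s) _.
have xB : piece m bs w (X, s).
  by split => //; rewrite /word_cyl /= size_map size_iota.
move=> /(_ xB) ->; rewrite mb /= /word_trajectory /w /=.
have -> : [seq X (k + Posz n) | n <- iota 1 K] = [seq X (k + 1 + Posz n) | n <- iota 0 K].
  by rewrite (iotaDl 1 0) -map_comp; apply: eq_map => n /=; congr X; rewrite PoszD addrA.
have W := word_events_map X k (rd m) 0 K; rewrite addr0 in W.
by rewrite addr0; congr (F (Trajectory _ _)); exact: (esym W).
Unshelve. all: by end_near.
Qed.

(** The expectation of [g m] is, by [parry_msum], a combination of sums [msum] over the regular grid
    of mesh (b - a) / (m + 1), which is the grid of [mlim_cvg]. The two limits in m are then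
    compared. *)
Lemma Rintegral_limit_window : \int[(mu \x P)%E]_x F (limit_window a b x.1 x.2) =
  \sum_(U : T | #|U| == N) \sum_(V : T | #|V| == N) psi U * psi V / @psi_norm R L N *
     (expR (- (l * (b - a))) * mlim k0 a (b - a) (bridge U V F)).
Proof.
(* Being a pointwise limit of the [g m], which vanish off the good sequences, [F0] is measurable; it
   differs from the integrand only on a null set. *)
pose F0 (x : Xs * Ss) : R := if `[< good_times x.2 >] then F (limit_window a b x.1 x.2) else 0.
have gF0 x : g m x @[m --> \oo] --> F0 x.
  rewrite /F0; case: asboolP => gx; first by case: x gx => X s gs; exact: g_cvg.
  by under eq_fun do rewrite g_bad //; exact: cvg_cst.
have mF0 : measurable_fun setT F0 by apply: (measurable_fun_cvg g_meas) => x _; exact: gF0.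
have mbad : measurable (setT `*` ~` (good_times : set Ss) : set (Xs * Ss)).
  by apply: measurableX => //; apply: measurableC; exact: measurable_good.
have bad0 : (mu \x P)%E (setT `*` ~` (good_times : set Ss)) = 0%E.
  rewrite product_measure1E //; last by apply: measurableC; exact: measurable_good.
  rewrite [X in (_ * X)%E](_ : _ = 0%E) ?mule0 //.
  apply: (eq_trans (probability_setC P (measurable_good (R := R)))).
  have P1 : P (good_times : set Ss) = 1%E by case: HP.
  by rewrite [X in (1 - X)%E]P1 subee.
have -> : \int[(mu \x P)%E]_x F (limit_window a b x.1 x.2) = \int[(mu \x P)%E]_x F0 x.
  rewrite /Rintegral; congr fine; apply: (integral_null_ext mbad bad0) => -[X s] /= nb.
  rewrite /F0 asboolT //; apply: contrapT => ng; exact: nb.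
have lim1 := bounded_cvg_Rintegral g_meas mF0 g_le measurable0 (measure0 (mu \x P)%E) (fun x _ => gF0 x).
apply: (seq_cvg_unique lim1); under eq_fun do rewrite Rintegral_g.
rewrite (_ : \sum_(U : T | #|U| == N) _ = expR (- (l * (b - a))) *
   \sum_(U : T | #|U| == N) \sum_(V : T | #|V| == N) psi U * psi V / @psi_norm R L N *
     mlim k0 a (b - a) (bridge U V F)); last first.
  rewrite mulr_sumr; apply: eq_bigr => U _; rewrite mulr_sumr; apply: eq_bigr => V _.
  by rewrite mulrCA.
apply: cvgMr; apply: cvg_big_sum => U _; apply: cvg_big_sum => V _; apply: cvgMr.
have t0 : 0 < b - a by rewrite subr_gt0.
have [_] := mlim_cvg a t0 (bridge_le U V F_le) (@cont_off_bridge_continuous _ _ U V F F_cont)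
  (mark_measurable_bridge k0 U V (continuous_measurable_trajectory F_cont)).
exact.
Qed.

End coupled_process.

Theorem theorem3 (R : realType) (L N : nat) (hL : (2 <= L)%N)
    (hN : (1 <= N <= L - 1)%N)
    (Sin Sfin : {set 'I_L}) (hSin : #|Sin| = N) (hSfin : #|Sfin| = N)
    (M : R -> R -> nat)
    (hM : forall tau : R, 0 < tau ->
       eps * (M tau eps)%:R @[eps --> 0^'+] --> tau) :
  let h : R := ln (sin (pi * N%:R / L%:R) / sin (pi / L%:R)) in
  exists (mu : probability (Zseq {set 'I_L}) R)
         (Q : R -> probability (borel_trajectory R L) R),
  [/\ max_entropy_measure N mu /\
      (forall nu : probability (Zseq {set 'I_L}) R,
         max_entropy_measure N nu ->
         forall A, measurable A -> nu A = mu A),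
      entropy mu = h /\ topological_entropy R L N = h,
      forall tau a b : R, 0 < tau -> a < b ->
        cvg_in_law 0^'+
          (fun eps f => evolution_mean eps Sin Sfin
             (fun c : configuration L (M tau eps) =>
                f (window a b (evolution_trajectory tau eps c))))
          (fun f => \int[Q tau]_w f (window a b w)) &
      forall P : probability (Zseq (measurableTypeR R)) R,
        poisson_process (expR h) P ->
        forall a b : R, a < b ->
        cvg_in_law +oo
          (fun tau f => \int[Q tau]_w f (window a b w))
          (fun f => \int[(mu \x P)%E]_x f (limit_window a b x.1 x.2))].
Proof.
move=> h.
have N_range : (0 < N < L)%N by lia.
pose k0 : 'I_L := Ordinal (ltnW hL).
have lam0 : 0 < lam R L N by exact: lam_gt0.
have eh : expR h = lam R L N by rewrite /h lnK // posrE.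
have [mu [muE mu_max mu_uniq mu_ent]] := exists_parry_measure (R := R) hL N_range.
(* The conditioning is meaningful at every positive tau: irreducibility makes the bridge from [Sin]
   to [Sfin] of positive mass. *)
have mass (tau : R) : 0 < tau -> 0 < mlim k0 (- (tau / 2)) tau (bridge Sin Sfin (fun=> 1)).
  move=> tau0.
  rewrite (mlim_bridge1 k0 tau0 (@mesh_gt0 R) (@mesh_cvg R) (@mesh_size_cvg R tau (ltW tau0))).
  by apply: prop_gt0 => //; rewrite hSin.
have exQ (tau : R) : exists Q : probability (borel_trajectory R L) R, 0 < tau ->
    forall (F : trajectory R L -> R) (C : R), measurable_fun setT (F : borel_trajectory R L -> R) ->
    (forall w, `|F w| <= C) -> \int[Q]_w F w =
    mlim k0 (- (tau / 2)) tau (bridge Sin Sfin F) / mlim k0 (- (tau / 2)) tau (bridge Sin Sfin (fun=> 1)).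
  have [tau0|tau0] := ltP 0 tau.
    have [Q QE] := exists_path_measure tau0 (mass tau tau0).
    by exists Q.
  (* Nothing is asked of the law when tau <= 0; that of duration 1 serves as a default value. *)
  have [Q _] := exists_path_measure (@ltr01 R) (mass 1 ltr01).
  by exists Q.
have [Q QE] := choice exQ.
have QW (tau a b : R) (f : trajectory R L -> R) : 0 < tau -> continuous f ->
    (exists C : R, forall w, `|f w| <= C) -> \int[Q tau]_w f (window a b w) =
    mlim k0 (- (tau / 2)) tau (bridge Sin Sfin (fun w => f (window a b w))) /
    mlim k0 (- (tau / 2)) tau (bridge Sin Sfin (fun=> 1)).
  move=> tau0 cf [C fC]; apply: (QE tau tau0 _ C) => //.
  exact: measurable_fun_window.
exists mu, Q; split.
- by split.
- split; first exact: mu_ent.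
  by apply/cvg_lim => //; exact: cvg_topological_entropy.
- move=> tau a b tau0 ab f cf fb; rewrite QW //.
  apply: (evolution_mean_cvg (M := M tau) hL tau0 cf fb (hM tau tau0)).
  exact/lt0r_neq0/mass.
- move=> P HP a b ab f cf fb; have [C fC] := fb.
  rewrite eh in HP; rewrite (Rintegral_limit_window hL N_range k0 muE HP ab fC cf).
  have lim := window_limit hL ab fC cf N_range hSin hSfin (k0 := k0).
  apply: cvg_trans lim; apply: near_eq_cvg; near=> tau.
  rewrite QW //; near: tau; apply: nbhs_pinfty_gt; exact: num_real.
Unshelve. all: by end_near.
Qed.
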